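(* For $\tau\in\mathbb{C}$ with $\operatorname{Im}\tau\neq0$ let $$x(\tau)=\frac{\wp(1|2,2\tau)-\wp(2|2,2\tau)}{\wp(\tau|2,2\tau)-\wp(2|2,2\tau)}$$ be Burnside's uniformizing function of the curve $y^2=x^5-x$. Then $x=x(\tau)$ satisfies the Schwarz equation $$\frac{\{x,\tau\}}{x_\tau^2}=-\frac12\left\{\frac1{x^2}+\frac1{(x-1)^2}+\frac1{(x+1)^2}+\frac1{(x-i)^2}+\frac1{(x+i)^2}-\frac{4x^3}{x^5-x}\right\}.$$ (This formula fixes the accessory parameters of the equation: the numerator of the last fraction is $4x^3+0$, i.e. its lower-order coefficients all vanish.)
   Context: $\wp(z|\omega,\omega')$ is the Weierstrass elliptic function with half-periods $\omega,\omega'$ (period lattice $2\omega\mathbb{Z}+2\omega'\mathbb{Z}$); thus $\wp(\cdot|2,2\tau)$ has lattice $4\mathbb{Z}+4\tau\mathbb{Z}$. The Schwarzian is $\{x,\tau\}=\dfrac{x_{\tau\tau\tau}}{x_\tau}-\dfrac32\Big(\dfrac{x_{\tau\tau}}{x_\tau}\Big)^2$, with subscripts denoting derivatives. *)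

(* Defs.v *)
(* The complex numbers are [R[i]] for an arbitrary [R : realType].  All complex
   functions are given the type [R[i]^o -> R[i]^o]: the regular module carries
   the normed-module structure over the field [R[i]], so that [derivable] and
   [derive1] mean complex differentiability and the complex derivative. *)
From mathcomp Require Import all_boot all_order all_algebra.
From mathcomp Require Import complex.
From mathcomp Require Import all_classical all_reals all_analysis.
From mathcomp Require Import summability.

Set Implicit Arguments.
Unset Strict Implicit.
Unset Printing Implicit Defensive.

Import Order.TTheory GRing.Theory Num.Theory.
Import numFieldNormedType.Exports.

Local Open Scope ring_scope.

(* wp z w w' is the elliptic function with HALF-periods w and w', i.e. with
   period lattice 2wZ + 2w'Z.  [summability.sum] is the unordered sum: the limit
   of the finite partial sums along the finite subsets of Z x Z.  It is
   meaningful when w, w' are linearly independent over the reals and z is not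
   a lattice point. *)
Definition wp (R : realType) (z w w' : R[i]) : R[i]^o :=
  z ^- 2 +
  summability.sum (fun p : int * int =>
    let l := 2 * w *~ p.1 + 2 * w' *~ p.2 in
    (if p == (0, 0) then 0 else (z - l) ^- 2 - l ^- 2) : R[i]^o).

Definition burnside (R : realType) (tau : R[i]^o) : R[i]^o :=
  (wp 1 2 (2 * tau) - wp 2 2 (2 * tau)) /
  (wp tau 2 (2 * tau) - wp 2 2 (2 * tau)).

Definition schwarzian (R : realType) (f : R[i]^o -> R[i]^o) (t : R[i]^o) :
    R[i]^o :=
  derive1n 3 f t / derive1 f t - 3 / 2 * (derive1n 2 f t / derive1 f t) ^+ 2.

(* Main.v *)
(* Let L = 4Z + 4 tau Z, f(z) = zeta(z) - eta z with 4 eta the period of zeta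
   along 4, so that f has period 4 and f(z + 4 tau) = f(z) - 4 kappa.  The
   function
     K = kappa wp_tau + (wp + eta)^2 - f wp' - wp''/2
   is elliptic and has no pole, hence is constant; integrating in z,
     kappa f_tau + f (wp + eta) + wp'/2
   is constant too, and comparing its values at z, z + 4 and z + 4 tau gives
   kappa_tau = 0 and K = - kappa eta_tau.  At the half-periods this is the
   Darboux-Halphen system for E_i = e_i + eta,
     - kappa E_i' = E_i E_j + E_i E_k - E_j E_k.
   With p = wp(1) - e1 and r = wp(tau) - e1, the half-period product formulas
   p^2 = (e1 - e2)(e1 - e3) and (r + e1 - e3)^2 = (e3 - e1)(e3 - e2) make all
   the e_i - e_j functions of x = p/r and r, and the Halphen system becomes
     x' = - p (1 - x^2) / (2 kappa),  p' = - p (E2 + E3) / kappa,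
     (E2 + E3)' = - 2 E2 E3 / kappa,
   from which the Schwarzian follows by algebra.

   Holomorphy is only ever used through second order Taylor expansions: a
   function having one at every point satisfies the maximum principle, since
   the mean of |a + b w + c w^2|^2 over w, -w, iw, -iw is at least |a|^2. *)
Require Import Defs.
From mathcomp Require Import all_boot all_order all_algebra.
From mathcomp Require Import complex.
From mathcomp Require Import all_classical all_reals all_analysis.
From mathcomp Require Import finmap summability.
From mathcomp Require Import ring lra zify.

Set Implicit Arguments.
Unset Strict Implicit.
Unset Printing Implicit Defensive.

Import Order.TTheory GRing.Theory Num.Theory.
Import numFieldNormedType.Exports.

Local Open Scope ring_scope.

(** The operator kappa d/dtau - f d/dz keeps wp elliptic: differentiating wp(z + 4 tau) = wp(z) in
    tau adds - 4 wp' to wp_tau, and the jump - 4 kappa of f compensates it. The other terms of K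
    remove the poles at 0: the coefficients of z^-4 in wp^2, - f wp' and - wp''/2 are 1, 2 and -3,
    those of eta z^-2 in 2 eta wp and - f wp' are 2 and -2, and wp_tau has no pole there. Everything
    rests on nonvanishing: first of wp'' at the half-periods, hence of the differences e_i - e_j,
    and from these of kappa, whose value is never computed. The same facts keep x away from 0, 1,
    -1, i and -i. The functions p and r are known through quadratic equations only. No square root
    is chosen: the equations are differentiated, and the unknown derivative enters linearly with a
    nonzero coefficient. *)

Section ComplexModulus.
Variable R : realType.
Implicit Types (x y z : R[i]) (a b : R).

(** The norm of [R[i]] takes its values in [R[i]]. This is the same modulus with values in the real
    field, where linear arithmetic and suprema apply. *)
Definition cmod (z : R[i]) : R := Normc.normc z.

Lemma normr_cmod z : `|z| = (cmod z)%:C%C.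
Proof. by case: z. Qed.

Lemma cmod_ge0 z : 0 <= cmod z.
Proof. by case: z => a b; exact: sqrtr_ge0. Qed.

Lemma cmod0 : cmod 0 = 0. Proof. exact: Normc.normc0. Qed.
Lemma cmod1 : cmod 1 = 1. Proof. exact: Normc.normc1. Qed.
Lemma cmodM x y : cmod (x * y) = cmod x * cmod y. Proof. exact: Normc.normcM. Qed.
Lemma cmodV x : cmod x^-1 = (cmod x)^-1. Proof. exact: Normc.normcV. Qed.
Lemma cmodN x : cmod (- x) = cmod x. Proof. exact: (@normcN R x). Qed.
Lemma cmodD x y : cmod (x + y) <= cmod x + cmod y. Proof. exact: (@le_normcD R x y). Qed.

Lemma cmod_eq0 x : (cmod x == 0) = (x == 0).
Proof.
apply/eqP/eqP => [/Normc.eq0_normc //|->]; exact: cmod0.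
Qed.

Lemma cmod_gt0 x : (0 < cmod x) = (x != 0).
Proof. by rewrite lt_def cmod_eq0 cmod_ge0 andbT. Qed.

Lemma cmodX x n : cmod (x ^+ n) = cmod x ^+ n.
Proof. by elim: n => [|n IHn]; rewrite ?expr0 ?cmod1 // !exprS cmodM IHn. Qed.

Lemma cmodM_le x y a b : cmod x <= a -> cmod y <= b -> cmod (x * y) <= a * b.
Proof. by move=> ha hb; rewrite cmodM ler_pM ?cmod_ge0. Qed.

Lemma cmodX_le x a n : cmod x <= a -> cmod (x ^+ n) <= a ^+ n.
Proof.
by move=> ha; rewrite cmodX lerXn2r ?nnegrE ?cmod_ge0 // (le_trans (cmod_ge0 x)).
Qed.

Lemma cmodB x y : cmod (x - y) <= cmod x + cmod y.
Proof. by rewrite -(cmodN y) cmodD. Qed.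

Lemma cmodBC x y : cmod (x - y) = cmod (y - x).
Proof. by rewrite -cmodN opprB. Qed.

Lemma cmod_real a : cmod a%:C%C = `|a|.
Proof. by rewrite /cmod /= expr0n addr0 sqrtr_sqr. Qed.

Lemma cmod_nat n : cmod n%:R = n%:R.
Proof. by rewrite -(rmorph_nat (real_complex R)) cmod_real normr_nat. Qed.

Lemma cmod_sqr z : cmod z ^+ 2 = complex.Re z ^+ 2 + complex.Im z ^+ 2.
Proof. by case: z => a b; rewrite sqr_sqrtr // addr_ge0 ?sqr_ge0. Qed.

Lemma cmod_Re z : `|complex.Re z| <= cmod z.
Proof.
rewrite -(ler_pXn2r (n := 2)) ?nnegrE ?cmod_ge0 // cmod_sqr real_normK ?num_real //.
by rewrite lerDl sqr_ge0.
Qed.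

Lemma cmod_Im z : `|complex.Im z| <= cmod z.
Proof.
rewrite -(ler_pXn2r (n := 2)) ?nnegrE ?cmod_ge0 // cmod_sqr real_normK ?num_real //.
by rewrite lerDr sqr_ge0.
Qed.

Lemma cmod_le_ReIm z : cmod z <= `|complex.Re z| + `|complex.Im z|.
Proof.
rewrite -(ler_pXn2r (n := 2)) ?nnegrE ?cmod_ge0 ?addr_ge0 // cmod_sqr.
rewrite -(real_normK (num_real (complex.Re z))) -(real_normK (num_real (complex.Im z))).
have := normr_ge0 (complex.Re z); have := normr_ge0 (complex.Im z); nra.
Qed.

Lemma cmod_sum (I : Type) (r : seq I) (P : pred I) (F : I -> R[i]) :
  cmod (\sum_(i <- r | P i) F i) <= \sum_(i <- r | P i) cmod (F i).
Proof.
elim/big_rec2: _ => [|i u v _ h]; first by rewrite cmod0.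
by apply: le_trans (cmodD _ _) _; rewrite lerD2l.
Qed.

Lemma cmod_small0 z (M : R) : 0 <= M ->
  (forall e : R, 0 < e -> cmod z <= M * e) -> z = 0.
Proof.
move=> M0 h; apply/eqP; rewrite -cmod_eq0; apply/negP => /negP z0.
have zp : 0 < cmod z by rewrite lt_def z0 cmod_ge0.
have M1 : 0 < M + 1 by lra.
have e0 : 0 < cmod z / (2 * (M + 1)) by rewrite divr_gt0 // mulr_gt0.
have := h _ e0.
suff : M * (cmod z / (2 * (M + 1))) < cmod z by lra.
rewrite mulrA ltr_pdivrMr ?mulr_gt0 //; nra.
Qed.

End ComplexModulus.

Arguments cmod {R} z : simpl never.

(** * Unordered sums and absolute convergence *)

Section UnorderedSum.
Variables (R : realType) (I : choiceType).
Implicit Types (f g : I -> R[i]) (W : I -> R) (s t : R[i]).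

(** A relation rather than an operator: sums are added, scaled and reindexed through it, and [csumE]
    converts the result to the limit that occurs in [wp]. *)
Definition has_sum f s := forall e : R, 0 < e ->
  exists A : {fset I}, forall B : {fset I}, (A `<=` B)%fset ->
    cmod (\sum_(i <- B) f i - s) < e.

Lemma has_sum_unique f s t : has_sum f s -> has_sum f t -> s = t.
Proof.
move=> hs ht; apply/eqP; rewrite -subr_eq0; apply/eqP.
apply: (@cmod_small0 _ _ 2) => // e e0.
have [A hA] := hs e e0; have [B hB] := ht e e0.
have := hA (A `|` B)%fset (fsubsetUl _ _); have := hB (A `|` B)%fset (fsubsetUr _ _).
set S := \sum_(i <- _) _ => h1 h2.
have -> : s - t = (S - t) - (S - s) by ring.
apply: le_trans (cmodB _ _) _; lra.
Qed.

Lemma has_sum_ext f g s : f =1 g -> has_sum f s -> has_sum g s.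
Proof. by move=> /funext ->. Qed.

Lemma has_sumD f g s t : has_sum f s -> has_sum g t ->
  has_sum (fun i => f i + g i) (s + t).
Proof.
move=> hs ht e e0; have e20 : 0 < e / 2 by lra.
have [A hA] := hs _ e20; have [B hB] := ht _ e20.
exists (A `|` B)%fset => D; rewrite fsubUset => /andP[/hA h1 /hB h2].
rewrite big_split /= opprD addrACA.
apply: le_lt_trans (cmodD _ _) _; lra.
Qed.

Lemma has_sumZ a f s : has_sum f s -> has_sum (fun i => a * f i) (a * s).
Proof.
move=> hs e e0; have a1 : 0 < cmod a + 1 by have := cmod_ge0 a; lra.
have [A hA] := hs _ (divr_gt0 e0 a1).
exists A => B /hA; rewrite -mulr_sumr -mulrBr cmodM ltr_pdivlMr // => h.
have := cmod_ge0 a; have := cmod_ge0 (\sum_(i <- B) f i - s); nra.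
Qed.

Lemma has_sumN f s : has_sum f s -> has_sum (fun i => - f i) (- s).
Proof.
move=> /(has_sumZ (-1)); rewrite mulN1r; apply: has_sum_ext => i.
by rewrite mulN1r.
Qed.

Lemma has_sumB f g s t : has_sum f s -> has_sum g t ->
  has_sum (fun i => f i - g i) (s - t).
Proof. by move=> hs /has_sumN; exact: has_sumD. Qed.

Lemma has_sum_pt (i0 : I) (a : R[i]) :
  has_sum (fun i => if i == i0 then a else 0) a.
Proof.
move=> e e0; exists [fset i0]%fset => B; rewrite fsub1set => iB.
rewrite (big_fsetD1 i0) //= eqxx big_seq big1 ?addr0 ?subrr ?cmod0 //.
by move=> i; rewrite !inE => /andP[/negbTE ->].
Qed.

Lemma has_sum_reindex (h k : I -> I) f s :
  cancel h k -> cancel k h -> has_sum f s -> has_sum (f \o h) s.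
Proof.
move=> hk kh hs e e0; have [A hA] := hs e e0.
exists (k @` A)%fset => B AB.
have := hA (h @` B)%fset; rewrite big_imfset /=; last first.
  by move=> x y _ _ /(can_inj hk).
apply; apply/fsubsetP => x xA; apply/imfsetP; exists (k x); last by rewrite kh.
by apply: (fsubsetP AB); apply: in_imfset.
Qed.

Definition summable_weight W :=
  (forall i, 0 <= W i) /\ exists M : R, forall A : {fset I}, \sum_(i <- A) W i <= M.

Lemma has_sum_le f s W (K M : R) : 0 <= K ->
  (forall A : {fset I}, \sum_(i <- A) W i <= M) ->
  (forall i, cmod (f i) <= K * W i) -> has_sum f s -> cmod s <= K * M.
Proof.
move=> K0 hM hf hs; apply/ler_addgt0Pr => e e0; have [A hA] := hs _ e0.
have := hA A (fsubset_refl _); set S := \sum_(i <- _) _ => h1.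
have -> : s = S - (S - s) by ring.
apply: le_trans (cmodB _ _) _.
suff : cmod S <= K * M by lra.
apply: le_trans (cmod_sum _ _ _) _; apply: (@le_trans _ _ (\sum_(i <- A) K * W i)).
  exact: ler_sum.
by rewrite -mulr_sumr ler_wpM2l.
Qed.

(** Partial sums of a nonnegative family increase with the index set, so their supremum is the
    limit. *)
Lemma real_has_sum (W : I -> R) : summable_weight W ->
  exists s : R, has_sum (fun i => (W i)%:C%C) s%:C%C.
Proof.
move=> [W0 [M hM]].
pose E := ((fun A : {fset I} => \sum_(i <- A) W i) @` setT)%classic.
have supE : has_sup E.
  split; first by exists (\sum_(i <- fset0%fset) W i); exists fset0%fset.
  by exists M => _ [A _ <-].
exists (sup E) => e e0.
have [_ [A _ <-] hA] := sup_adherent e0 supE.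
exists A => B AB.
have hB : \sum_(i <- B) W i <= sup E by apply: sup_upper_bound => //; exists B.
have hAB : \sum_(i <- A) W i <= \sum_(i <- B) W i.
  rewrite (big_fsetID _ (fun i => i \in A) B) /=.
  have -> : \sum_(i <- [fset x | x in B & x \in A]%fset) W i = \sum_(i <- A) W i.
    apply: eq_fbigl => i; rewrite !inE /=.
    apply/andP/idP => [[]//|iA]; split=> //; exact: (fsubsetP AB).
  by rewrite lerDl sumr_ge0.
by rewrite -rmorph_sum -rmorphB cmod_real ler0_norm; lra.
Qed.

(** Real and imaginary parts are treated separately; a real family g with |g| <= K W is the
    difference of the nonnegative families g + K W and K W. *)
Lemma has_sum_exists f W (K : R) : summable_weight W ->
  (forall i, cmod (f i) <= K * W i) -> exists s, has_sum f s.
Proof.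
move=> [W0 [M hM]] hf.
wlog K0 : K hf / 0 <= K.
  move=> h; apply: (h `|K|) => // i; apply: le_trans (hf i) _.
  by rewrite ler_wpM2r // ler_norm.
have sW (g : I -> R) : (forall i, `|g i| <= K * W i) ->
    exists s : R, has_sum (fun i => (g i)%:C%C) s%:C%C.
  move=> hg.
  have [|s hs] := @real_has_sum (fun i => g i + K * W i).
    split=> [i|]; first by have := hg i; rewrite ler_norml => /andP[? _]; lra.
    exists (2 * K * M) => A; apply: (@le_trans _ _ (\sum_(i <- A) 2 * K * W i)).
      apply: ler_sum => i _; have := hg i; rewrite ler_norml => /andP[_ ?]; lra.
    by rewrite -mulr_sumr ler_wpM2l // mulr_ge0.
  have [|t ht] := @real_has_sum (fun i => K * W i).
    split=> [i|]; first by rewrite mulr_ge0.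
    by exists (K * M) => A; rewrite -mulr_sumr ler_wpM2l.
  exists (s - t); rewrite rmorphB; have := has_sumB hs ht; apply: has_sum_ext => i.
  by rewrite -rmorphB addrK.
have [|s hs] := sW (fun i => complex.Re (f i)).
  by move=> i; apply: le_trans (cmod_Re _) (hf i).
have [|t ht] := sW (fun i => complex.Im (f i)).
  by move=> i; apply: le_trans (cmod_Im _) (hf i).
exists (s%:C + 'i * t%:C)%C.
have := has_sumD hs (has_sumZ 'i%C ht); apply: has_sum_ext => i.
by rewrite -complexE.
Qed.

End UnorderedSum.

(** * The summation operator *)

Section SumOperator.
Variables (R : realType) (I : choiceType).
Implicit Types (f g : I -> R[i]).

Definition csum f : R[i] := summability.sum (f : I -> R[i]^o).

Lemma csumE f s : has_sum f s -> csum f = s.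
Proof.
move=> hs; rewrite /csum /summability.sum; apply: (@cvg_lim R[i]^o (@norm_hausdorff _ _) _ _ totally_filter).
apply: (iffRL (@cvgrPdist_lt _ R[i]^o _ _ (totally_filter (I:=I)) _ _)) => e e0.
have er : e \is Num.real by rewrite gtr0_real.
have [a ae] : exists a : R, e = a%:C%C by apply/complex_realP.
rewrite {}ae ltcR in e0 * => {er}.
have [A hA] := hs _ e0; exists A => //= B /hA.
rewrite /partial_sum -(big_seq_fsetE _ B xpredT f) /= => h.
by rewrite normr_cmod ltcR cmodBC.
Qed.

Lemma has_csum f W (K : R) : summable_weight W ->
  (forall i, cmod (f i) <= K * W i) -> has_sum f (csum f).
Proof. by move=> sW /(has_sum_exists sW)[s hs]; rewrite (csumE hs). Qed.

End SumOperator.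

(** * Second order Taylor expansions with uniform remainders *)

Section Jets.
Variable R : realType.
Local Notation C := R[i].

Section Families.
Variable I : Type.
Implicit Types (W N : I -> R) (g : I -> C -> C) (a b c : I -> C).

(* The second order Taylor expansion of [g i] at 0, with coefficients and
   remainder controlled by the weight [W i] uniformly in [i].  These bounds are
   stable under products and can be summed over a summable weight, which
   replaces any discussion of uniform convergence. *)
Definition jet W g a b c := exists M d : R, [/\ 0 <= M, 0 < d & forall i,
  [/\ cmod (a i) <= M * W i, cmod (b i) <= M * W i, cmod (c i) <= M * W i
    & forall h, cmod h <= d ->
      cmod (g i h - (a i + b i * h + c i * h ^+ 2)) <= M * W i * cmod h ^+ 3]].

Lemma jet_eq W g a b c g' a' b' c' : jet W g a b c ->
  (forall i h, g i h = g' i h) -> a =1 a' -> b =1 b' -> c =1 c' ->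
  jet W g' a' b' c'.
Proof.
move=> hj hg ha hb hc; suff [-> -> -> ->] : [/\ g' = g, a' = a, b' = b & c' = c] by [].
by split; apply/funext => i; rewrite ?ha ?hb ?hc //; apply/funext => h; rewrite hg.
Qed.

Lemma jet_weaken W W' (K : R) g a b c : 0 <= K -> (forall i, W i <= K * W' i) ->
  jet W g a b c -> jet W' g a b c.
Proof.
move=> K0 hW [M [d [M0 d0 hg]]]; exists (M * K), d; split=> // [|i].
  by rewrite mulr_ge0.
have hM : M * W i <= M * K * W' i by rewrite -mulrA ler_wpM2l.
have [h1 h2 h3 h4] := hg i; split; try by apply: le_trans hM.
move=> h /h4 /le_trans; apply; rewrite ler_wpM2r ?exprn_ge0 ?cmod_ge0 //.
Qed.

Lemma jetD W g a b c g' a' b' c' : (forall i, 0 <= W i) ->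
  jet W g a b c -> jet W g' a' b' c' ->
  jet W (fun i h => g i h + g' i h) (fun i => a i + a' i)
        (fun i => b i + b' i) (fun i => c i + c' i).
Proof.
move=> W0 [M [d [M0 d0 hg]]] [M' [d' [M'0 d'0 hg']]].
exists (M + M'), (Num.min d d'); split=> [||i]; first by rewrite addr_ge0.
  by rewrite lt_min d0.
have [h1 h2 h3 h4] := hg i; have [h1' h2' h3' h4'] := hg' i.
split; try by apply: le_trans (cmodD _ _) _; rewrite mulrDl lerD.
move=> h; rewrite le_min => /andP[/h4 k4 /h4' k4'].
set X := _ - _ in k4; set Y := _ - _ in k4'.
have -> : g i h + g' i h - (a i + a' i + (b i + b' i) * h + (c i + c' i) * h ^+ 2)
  = X + Y by rewrite /X /Y; ring.
by apply: le_trans (cmodD _ _) _; rewrite !mulrDl lerD.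
Qed.

Lemma jetM W W' g a b c g' a' b' c' : (forall i, 0 <= W i) -> (forall i, 0 <= W' i) ->
  jet W g a b c -> jet W' g' a' b' c' ->
  jet (fun i => W i * W' i) (fun i h => g i h * g' i h) (fun i => a i * a' i)
    (fun i => a i * b' i + b i * a' i)
    (fun i => a i * c' i + b i * b' i + c i * a' i).
Proof.
move=> W0 W'0 [M [d [M0 d0 hg]]] [M' [d' [M'0 d'0 hg']]].
(* 10 = 3 + 3 + 3 + 1 collects the bounds [e1] to [e4] of the four parts of the remainder. A radius
   at most 1 absorbs the higher powers of h. *)
exists (10 * (M * M')), (Num.min 1 (Num.min d d')); split=> [||i].
- by rewrite !mulr_ge0.
- by rewrite !lt_min ltr01 d0.
have [h1 h2 h3 h4] := hg i; have [h1' h2' h3' h4'] := hg' i.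
set P := M * W i in h1 h2 h3 h4 *; set P' := M' * W' i in h1' h2' h3' h4' *.
have P0 : 0 <= P by rewrite mulr_ge0.
have P'0 : 0 <= P' by rewrite mulr_ge0.
have PP0 : 0 <= P * P' by rewrite mulr_ge0.
have -> : 10 * (M * M') * (W i * W' i) = 10 * (P * P') by rewrite /P /P'; ring.
have pM x y : cmod x <= P -> cmod y <= P' -> cmod (x * y) <= P * P'.
  by move=> hx hy; rewrite cmodM ler_pM ?cmod_ge0.
have pMa := pM _ _ h1; have pMb := pM _ _ h2; have pMc := pM _ _ h3.
split.
- by have := pMa _ h1'; lra.
- apply: le_trans (cmodD _ _) _; have := pMa _ h2'; have := pMb _ h1'; lra.
- apply: le_trans (cmodD _ _) _; have := cmodD (a i * c' i) (b i * b' i).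
  have := pMa _ h3'; have := pMb _ h2'; have := pMc _ h1'; lra.
move=> h; rewrite !le_min => /and3P[h_le1 /h4 k4 /h4' k4'].
have t0 := cmod_ge0 h; set t := cmod h in t0 h_le1 k4 k4' *.
have t3 : 0 <= t ^+ 3 by rewrite exprn_ge0.
have t31 : t ^+ 3 <= 1 by rewrite exprn_ile1.
have t21 : t ^+ 2 <= 1 by rewrite exprn_ile1.
set X := _ - _ in k4; set Y := _ - _ in k4'.
set A := a i + b i * h + c i * h ^+ 2; set A' := a' i + b' i * h + c' i * h ^+ 2.
have bA (x y z : C) (Q : R) : 0 <= Q -> cmod x <= Q -> cmod y <= Q -> cmod z <= Q ->
    cmod (x + y * h + z * h ^+ 2) <= 3 * Q.
  move=> Q0 hx hy hz; have := cmodD (x + y * h) (z * h ^+ 2).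
  have := cmodD x (y * h); rewrite !(cmodX, cmodM) -/t.
  have : cmod y * t <= Q * 1 by rewrite ler_pM ?cmod_ge0.
  have : cmod z * t ^+ 2 <= Q * 1 by rewrite ler_pM ?cmod_ge0 ?sqr_ge0.
  lra.
have A3 : cmod A <= 3 * P by exact: bA.
have A'3 : cmod A' <= 3 * P' by exact: bA.
have -> : g i h * g' i h - (a i * a' i + (a i * b' i + b i * a' i) * h +
    (a i * c' i + b i * b' i + c i * a' i) * h ^+ 2) =
  (b i * c' i + c i * b' i + (c i * c' i) * h) * h ^+ 3 + A * Y + X * A' + X * Y.
  by rewrite /X /Y /A /A'; ring.
have e1 : cmod ((b i * c' i + c i * b' i + (c i * c' i) * h) * h ^+ 3)
    <= 3 * (P * P') * t ^+ 3.
  rewrite !(cmodX, cmodM) -/t ler_wpM2r //.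
  have := cmodD (b i * c' i + c i * b' i) ((c i * c' i) * h).
  have := cmodD (b i * c' i) (c i * b' i).
  have := pMb _ h3'; have := pMc _ h2'.
  have : cmod ((c i * c' i) * h) <= P * P' * 1.
    by rewrite cmodM ler_pM ?cmod_ge0 // pMc.
  lra.
have e2 : cmod (A * Y) <= 3 * (P * P') * t ^+ 3.
  have : cmod A * cmod Y <= 3 * P * (P' * t ^+ 3) by rewrite ler_pM ?cmod_ge0.
  rewrite cmodM; lra.
have e3 : cmod (X * A') <= 3 * (P * P') * t ^+ 3.
  have : cmod X * cmod A' <= (P * t ^+ 3) * (3 * P') by rewrite ler_pM ?cmod_ge0.
  rewrite cmodM; lra.
have e4 : cmod (X * Y) <= (P * P') * t ^+ 3.
  have : cmod X * cmod Y <= (P * 1) * (P' * t ^+ 3).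
    rewrite ler_pM ?cmod_ge0 // (le_trans k4) // ler_wpM2l //.
  rewrite cmodM; lra.
have := cmodD ((b i * c' i + c i * b' i + (c i * c' i) * h) * h ^+ 3 + A * Y + X * A') (X * Y).
have := cmodD ((b i * c' i + c i * b' i + (c i * c' i) * h) * h ^+ 3 + A * Y) (X * A').
have := cmodD ((b i * c' i + c i * b' i + (c i * c' i) * h) * h ^+ 3) (A * Y).
lra.
Qed.

Lemma jet_affine W a b (K : R) : 0 <= K -> (forall i, 0 <= W i) ->
  (forall i, cmod (a i) <= K * W i) -> (forall i, cmod (b i) <= K * W i) ->
  jet W (fun i h => a i + b i * h) a b (fun=> 0).
Proof.
move=> K0 W0 ha hb; exists K, 1; split=> // i; split=> //.
  by rewrite cmod0 mulr_ge0.
move=> h _; rewrite mul0r addr0 subrr cmod0 mulr_ge0 ?exprn_ge0 ?cmod_ge0 //.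
by rewrite mulr_ge0.
Qed.

(** Since |a i| is at least of size [N i] and |b i| at most of that size, a i + b i h stays
    comparable to [N i] on a disc whose radius does not depend on i. *)
Lemma jet_inv N a b (P : pred I) (k K : R) : 0 < k -> 0 <= K ->
  (forall i, 0 < N i) ->
  (forall i, P i -> k * N i <= cmod (a i)) -> (forall i, cmod (b i) <= K * N i) ->
  jet (fun i => (N i)^-1)
    (fun i h => if P i then (a i + b i * h)^-1 else 0)
    (fun i => if P i then (a i)^-1 else 0)
    (fun i => if P i then - b i * (a i)^-1 ^+ 2 else 0)
    (fun i => if P i then b i ^+ 2 * (a i)^-1 ^+ 3 else 0).
Proof.
move=> k0 K0 N0 ha hb.
(* The summands bound, in units of (N i)^-1, the three coefficients and the remainder. *)
pose M := k^-1 + K * k^-1 ^+ 2 + K ^+ 2 * k^-1 ^+ 3 + 2 * (K ^+ 3 * k^-1 ^+ 4).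
have kV0 : 0 < k^-1 by rewrite invr_gt0.
have M1 : 0 <= k^-1 by rewrite ltW.
have M2 : 0 <= K * k^-1 ^+ 2 by rewrite mulr_ge0 ?exprn_ge0.
have M3 : 0 <= K ^+ 2 * k^-1 ^+ 3 by rewrite mulr_ge0 ?exprn_ge0.
have M4 : 0 <= K ^+ 3 * k^-1 ^+ 4 by rewrite mulr_ge0 ?exprn_ge0.
have K1 : 0 < K + 1 by lra.
(* This radius gives |b i h| <= k N i / 2, at most half of |a i|; K + 1 replaces K because K may be
   0. *)
exists M, (k / (2 * (K + 1))); split=> [||i]; first by rewrite /M; lra.
  by rewrite divr_gt0 // mulr_gt0.
have NV0 : 0 < (N i)^-1 by rewrite invr_gt0.
have MN x : 0 <= x -> x <= M -> x * (N i)^-1 <= M * (N i)^-1.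
  by move=> _ xM; rewrite ler_wpM2r // ltW.
case: (boolP (P i)) => [Pi|_]; last first.
  have MN0 : 0 <= M * (N i)^-1 by rewrite mulr_ge0 ?(ltW NV0) // /M; lra.
  split=> [|||h _]; rewrite ?mul0r ?addr0 ?subr0 ?cmod0 //.
  by rewrite mulr_ge0 // exprn_ge0 // cmod_ge0.
have kN : 0 < k * N i by rewrite mulr_gt0.
have a0 : 0 < cmod (a i) by apply: lt_le_trans (ha i Pi).
have an0 : a i != 0 by rewrite -cmod_gt0.
have aV : cmod (a i)^-1 <= k^-1 * (N i)^-1.
  by rewrite cmodV -invfM lef_pV2 ?posrE ?(mulrC (N i)) // ha.
have NNV : N i * (N i)^-1 = 1 by rewrite divff // gt_eqF.
split.
- by apply: le_trans aV _; apply: MN => //; rewrite /M; lra.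
- apply: (@le_trans _ _ ((K * N i) * (k^-1 * (N i)^-1) ^+ 2)).
    by apply: cmodM_le; [rewrite cmodN|apply: cmodX_le].
  have -> : (K * N i) * (k^-1 * (N i)^-1) ^+ 2 = (K * k^-1 ^+ 2) * (N i * (N i)^-1) * (N i)^-1 by ring.
  by rewrite NNV mulr1; apply: MN => //; rewrite /M; lra.
- apply: (@le_trans _ _ ((K * N i) ^+ 2 * (k^-1 * (N i)^-1) ^+ 3)).
    by apply: cmodM_le; apply: cmodX_le.
  have -> : (K * N i) ^+ 2 * (k^-1 * (N i)^-1) ^+ 3 =
    (K ^+ 2 * k^-1 ^+ 3) * (N i * (N i)^-1) ^+ 2 * (N i)^-1 by ring.
  by rewrite NNV expr1n mulr1; apply: MN => //; rewrite /M; lra.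
move=> h hd.
have bh : cmod (b i * h) <= k * N i / 2.
  rewrite cmodM; apply: (@le_trans _ _ ((K + 1) * N i * (k / (2 * (K + 1))))).
    rewrite ler_pM ?cmod_ge0 // (le_trans (hb i)) // ler_wpM2r ?ltW //; lra.
  rewrite le_eqVlt; apply/orP; left; apply/eqP; field.
  by rewrite gt_eqF.
have ab : k * N i / 2 <= cmod (a i + b i * h).
  have := cmodB (a i + b i * h) (b i * h); rewrite addrK.
  by have := ha i Pi; lra.
have ab0 : 0 < cmod (a i + b i * h) by apply: lt_le_trans ab; lra.
have abn0 : a i + b i * h != 0 by rewrite -cmod_gt0.
have abV : cmod (a i + b i * h)^-1 <= 2 * (k^-1 * (N i)^-1).
  rewrite cmodV -[leRHS]invrK lef_pV2 ?posrE ?invr_gt0 ?mulr_gt0 //.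
  by rewrite !invfM !invrK mulrC.
have -> : (a i + b i * h)^-1 - ((a i)^-1 + - b i * (a i)^-1 ^+ 2 * h +
   b i ^+ 2 * (a i)^-1 ^+ 3 * h ^+ 2) =
   - (b i ^+ 3 * (a i)^-1 ^+ 3 * (a i + b i * h)^-1 * h ^+ 3).
  by field; rewrite an0 abn0.
rewrite cmodN cmodM [cmod (h ^+ 3)]cmodX ler_wpM2r ?exprn_ge0 ?cmod_ge0 //.
apply: (@le_trans _ _ ((K * N i) ^+ 3 * (k^-1 * (N i)^-1) ^+ 3 * (2 * (k^-1 * (N i)^-1)))).
  by apply: (cmodM_le _ abV); apply: cmodM_le; apply: cmodX_le.
have -> : (K * N i) ^+ 3 * (k^-1 * (N i)^-1) ^+ 3 * (2 * (k^-1 * (N i)^-1)) =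
  2 * (K ^+ 3 * k^-1 ^+ 4) * (N i * (N i)^-1) ^+ 3 * (N i)^-1 by ring.
by rewrite NNV expr1n mulr1; apply: MN => //; rewrite /M; lra.
Qed.

End Families.

(** The case of one function, where bounds on the coefficients are automatic. The coefficient c
    plays the part of half the second derivative. *)
Definition sjet (f : C -> C) (a b c : C) := exists M d : R, [/\ 0 <= M, 0 < d &
  forall h, cmod h <= d -> cmod (f h - (a + b * h + c * h ^+ 2)) <= M * cmod h ^+ 3].

Lemma sjetP f a b c :
  sjet f a b c <-> jet (I := unit) (fun=> 1) (fun=> f) (fun=> a) (fun=> b) (fun=> c).
Proof.
split=> [[M [d [M0 d0 hf]]]|[M [d [M0 d0 /(_ tt)[_ _ _ hf]]]]].
  exists (M + cmod a + cmod b + cmod c), d; split=> // [|_].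
    by rewrite !addr_ge0 ?cmod_ge0.
  have := cmod_ge0 a; have := cmod_ge0 b; have := cmod_ge0 c.
  move=> c0 b0 a0; rewrite mulr1; split; try lra.
  move=> h /hf /le_trans; apply; rewrite ler_wpM2r ?exprn_ge0 ?cmod_ge0 //; lra.
by exists M, d; split=> // h /hf; rewrite mulr1.
Qed.

(** Termwise differentiation: the remainders are bounded by [W i] times one constant and |h|^3, so
    [has_sum_le] adds them up. *)
Lemma csum_jet (I : choiceType) (W : I -> R) g a b c :
  summable_weight W -> jet W g a b c ->
  sjet (fun h => csum (g^~ h)) (csum a) (csum b) (csum c).
Proof.
move=> sW [M [d [M0 d0 hg]]]; have [W0 [MW hMW]] := sW.
have MW0 : 0 <= MW by have := hMW fset0; rewrite big_seq_fset0.
exists (M * MW), (Num.min 1 d); split=> [||h]; first by rewrite mulr_ge0.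
  by rewrite lt_min ltr01.
rewrite le_min => /andP[h1 hd].
have t0 := cmod_ge0 h; set t := cmod h in t0 h1 hd *.
have t31 : t ^+ 3 <= 1 by rewrite exprn_ile1.
have t21 : t ^+ 2 <= 1 by rewrite exprn_ile1.
have sa : has_sum a (csum a) by apply: (has_csum (W := W) (K := M)) => // i; have [] := hg i.
have sb : has_sum b (csum b) by apply: (has_csum (W := W) (K := M)) => // i; have [] := hg i.
have sc : has_sum c (csum c) by apply: (has_csum (W := W) (K := M)) => // i; have [] := hg i.
have sg : has_sum (g^~ h) (csum (g^~ h)).
  (* Three coefficients and the remainder each contribute M, because |h| <= 1. *)
  apply: (has_csum (W := W) (K := 4 * M)) => // i.
  have [ha hb hc /(_ h hd)] := hg i; rewrite -/t => hr.
  have P0 : 0 <= M * W i by rewrite mulr_ge0.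
  have : cmod (b i * h) <= M * W i * 1 by rewrite cmodM ler_pM ?cmod_ge0.
  have : cmod (c i * h ^+ 2) <= M * W i * 1.
    by rewrite !(cmodX, cmodM) ler_pM ?cmod_ge0 ?sqr_ge0.
  have : M * W i * t ^+ 3 <= M * W i * 1 by rewrite ler_wpM2l.
  have := cmodD (a i + b i * h) (c i * h ^+ 2); have := cmodD (a i) (b i * h).
  have := cmodD (g i h - (a i + b i * h + c i * h ^+ 2)) (a i + b i * h + c i * h ^+ 2).
  rewrite subrK; lra.
have := has_sumB sg (has_sumD (has_sumD sa (has_sumZ h sb)) (has_sumZ (h ^+ 2) sc)).
move=> /(has_sum_le (W := W) (K := M * t ^+ 3) _ hMW).
rewrite (mulrC h) (mulrC (h ^+ 2)) mulrAC; apply; first by rewrite mulr_ge0 ?exprn_ge0.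
move=> i; have [_ _ _ /(_ h hd)] := hg i.
by rewrite (mulrC h) (mulrC (h ^+ 2)) mulrAC.
Qed.

Lemma sjet_eq f a b c a' b' c' : sjet f a b c -> a = a' -> b = b' -> c = c' ->
  sjet f a' b' c'.
Proof. by move=> ? <- <- <-. Qed.

Lemma sjet_near f g a b c (e : R) : 0 < e -> (forall h, cmod h <= e -> f h = g h) ->
  sjet f a b c -> sjet g a b c.
Proof.
move=> e0 fg [M [d [M0 d0 hf]]]; exists M, (Num.min e d); split=> [||h] //.
  by rewrite lt_min e0.
by rewrite le_min => /andP[he hd]; rewrite -fg // hf.
Qed.

Lemma sjet_const (a : C) : sjet (fun=> a) a 0 0.
Proof.
exists 0, 1; split=> // h _.
by rewrite !mul0r !addr0 subrr cmod0.
Qed.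

Lemma sjet_affine (a b : C) : sjet (fun h => a + b * h) a b 0.
Proof. by exists 0, 1; split=> // h _; rewrite !mul0r !addr0 subrr cmod0. Qed.

Lemma sjet_shift (a : C) : sjet (fun h => a + h) a 1 0.
Proof. by exists 0, 1; split=> // h _; rewrite !mul0r mul1r !addr0 subrr cmod0. Qed.

Lemma sjetD f a b c f' a' b' c' : sjet f a b c -> sjet f' a' b' c' ->
  sjet (fun h => f h + f' h) (a + a') (b + b') (c + c').
Proof. by move=> /sjetP hf /sjetP hf'; apply/sjetP; apply: jetD hf hf'. Qed.

Lemma sjetM f a b c f' a' b' c' : sjet f a b c -> sjet f' a' b' c' ->
  sjet (fun h => f h * f' h) (a * a') (a * b' + b * a') (a * c' + b * b' + c * a').
Proof.
move=> /sjetP hf /sjetP hf'; apply/sjetP.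
apply: (jet_weaken (W := fun=> 1 * 1) (K := 1)) => //.
exact: jetM hf hf'.
Qed.

Lemma sjetZ k f a b c : sjet f a b c -> sjet (fun h => k * f h) (k * a) (k * b) (k * c).
Proof.
move=> /(sjetM (sjet_const k)) /sjet_eq; apply => //; ring.
Qed.

Lemma sjetN f a b c : sjet f a b c -> sjet (fun h => - f h) (- a) (- b) (- c).
Proof.
move=> /(sjetZ (-1)); rewrite !mulN1r; apply: sjet_near (ltr01) _ => h _.
by rewrite mulN1r.
Qed.

Lemma sjetB f a b c f' a' b' c' : sjet f a b c -> sjet f' a' b' c' ->
  sjet (fun h => f h - f' h) (a - a') (b - b') (c - c').
Proof. by move=> hf /sjetN; exact: sjetD. Qed.

Lemma sjetX f a b c : sjet f a b c ->
  sjet (fun h => f h ^+ 2) (a ^+ 2) (2 * a * b) (2 * a * c + b ^+ 2).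
Proof.
by move=> hf; apply: sjet_eq (sjetM hf hf) _ _ _; rewrite ?expr2 //; ring.
Qed.

Lemma sjet_inv_shift (a b : C) : a != 0 ->
  sjet (fun h => (a + b * h)^-1) a^-1 (- b * a^-1 ^+ 2) (b ^+ 2 * a^-1 ^+ 3).
Proof.
move=> a0; apply/sjetP.
apply: (jet_weaken (W := fun=> 1^-1) (K := 1)) => //; first by rewrite invr1 mulr1.
have ha : 0 < cmod a by rewrite cmod_gt0.
apply: (@jet_inv unit (fun=> 1) (fun=> a) (fun=> b) xpredT (cmod a) (cmod b)) => //.
- exact: cmod_ge0.
- by rewrite mulr1.
- by rewrite mulr1.
Qed.

Lemma sjet_invl (a : C) : a != 0 ->
  sjet (fun h => (a + h)^-1) a^-1 (- a^-1 ^+ 2) (a^-1 ^+ 3).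
Proof.
move=> a0; have /sjet_near := sjet_inv_shift 1 a0.
move=> /(_ _ _ ltr01 (fun h _ => _))/sjet_eq; apply=> //; last by ring.
- by move=> h; rewrite mul1r.
- by ring.
Qed.

Lemma sjet_continuous f a b c : sjet f a b c ->
  forall e : R, 0 < e -> exists2 d : R, 0 < d & forall h, cmod h <= d -> cmod (f h - f 0) < e.
Proof.
move=> [M [d [M0 d0 hf]]] e e0.
have f0 : f 0 = a.
  have := hf 0; rewrite cmod0 => /(_ (ltW d0)); rewrite !expr0n !mulr0 !addr0.
  move=> h; apply/eqP; rewrite -subr_eq0 -cmod_eq0 eq_le cmod_ge0 andbT //.
have K0 : 0 < M + cmod b + cmod c + 1 by have := cmod_ge0 b; have := cmod_ge0 c; lra.
exists (Num.min 1 (Num.min d (e / 2 / (M + cmod b + cmod c + 1)))).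
  by rewrite !lt_min ltr01 d0 !divr_gt0.
move=> h; rewrite !le_min => /and3P[h1 /hf hd]; rewrite ler_pdivlMr // => he.
rewrite f0; have t0 := cmod_ge0 h; set t := cmod h in t0 h1 hd he *.
have t3 : t ^+ 3 <= t by rewrite exprS ler_piMr // exprn_ile1.
have t2 : t ^+ 2 <= t by rewrite exprS ler_piMr // expr1.
set X := _ - _ in hd; have -> : f h - a = X + b * h + c * h ^+ 2 by rewrite /X; ring.
have := cmodD (X + b * h) (c * h ^+ 2); have := cmodD X (b * h).
rewrite !(cmodX, cmodM) -/t.
have : M * t ^+ 3 <= M * t by rewrite ler_wpM2l.
have : cmod c * t ^+ 2 <= cmod c * t by rewrite ler_wpM2l ?cmod_ge0.
lra.
Qed.

Lemma sjet_at0 f a b c : sjet f a b c -> f 0 = a.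
Proof.
move=> [M [d [M0 d0 hf]]].
have := hf 0; rewrite cmod0 => /(_ (ltW d0)); rewrite !expr0n !mulr0 !addr0.
move=> h; apply/eqP; rewrite -subr_eq0 -cmod_eq0 eq_le cmod_ge0 andbT //.
Qed.

(** Real increments t > 0 suffice: dividing the difference of the expansions by t and letting t tend
    to 0 gives b = b', a second division gives c = c'. Identities between functions are
    differentiated through this lemma. *)
Lemma sjet_unique f a b c a' b' c' : sjet f a b c -> sjet f a' b' c' ->
  [/\ a = a', b = b' & c = c'].
Proof.
move=> hf hf'; have aa : a = a' by rewrite -(sjet_at0 hf) -(sjet_at0 hf').
rewrite -{}aa in hf' *.
case: hf hf' => M [d [M0 d0 hf]] [M' [d' [M'0 d'0 hf']]].
have key (t : R) : 0 < t -> t <= d -> t <= d' ->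
    cmod ((b - b') + (c - c') * t%:C%C) <= (M + M') * t ^+ 2.
  move=> t0 td td'; have ct : cmod t%:C%C = t by rewrite cmod_real gtr0_norm.
  have := hf t%:C%C; have := hf' t%:C%C; rewrite ct => /(_ td') h1 /(_ td) h2.
  have tn : t%:C%C != 0 :> C by rewrite -cmod_gt0 ct.
  rewrite -(ler_pM2r t0).
  have -> : cmod (b - b' + (c - c') * t%:C%C) * t =
    cmod ((b - b' + (c - c') * t%:C%C) * t%:C%C) by rewrite cmodM ct.
  set X := _ - _ in h1; set Y := _ - _ in h2.
  have -> : (b - b' + (c - c') * t%:C%C) * t%:C%C = X - Y by rewrite /X /Y; ring.
  apply: le_trans (cmodB _ _) _; rewrite -mulrA -exprSr; lra.
have m0 : 0 < Num.min 1 (Num.min d d') by rewrite !lt_min ltr01 d0.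
have cc0 := cmod_ge0 (c - c').
have bb : b - b' = 0.
  apply: (@cmod_small0 _ _ (M + M' + cmod (c - c'))) => [|e e0]; first by lra.
  have [t [t0 t1 td td' te]] : exists t : R, [/\ 0 < t, t <= 1, t <= d, t <= d' & t <= e].
    exists (Num.min e (Num.min 1 (Num.min d d'))).
    by rewrite lt_min e0 m0 !ge_min !lexx !orbT.
  have := key t t0 td td'; set Z := _ * t%:C%C => h.
  have -> : b - b' = (b - b' + Z) - Z by ring.
  apply: le_trans (cmodB _ _) _; rewrite /Z cmodM cmod_real gtr0_norm //.
  have : t ^+ 2 <= t by rewrite exprS expr1 ler_piMr // ltW.
  nra.
split=> //; first by apply/eqP; rewrite -subr_eq0 bb.
apply/eqP; rewrite -subr_eq0; apply/eqP.
apply: (@cmod_small0 _ _ (M + M')) => [|e e0]; first by lra.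
have [t [t0 t1 td td' te]] : exists t : R, [/\ 0 < t, t <= 1, t <= d, t <= d' & t <= e].
  exists (Num.min e (Num.min 1 (Num.min d d'))).
  by rewrite lt_min e0 m0 !ge_min !lexx !orbT.
have := key t t0 td td'; rewrite bb add0r cmodM cmod_real gtr0_norm // expr2 mulrA ler_pM2r //.
move=> h; apply: le_trans h _; rewrite ler_wpM2l //; lra.
Qed.

End Jets.

(** * Maximum principle for functions with second order expansions *)

Section MaximumPrinciple.
Variable R : realType.
Local Notation C := R[i].
Implicit Types (h F : C -> C) (a z w : C) (r : R).

Definition ccont h z := forall e : R, 0 < e ->
  exists2 d : R, 0 < d & forall w, cmod w <= d -> cmod (h (z + w) - h z) < e.

Lemma sjet_ccont h z a b c : sjet (fun w => h (z + w)) a b c -> ccont h z.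
Proof. by move=> /sjet_continuous hz e /hz[d d0 hd]; exists d => // w /hd; rewrite addr0. Qed.

Lemma le_cmod_sub z w : `|cmod z - cmod w| <= cmod (z - w).
Proof.
rewrite ler_norml; have := cmodD (z - w) w; rewrite subrK.
have := cmodD (w - z) z; rewrite subrK cmodBC; lra.
Qed.

(** Reading complex numbers as points of the real plane gives access to compactness of closed discs
    and to the extreme value theorem. *)
Let toC (p : R * R) : C := (p.1 +i* p.2)%C.

Let toC_continuous h p : ccont h (toC p) ->
  {for p, continuous (fun q : R * R => cmod (h (toC q)))}.
Proof.
move=> hc; apply/cvgrPdist_lt => /= e e0; have [d d0 hd] := hc e e0.
have d20 : 0 < d / 2 by lra.
exists (ball p.1 (d / 2), ball p.2 (d / 2)) => /=; first by split; exact: nbhsx_ballx.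
move=> q /= [q1 q2].
apply: le_lt_trans (le_cmod_sub _ _) _; rewrite cmodBC.
have -> : toC q = toC p + toC (q.1 - p.1, q.2 - p.2).
  by rewrite /toC; case: (p) => p1 p2; case: (q) => x y /=; simpc; rewrite !subrKC.
apply: hd; apply: le_trans (cmod_le_ReIm _) _ => /=.
move: q1 q2; rewrite /ball /= => q1 q2.
rewrite (distrC q.1) (distrC q.2); lra.
Qed.

(** With ep > 0 the added term turns the weak mean inequality into a strict one; with ep = 0 this is
    the extreme value theorem on a disc. *)
Lemma disc_max h a r (ep : R) : 0 <= r ->
  (forall z, cmod (z - a) <= r -> ccont h z) ->
  exists2 z0, cmod (z0 - a) <= r & forall z, cmod (z - a) <= r ->
    cmod (h z) ^+ 2 + ep * cmod (z - a) ^+ 2 <=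
    cmod (h z0) ^+ 2 + ep * cmod (z0 - a) ^+ 2.
Proof.
move=> r0 hc.
pose N (p : R * R) := cmod (toC p - a).
have Nc : continuous N.
  move=> p; apply: (@toC_continuous (fun z => z - a)) => e e0.
  exists (e / 2) => [|w hw]; first by lra.
  have -> : toC p + w - a - (toC p - a) = w by ring.
  lra.
pose G (p : R * R) := cmod (h (toC p)).
pose F (p : R * R) := G p * G p + ep * (N p * N p).
pose A : set (R * R) := [set p | cmod (toC p - a) <= r]%classic.
have [|||c cA hmax] := @compact_EVT_max _ R F A _ _ _.
- exists (complex.Re a, complex.Im a); rewrite /A /= /toC /=.
  have -> : (complex.Re a +i* complex.Im a)%C = a by case: (a).
  by rewrite subrr cmod0.
- have : compact ((`[complex.Re a - r, complex.Re a + r] `*`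
                  `[complex.Im a - r, complex.Im a + r]) `&` A)%classic.
    apply: compact_closedI; first by apply: compact_setX; exact: segment_compact.
    have -> : A = (N @^-1` [set x | x <= r])%classic by [].
    by apply: (closed_comp (fun p _ => Nc p)); exact: closed_le.
  congr compact; apply/seteqP; split=> [p []//|p pA]; split=> //.
  have := cmod_Re (toC p - a); have := cmod_Im (toC p - a).
  have hre : complex.Re (toC p - a) = p.1 - complex.Re a by rewrite /toC; case: (a).
  have him : complex.Im (toC p - a) = p.2 - complex.Im a by rewrite /toC; case: (a).
  move: pA; rewrite /A /= hre him => pA /le_trans/(_ pA) h2 /le_trans/(_ pA) h1.
  move: h1 h2; rewrite !ler_norml !in_itv /= => /andP[? ?] /andP[? ?].
  split; apply/andP; split; lra.
- apply: continuous_in_subspaceT => p /set_mem pA.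
  have Gc : {for p, continuous G} by apply: toC_continuous; apply: hc.
  have Npc : {for p, continuous N} by exact: Nc.
  apply: cvgD; first exact: (cvgM Gc Gc).
  by apply: cvgM; [exact: cvg_cst|exact: (cvgM Npc Npc)].
- exists (toC c); first exact: (set_mem cA).
  move=> z hz; have := hmax (complex.Re z, complex.Im z).
  have -> : F (complex.Re z, complex.Im z) = cmod (h z) ^+ 2 + ep * cmod (z - a) ^+ 2.
    by rewrite /F /G /N /toC /= !expr2; case: (z).
  rewrite /F /G /N !expr2; apply; apply: mem_set; rewrite /A /= /toC /=.
  by case: z hz.
Qed.

(** Over the four points the sums of u, u^2 and |u|^2 u vanish, so no cross term survives. *)
Lemma sum4_cmod (q : C -> C) (a b c w : C) :
  (forall u, q u = a + b * u + c * u ^+ 2) ->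
  cmod (q w) ^+ 2 + cmod (q (- w)) ^+ 2 + cmod (q ('i%C * w)) ^+ 2
    + cmod (q (- ('i%C * w))) ^+ 2 =
  4 * (cmod a ^+ 2 + cmod b ^+ 2 * cmod w ^+ 2 + cmod c ^+ 2 * cmod w ^+ 4).
Proof.
move=> hq; rewrite -[4%N]/(2 * 2)%N exprM !cmod_sqr !hq {q hq}.
case: a b c w => [a1 a2] [b1 b2] [c1 c2] [w1 w2].
rewrite !expr2; simpc => /=; ring.
Qed.

(** The mean of |h|^2 + ep |z - a|^2 over four points at distance s exceeds the value at the centre
    by at least ep s^2, up to a Taylor error 2 B M s^3 that is smaller for small s. *)
Lemma no_interior_max h z a (ep : R) : 0 < ep ->
  (exists t, 0 < t /\ forall w, cmod w <= t ->
     cmod (h (z + w)) ^+ 2 + ep * cmod (z + w - a) ^+ 2 <=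
     cmod (h z) ^+ 2 + ep * cmod (z - a) ^+ 2) ->
  forall h0 h1 h2 : C, ~ sjet (fun w => h (z + w)) h0 h1 h2.
Proof.
move=> ep0 [t [t0 hmax]] h0 h1 h2 hj.
have hz : h z = h0 by have := sjet_at0 hj; rewrite addr0.
move: hj => [M [d [M0 d0 hj]]].
pose B := cmod h0 + cmod h1 + cmod h2.
have B0 : 0 <= B by rewrite /B !addr_ge0 ?cmod_ge0.
have BM0 : 0 < 2 * B * M + 1 by have := mulr_ge0 B0 M0; lra.
have [s [s0 s1 st sd sB]] : exists s : R,
    [/\ 0 < s, s <= 1, s <= t, s <= d & s * (2 * B * M + 1) < ep].
  exists (Num.min 1 (Num.min t (Num.min d (ep / 2 / (2 * B * M + 1))))).
  have e20 : 0 < ep / 2 by lra.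
  rewrite !lt_min ltr01 t0 d0 divr_gt0 //; split=> //; rewrite ?ge_min ?lexx ?orbT //.
  set m := Num.min _ _; have : m <= ep / 2 / (2 * B * M + 1) by rewrite /m !ge_min lexx !orbT.
  rewrite ler_pdivlMr //; lra.
pose q w := h0 + h1 * w + h2 * w ^+ 2.
have lowq w : cmod w = s ->
    cmod (q w) ^+ 2 - 2 * B * M * s ^+ 3 + ep * cmod (z - a + w) ^+ 2 <=
    cmod h0 ^+ 2 + ep * cmod (z - a) ^+ 2.
  move=> ws; have := hmax w; rewrite ws hz (addrAC z) => /(_ st) /(le_trans _); apply.
  rewrite lerD2r; have := hj w; rewrite ws => /(_ sd) hr.
  have qB : cmod (q w) <= B.
    have := cmodD (h0 + h1 * w) (h2 * w ^+ 2); have := cmodD h0 (h1 * w).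
    rewrite !cmodM ws.
    have : cmod h1 * s <= cmod h1 by rewrite ler_piMr ?cmod_ge0.
    have : cmod h2 * (s * s) <= cmod h2.
      by rewrite ler_piMr ?cmod_ge0 // mulr_ile1 // ltW.
    rewrite /q /B; lra.
  have := cmodB (h (z + w)) (h (z + w) - q w); rewrite subKr.
  have := cmod_ge0 (h (z + w)); have := cmod_ge0 (q w).
  have s30 : 0 <= M * s ^+ 3 by rewrite mulr_ge0 // exprn_ge0 // ltW.
  move: hr; rewrite -/(q w).
  set x := cmod (h (z + w)); set y := cmod (q w) in qB *; set u := cmod (_ - _).
  have -> : 2 * B * M * s ^+ 3 = 2 * B * (M * s ^+ 3) by ring.
  move: s30; set v := M * s ^+ 3 => v0 uv y0 x0 hy.
  have yxv : y <= x + v by lra.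
  (* Both cases give y^2 - 2 B v <= x^2: the first because y^2 <= B v, the second by squaring y - v
     <= x. *)
  case: (lerP y v) => [yv|vy].
    have : y ^+ 2 <= B * v by rewrite expr2 ler_pM.
    have := sqr_ge0 x; have := mulr_ge0 B0 v0; lra.
  have : (y - v) ^+ 2 <= x ^+ 2 by rewrite lerXn2r ?nnegrE //; lra.
  have : y * v <= B * v by rewrite ler_wpM2r.
  have := sqr_ge0 v; lra.
pose w := s%:C%C : C.
have ws : cmod w = s by rewrite cmod_real gtr0_norm.
have i1 : cmod ('i%C : C) = 1 by rewrite /cmod /= expr0n add0r expr1n sqrtr1.
have iws : cmod ('i%C * w) = s by rewrite cmodM i1 mul1r.
have S1 : cmod (q w) ^+ 2 + cmod (q (- w)) ^+ 2 + cmod (q ('i%C * w)) ^+ 2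
    + cmod (q (- ('i%C * w))) ^+ 2 =
  4 * (cmod h0 ^+ 2 + cmod h1 ^+ 2 * s ^+ 2 + cmod h2 ^+ 2 * s ^+ 4).
  by rewrite -ws -(sum4_cmod (q := q)).
have S2 : cmod (z - a + w) ^+ 2 + cmod (z - a - w) ^+ 2 + cmod (z - a + 'i%C * w) ^+ 2
    + cmod (z - a - 'i%C * w) ^+ 2 = 4 * (cmod (z - a) ^+ 2 + s ^+ 2).
  rewrite (@sum4_cmod (fun u => z - a + u) (z - a) 1 0 w) => [|u]; last by ring.
  by rewrite ws cmod0 cmod1 expr1n mul1r expr0n mul0r addr0.
have b1 : 0 <= cmod h1 ^+ 2 * s ^+ 2 by rewrite mulr_ge0 ?sqr_ge0.
have b2 : 0 <= cmod h2 ^+ 2 * s ^+ 4 by rewrite mulr_ge0 ?sqr_ge0 ?exprn_ge0 ?ltW.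
have key : 2 * B * M * s ^+ 3 < ep * s ^+ 2.
  rewrite -subr_gt0.
  have -> : ep * s ^+ 2 - 2 * B * M * s ^+ 3 = (ep - s * (2 * B * M)) * s ^+ 2 by ring.
  rewrite mulr_gt0 ?exprn_gt0 //; lra.
have := lowq w ws; have := lowq (- w) (etrans (cmodN _) ws).
have := lowq ('i%C * w) iws; have := lowq (- ('i%C * w)) (etrans (cmodN _) iws).
move: S1 S2; set c1 := cmod (z - a + w); set c2 := cmod (z - a - w).
set c3 := cmod (z - a + 'i%C * w); set c4 := cmod (z - a - 'i%C * w) => S1 S2.
have : ep * (c1 ^+ 2 + c2 ^+ 2 + c3 ^+ 2 + c4 ^+ 2) =
  ep * (4 * (cmod (z - a) ^+ 2 + s ^+ 2)) by rewrite S2.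
lra.
Qed.

(** A maximum at a zero of h is harmless, so no expansion is asked for there. This admits quotients
    that are extended by 0 at a singular point. *)
Lemma max_principle h a r (M : R) : 0 <= r -> 0 <= M ->
  (forall z, cmod (z - a) <= r -> ccont h z) ->
  (forall z, cmod (z - a) < r -> h z = 0 \/
     exists h0 h1 h2 : C, sjet (fun w => h (z + w)) h0 h1 h2) ->
  (forall z, cmod (z - a) = r -> cmod (h z) <= M) ->
  forall z, cmod (z - a) <= r -> cmod (h z) <= M.
Proof.
move=> r0 M0 hc hj hM z hz.
rewrite -(ler_pXn2r (n := 2)) ?nnegrE ?cmod_ge0 //.
apply/ler_addgt0Pr => e e0.
have r10 : 0 < r ^+ 2 + 1 by have := sqr_ge0 r; lra.
pose ep := e / (r ^+ 2 + 1).
have ep0 : 0 < ep by rewrite divr_gt0.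
have epr : ep * r ^+ 2 <= e.
  have : ep * (r ^+ 2 + 1) = e by rewrite /ep divfK // gt_eqF.
  lra.
have [z0 z0r hmax] := disc_max ep r0 hc.
have hzmax := hmax z hz.
have zz : 0 <= ep * cmod (z - a) ^+ 2 by rewrite mulr_ge0 ?sqr_ge0 // ltW.
suff hz0 : cmod (h z0) ^+ 2 <= M ^+ 2.
  have : ep * cmod (z0 - a) ^+ 2 <= ep * r ^+ 2.
    by rewrite ler_pM2l // lerXn2r ?nnegrE ?cmod_ge0.
  lra.
move: z0r; rewrite le_eqVlt => /orP[/eqP/hM h0|z0r].
  by rewrite lerXn2r ?nnegrE ?cmod_ge0.
have [->|[h0 [h1 [h2 hj0]]]] := hj z0 z0r; first by rewrite cmod0 expr0n sqr_ge0.
exfalso; apply: (no_interior_max (z := z0) (a := a) ep0 _ hj0).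
exists (r - cmod (z0 - a)); split=> [|w hw]; first by rewrite subr_gt0.
apply: hmax; have := cmodD (z0 - a) w; rewrite addrAC; lra.
Qed.

End MaximumPrinciple.

(** * Identity theorem, Liouville theorem, constancy along lines *)

Section HolomorphicTools.
Variable R : realType.
Local Notation C := R[i].
Implicit Types (f g F v : C -> C) (z w : C).

Definition has_jet f z := exists a b c : C, sjet (fun w => f (z + w)) a b c.

Lemma has_jet_ccont f z : has_jet f z -> ccont f z.
Proof. by move=> [a [b [c /sjet_ccont]]]. Qed.

Lemma has_jetM f g z : has_jet f z -> has_jet g z -> has_jet (fun z => f z * g z) z.
Proof. by move=> [? [? [? hf]]] [? [? [? hg]]]; have := sjetM hf hg; do 3 eexists; eassumption. Qed.

Lemma has_jetD f g z : has_jet f z -> has_jet g z -> has_jet (fun z => f z + g z) z.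
Proof. by move=> [? [? [? hf]]] [? [? [? hg]]]; have := sjetD hf hg; do 3 eexists; eassumption. Qed.

Lemma has_jetN f z : has_jet f z -> has_jet (fun z => - f z) z.
Proof. by move=> [? [? [? hf]]]; have := sjetN hf; do 3 eexists; eassumption. Qed.

Lemma has_jet_cst a z : has_jet (fun=> a) z.
Proof. by do 3 eexists; exact: sjet_const. Qed.

Lemma has_jet_id z : has_jet (fun z => z) z.
Proof. by do 3 eexists; exact: sjet_shift. Qed.

Lemma has_jetX f z n : has_jet f z -> has_jet (fun z => f z ^+ n) z.
Proof.
move=> hf; elim: n => [|n IHn]; first exact: has_jet_cst.
have [a [b [c h]]] := has_jetM hf IHn; exists a, b, c.
by apply: sjet_near (ltr01) _ h => w _; rewrite exprS.
Qed.

Lemma has_jetV_sub a z : z != a -> has_jet (fun z => (z - a)^-1) z.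
Proof.
rewrite -subr_eq0 => /sjet_invl h; do 3 eexists.
by apply: sjet_near (ltr01) _ h => w _; rewrite addrAC.
Qed.

Lemma has_jet_near f g z (d : R) : 0 < d -> (forall w, cmod w <= d -> f (z + w) = g (z + w)) ->
  has_jet f z -> has_jet g z.
Proof. by move=> d0 hd [a [b [c h]]]; exists a, b, c; exact: sjet_near d0 hd h. Qed.

Lemma has_jet_shift f z a : has_jet f (z + a) -> has_jet (fun z => f (z + a)) z.
Proof.
move=> [b [c [d h]]]; exists b, c, d; apply: sjet_near (ltr01) _ h => w _.
by rewrite addrAC.
Qed.

Lemma ccontM f g z : ccont f z -> ccont g z -> ccont (fun z => f z * g z) z.
Proof.
move=> hf hg e e0.
have k0 : 0 < cmod (f z) + cmod (g z) + 1.
  by have := cmod_ge0 (f z); have := cmod_ge0 (g z); lra.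
pose t := Num.min 1 (e / 2 / (cmod (f z) + cmod (g z) + 1)).
have t0 : 0 < t by rewrite lt_min ltr01 !divr_gt0.
have [d1 d10 h1] := hf t t0; have [d2 d20 h2] := hg t t0.
exists (Num.min d1 d2) => [|w]; first by rewrite lt_min d10.
rewrite le_min => /andP[/h1 k1 /h2 k2].
have t1 : t <= 1 by rewrite ge_min lexx.
have te : t * (cmod (f z) + cmod (g z) + 1) <= e / 2.
  by rewrite -ler_pdivlMr // ge_min lexx orbT.
set X := f (z + w) - f z in k1; set Y := g (z + w) - g z in k2.
have -> : f (z + w) * g (z + w) - f z * g z = X * Y + (X * g z + f z * Y).
  by rewrite /X /Y; ring.
have := cmodD (X * Y) (X * g z + f z * Y); have := cmodD (X * g z) (f z * Y).
rewrite !cmodM.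
have : cmod X * cmod Y <= t * 1 by rewrite ler_pM ?cmod_ge0 // ltW // (lt_le_trans k2).
have : cmod X * cmod (g z) <= t * cmod (g z) by rewrite ler_wpM2r ?cmod_ge0 // ltW.
have : cmod (f z) * cmod Y <= cmod (f z) * t by rewrite ler_wpM2l ?cmod_ge0 // ltW.
lra.
Qed.

Lemma ccont_addr f z a : ccont f z -> ccont (fun z => f z + a) z.
Proof.
move=> hf e /hf[d d0 hd]; exists d => // w /hd.
by rewrite opprD addrACA subrr addr0.
Qed.

Lemma geometric_le0 (x q M : R) : 0 <= q < 1 -> (forall n, x <= M * q ^+ n) -> x <= 0.
Proof.
move=> /andP[q0 q1] hx.
have cq : ((fun n => M * q ^+ n) @ \oo --> M * 0)%classic.
  by apply: cvgM; [exact: cvg_cst|apply: cvg_expr; rewrite ger0_norm].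
rewrite mulr0 in cq; rewrite -(cvg_lim _ cq) //.
by apply: limr_ge; [apply/cvg_ex; exists 0|apply: nearW].
Qed.

(* The maximum principle applied to v(z) / z^n, for all n. *)
Lemma zero_on_disc v (r d : R) : 0 < d -> 0 < r ->
  (forall z, cmod z <= r -> has_jet v z) ->
  (forall z, cmod z <= d -> v z = 0) ->
  forall z, cmod z < r -> v z = 0.
Proof.
move=> d0 r0 hv v0.
have [|z0 _ hmax] := @disc_max _ v 0 r 0 (ltW r0).
  by move=> z; rewrite subr0 => /hv/has_jet_ccont.
pose M := cmod (v z0).
have hM z : cmod z <= r -> cmod (v z) <= M.
  have := hmax z; rewrite subr0 !mul0r !addr0 => h /h.
  by rewrite ler_pXn2r ?nnegrE ?cmod_ge0.
move=> z zr; have [->|zn0] := eqVneq z 0; first by rewrite v0 // cmod0 ltW.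
apply/eqP; rewrite -cmod_eq0 eq_le cmod_ge0 andbT.
have cz : 0 < cmod z by rewrite cmod_gt0.
apply: (@geometric_le0 _ (cmod z / r) M) => [|n].
  by rewrite divr_ge0 ?cmod_ge0 ?(ltW r0) //= ltr_pdivrMr // mul1r.
(* Because v vanishes near 0, so does h, whatever value the inverse takes at 0; on the circle of
   radius r it is at most M r^-n. *)
pose h z := v z * (z - 0)^-1 ^+ n.
have h0 : h 0 = 0 by rewrite /h v0 ?mul0r // cmod0 ltW.
have hj u : cmod u <= r -> u != 0 -> has_jet h u.
  move=> /hv hu un0; apply: has_jetM hu _; apply: has_jetX; exact: has_jetV_sub.
suff : cmod (h z) <= M * r^-1 ^+ n.
  rewrite /h subr0 cmodM cmodX cmodV [(cmod z)^-1 ^+ n]exprVn ler_pdivrMr ?exprn_gt0 //.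
  by rewrite exprMn mulrA mulrAC.
apply: (@max_principle _ h 0 r _ (ltW r0)); last by rewrite subr0 ltW.
- by rewrite mulr_ge0 ?cmod_ge0 ?exprn_ge0 // invr_ge0 ltW.
- move=> u; rewrite subr0 => ur; have [->|un0] := eqVneq u 0; last first.
    exact/has_jet_ccont/hj.
  move=> e e0; exists d => // w wd.
  by rewrite add0r h0 /h v0 // mul0r subr0 cmod0.
- move=> u; rewrite subr0 => ur; have [->|un0] := eqVneq u 0; first by left.
  by right; apply: hj => //; exact: ltW.
- move=> u; rewrite subr0 => ur; rewrite /h subr0; apply: cmodM_le.
    by apply: hM; rewrite ur.
  by apply: cmodX_le; rewrite cmodV ur.
Qed.

(* The maximum principle on large discs applied to
   F(z) (F(z) - F(z1))^2 / (z - z1) shows that F only takes the values 0 and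
   F(z1); an intermediate value of |F| on a segment then gives F(z1) = 0. *)
Lemma liouville F (B : R) (z00 : C) : (forall z, ccont F z) ->
  (forall z, cmod (F z) <= B) -> (forall z, F z = 0 \/ has_jet F z) ->
  F z00 = 0 -> forall z, F z = 0.
Proof.
move=> Fc FB Fj F00 z1; apply/eqP; apply: contraT => Fz1.
have B0 : 0 <= B by apply: le_trans (cmod_ge0 _) (FB 0).
(* The factor F makes h vanish wherever F has no expansion; the square makes h tend to 0 at z1, so
   that the value 0 taken there is the continuous one. *)
pose h z := F z * ((F z - F z1) ^+ 2 * (z - z1)^-1).
have hz1 : h z1 = 0 by rewrite /h subrr expr0n !mul0r mulr0.
have hj z : F z = 0 \/ has_jet F z -> z != z1 -> h z = 0 \/ has_jet h z.
  move=> [Fz|Fz] zz1; first by left; rewrite /h Fz mul0r.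
  right; apply: has_jetM => //; apply: has_jetM; last exact: has_jetV_sub.
  by apply: has_jetX; apply: has_jetD => //; exact: has_jet_cst.
have hc z : ccont h z.
  have [->|zz1] := eqVneq z z1; last first.
    apply: ccontM => //; apply: ccontM; last exact/has_jet_ccont/has_jetV_sub.
    rewrite [X in ccont X](_ : _ = fun z => (F z - F z1) * (F z - F z1)); last first.
      by apply/funext => u; rewrite expr2.
    by apply: ccontM; exact: ccont_addr.
  have [/eqP|[a [b [c hj1]]]] := Fj z1; first by rewrite (negbTE Fz1).
  have Fa : F z1 = a by have := sjet_at0 hj1; rewrite addr0.
  move=> e e0; case: hj1 => M [d [M0 d0 hd]].
  pose K := cmod b + cmod c + M.
  have K0 : 0 <= K by rewrite /K !addr_ge0 ?cmod_ge0.
  have BK0 : 0 <= B * K ^+ 2 by rewrite mulr_ge0 ?sqr_ge0.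
  exists (Num.min 1 (Num.min d (e / 2 / (B * K ^+ 2 + 1)))).
    by rewrite !lt_min ltr01 d0 !divr_gt0 //; lra.
  move=> w; rewrite !le_min => /and3P[w1 /hd wd]; rewrite ler_pdivlMr; last by lra.
  move=> we; rewrite hz1 subr0.
  have [->|wn0] := eqVneq w 0; first by rewrite addr0 hz1 cmod0.
  have wc : 0 < cmod w by rewrite cmod_gt0.
  set t := cmod w in w1 wd we wc *.
  have FK : cmod (F (z1 + w) - F z1) <= K * t.
    move: wd; set X := _ - _ => hX.
    have -> : F (z1 + w) - F z1 = X + b * w + c * w ^+ 2 by rewrite /X Fa; ring.
    have := cmodD (X + b * w) (c * w ^+ 2); have := cmodD X (b * w).
    rewrite !cmodM -/t.
    have t3 : t ^+ 3 <= t by rewrite exprS ler_piMr ?(ltW wc) // exprn_ile1 // ltW.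
    have t2 : t * t <= t by rewrite ler_piMr // ltW.
    have : M * t ^+ 3 <= M * t by rewrite ler_wpM2l.
    have : cmod c * (t * t) <= cmod c * t by rewrite ler_wpM2l ?cmod_ge0.
    rewrite /K; lra.
  have : cmod (h (z1 + w)) <= B * ((K * t) ^+ 2 * t^-1).
    rewrite /h [z1 + w - z1]addrC addKr; apply: cmodM_le => //.
    by apply: cmodM_le; [exact: cmodX_le|rewrite cmodV].
  have -> : B * ((K * t) ^+ 2 * t^-1) = t * (B * K ^+ 2).
    by field; rewrite gt_eqF.
  lra.
(* On the circle of radius r around z1 the three factors are at most B, (2 B)^2 and 1/r, and r can
   be taken arbitrarily large. *)
have hb z r : 0 < r -> cmod (z - z1) <= r -> cmod (h z) <= B * ((2 * B) ^+ 2) * r^-1.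
  move=> r0; apply: max_principle (ltW r0) _ _ _ _ z => //.
  - by rewrite !mulr_ge0 ?sqr_ge0 // invr_ge0 ltW.
  - move=> z _; have [->|zz1] := eqVneq z z1; first by left.
    exact: hj.
  - move=> z zr; rewrite /h -mulrA; apply: cmodM_le => //; apply: cmodM_le.
      by apply: cmodX_le; have := cmodB (F z) (F z1); have := FB z; have := FB z1; lra.
    by rewrite cmodV zr.
have h0 z : h z = 0.
  apply: (@cmod_small0 _ _ (B * (2 * B) ^+ 2)) => [|e e0].
    by rewrite mulr_ge0 ?sqr_ge0.
  pose r := cmod (z - z1) + e^-1.
  have r0 : 0 < r by rewrite ltr_wpDl ?cmod_ge0 // invr_gt0.
  apply: le_trans (hb z r r0 _) _; first by rewrite lerDl invr_ge0 ltW.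
  rewrite ler_wpM2l ?mulr_ge0 ?sqr_ge0 // -[leRHS]invrK lef_pV2 ?posrE ?invr_gt0 //.
  by rewrite lerDr cmod_ge0.
have F2 z : F z = 0 \/ F z = F z1.
  have [->|zz1] := eqVneq z z1; first by right.
  have /eqP := h0 z; rewrite !mulf_eq0 invr_eq0 !subr_eq0 (negbTE zz1) orbF orbb.
  by case/orP => /eqP; [left|right].
pose g (t : R) := cmod (F (z00 + t%:C%C * (z1 - z00))).
have gc : continuous g.
  move=> t; apply/cvgrPdist_lt => /= e e0.
  have [d d0 hd] := Fc (z00 + t%:C%C * (z1 - z00)) e e0.
  have k0 : 0 < cmod (z1 - z00) + 1 by have := cmod_ge0 (z1 - z00); lra.
  apply/nbhs_ballP; exists (d / (cmod (z1 - z00) + 1)); first exact: divr_gt0.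
  move=> s; rewrite /ball /= ltr_pdivlMr // => st.
  apply: le_lt_trans (le_cmod_sub _ _) _; rewrite cmodBC.
  have -> : z00 + s%:C%C * (z1 - z00) =
     z00 + t%:C%C * (z1 - z00) + (s - t)%:C%C * (z1 - z00) by rewrite rmorphB; ring.
  apply: hd; rewrite cmodM cmod_real distrC.
  have := normr_ge0 (t - s); lra.
have m0 : 0 < cmod (F z1) by rewrite cmod_gt0.
have g0 : g 0 = 0 by rewrite /g mul0r addr0 F00 cmod0.
have g1 : g 1 = cmod (F z1) by rewrite /g mul1r subrKC.
have [||t _ gt] := @IVT _ g 0 1 (cmod (F z1) / 2) ler01.
- exact: continuous_subspaceT.
- rewrite g0 g1 min_l ?max_r ?(ltW m0) //; apply/andP; split; lra.
have := F2 (z00 + t%:C%C * (z1 - z00)); move: gt; rewrite /g => gt [Ft|Ft].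
  by move: gt; rewrite Ft cmod0; lra.
by move: gt; rewrite Ft; lra.
Qed.

Lemma is_derive0_quadratic (g : R -> R) (t K d : R) : 0 < d ->
  (forall s, `|s| <= d -> `|g (t + s) - g t| <= K * s ^+ 2) -> is_derive t 1 g 0.
Proof.
move=> d0 hg.
have hcv : ((fun s => s^-1 *: ((g \o shift t) (s *: 1) - g t)) @ 0^' --> 0)%classic.
  apply/cvgrPdist_lt => /= e e0.
  have K0 : 0 < `|K| + 1 by have := normr_ge0 K; lra.
  exists (Num.min d (e / (`|K| + 1))) => /=; first by rewrite lt_min d0 divr_gt0.
  move=> s; rewrite /ball_ /= sub0r normrN lt_min => /andP[sd]; rewrite ltr_pdivlMr // => se sn0.
  rewrite sub0r normrN normrM /shift /= [s%:A]mulr1 normfV.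
  have := hg s (ltW sd); rewrite (addrC t) => h.
  have s0 : 0 < `|s| by rewrite normr_gt0.
  rewrite mulrC ltr_pdivrMr //; apply: le_lt_trans h _.
  rewrite -[s ^+ 2]real_normK ?num_real // expr2 mulrA ltr_pM2r //.
  have : K * `|s| <= `|K| * `|s| by rewrite ler_pM2r // ler_norm.
  lra.
apply: DeriveDef; first by apply/cvg_ex; exists 0.
exact: (cvg_lim _ hcv).
Qed.

(** Without a linear term the increments along the line are quadratic, so the real and imaginary
    parts have derivative 0 there. *)
Lemma constant_on_line F (z u : C) :
  (forall t : R, exists a c, sjet (fun w => F (z + t%:C%C * u + w)) a 0 c) ->
  forall s t : R, F (z + s%:C%C * u) = F (z + t%:C%C * u).
Proof.
move=> hF s t.
have quad x : exists K d : R, 0 < d /\ forall y : R, `|y| <= d ->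
    cmod (F (z + (x + y)%:C%C * u) - F (z + x%:C%C * u)) <= K * y ^+ 2.
  have [a [c hj]] := hF x; have aE := sjet_at0 hj; rewrite addr0 in aE.
  case: hj => M [d [M0 d0 hd]].
  have k0 : 0 < cmod u + 1 by have := cmod_ge0 u; lra.
  exists (M * cmod u ^+ 3 + cmod c * cmod u ^+ 2), (Num.min 1 (d / (cmod u + 1))).
  split; first by rewrite lt_min ltr01 divr_gt0.
  move=> y; rewrite le_min ler_pdivlMr // => /andP[y1 yd].
  have -> : z + (x + y)%:C%C * u = z + x%:C%C * u + y%:C%C * u.
    by rewrite rmorphD; ring.
  have cy : cmod (y%:C%C * u) = `|y| * cmod u by rewrite cmodM cmod_real.
  have := hd (y%:C%C * u); rewrite cy => hX0.
  have {hX0} := hX0 ltac:(have := normr_ge0 y; lra).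
  set X := _ - _ => hX; rewrite aE.
  set G := F _ in X hX *.
  have -> : G - a = X + c * (y%:C%C * u) ^+ 2 by rewrite /X; ring.
  apply: le_trans (cmodD _ _) _.
  rewrite [cmod (c * _)]cmodM cmodX cy.
  have -> : y ^+ 2 = `|y| ^+ 2 by rewrite real_normK ?num_real.
  have y3 : `|y| ^+ 3 <= `|y| ^+ 2 by rewrite exprS ler_piMl ?sqr_ge0.
  have : M * cmod u ^+ 3 * `|y| ^+ 3 <= M * cmod u ^+ 3 * `|y| ^+ 2.
    by rewrite ler_wpM2l // mulr_ge0 // exprn_ge0 // cmod_ge0.
  rewrite exprMn in hX; move: hX; rewrite exprMn; lra.
apply/eqP; rewrite eq_complex; apply/andP; split; apply/eqP.
- apply: (@is_derive_0_is_cst _ (fun t : R => complex.Re (F (z + t%:C%C * u)))) => x.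
  have [K [d [d0 hd]]] := quad x; apply: is_derive0_quadratic d0 _ => y /hd.
  by apply: le_trans; apply: le_trans (cmod_Re _); rewrite raddfB.
- apply: (@is_derive_0_is_cst _ (fun t : R => complex.Im (F (z + t%:C%C * u)))) => x.
  have [K [d [d0 hd]]] := quad x; apply: is_derive0_quadratic d0 _ => y /hd.
  by apply: le_trans; apply: le_trans (cmod_Im _); rewrite raddfB.
Qed.

End HolomorphicTools.

(** * The period lattice: growth, separation, summability *)

Section Lattice.
Variable R : realType.
Local Notation C := R[i].
Implicit Types (z tau : C) (p : int * int).

(* The period lattice of [wp _ 2 (2 * tau)]. *)
Definition lat tau p : C := 4 * p.1%:~R + 4 * p.2%:~R * tau.
Definition inL tau z := exists p, z = lat tau p.
(** A size of the index rather than of the lattice point: it does not involve tau, so a single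
    summable weight serves while tau varies. *)
Definition latN p : R := 1 + `|p.1%:~R| + `|p.2%:~R|.

Lemma latN_ge1 p : 1 <= latN p.
Proof. by rewrite /latN -addrA lerDl addr_ge0. Qed.

Lemma latN_gt0 p : 0 < latN p.
Proof. exact: lt_le_trans (latN_ge1 p). Qed.

Lemma latNV_ge0 p : 0 <= (latN p)^-1.
Proof. by rewrite invr_ge0 ltW // latN_gt0. Qed.

Lemma sum_telescope_le (F G : nat -> R) K : (forall k, F k <= G k - G k.+1) ->
  (forall k, 0 <= G k) -> \sum_(k < K) F k <= G 0%N.
Proof.
move=> FG G0; have : \sum_(k < K) F k <= G 0%N - G K.
  elim: K => [|K IHK]; first by rewrite big_ord0 subrr.
  by rewrite big_ord_recr /=; have := FG K; lra.
by have := G0 K; lra.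
Qed.

Lemma sum_subset_le (T : eqType) (s1 s2 : seq T) (F : T -> R) :
  (forall x, 0 <= F x) -> uniq s1 -> {subset s1 <= s2} ->
  \sum_(x <- s1) F x <= \sum_(x <- s2) F x.
Proof.
move=> F0; elim: s1 s2 => [|x s1 IHs] s2 /=; first by rewrite big_nil sumr_ge0.
move=> /andP[xs1 us1] sub; rewrite big_cons (big_rem x (sub x (mem_head _ _))) /=.
rewrite lerD2l; apply: IHs => // y ys1.
have := sub y; rewrite inE ys1 orbT => /(_ isT).
rewrite (perm_mem (perm_to_rem (sub x (mem_head _ _)))) inE => /predU1P[yx|//].
by rewrite -yx ys1 in xs1.
Qed.

Definition int_box (K : nat) : seq int :=
  [seq Posz k | k <- iota 0 K] ++ [seq Negz k | k <- iota 0 K].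

(** Each sign contributes at most G 0 by telescoping. [Negz k] has absolute value k + 1, which is
    where monotonicity of F enters. *)
Lemma sum_int_box K (F : R -> R) (G : nat -> R) :
  (forall x y : R, 0 <= x <= y -> F y <= F x) -> (forall k, F k%:R <= G k - G k.+1) ->
  (forall k, 0 <= G k) ->
  \sum_(n <- int_box K) F `|n%:~R| <= 2 * G 0%N.
Proof.
move=> Fdec FG G0; rewrite big_cat !big_map -[K in iota 0 K]subn0 -/(index_iota 0 K) !big_mkord.
have h1 : \sum_(k < K) F `|(Posz k)%:~R| <= G 0%N.
  apply: (@sum_telescope_le (fun k => F `|(Posz k)%:~R|) G) => // k; rewrite -pmulrn normr_nat //.
have h2 : \sum_(k < K) F `|(Negz k)%:~R| <= G 0%N.
  apply: (@sum_telescope_le (fun k => F `|(Negz k)%:~R|) G) => // k.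
  apply: (le_trans _ (FG k)); apply: Fdec; rewrite ler0n /=.
  by rewrite NegzE mulrNz normrN -pmulrn normr_nat ler_nat.
rewrite /=; lra.
Qed.

Lemma invX_dec (n : nat) (x y : R) : 0 < x -> x <= y -> y^-1 ^+ n <= x^-1 ^+ n.
Proof.
move=> x0 xy; have y0 := lt_le_trans x0 xy.
by rewrite lerXn2r ?nnegrE ?invr_ge0 ?(ltW x0) ?(ltW y0) // lef_pV2 ?posrE.
Qed.

(** A discrete integral comparison. It bounds the sum over n of (1 + |m| + |n|)^-3 by a multiple of
    (1 + |m|)^-2, which [square_tele] then sums over m. *)
Lemma cube_tele (b : R) : 1 <= b -> b^-1 ^+ 3 <= 2 * b^-1 ^+ 2 - 2 * (b + 1)^-1 ^+ 2.
Proof.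
move=> b1; rewrite -subr_ge0.
have -> : 2 * b^-1 ^+ 2 - 2 * (b + 1)^-1 ^+ 2 - b^-1 ^+ 3 =
  (3 * b ^+ 2 - 1) / (b ^+ 3 * (b + 1) ^+ 2).
  by field; apply/andP; split; rewrite gt_eqF //; lra.
rewrite divr_ge0 //; first by nra.
by rewrite mulr_ge0 ?exprn_ge0 //; lra.
Qed.

Lemma square_tele (b : R) : 1 <= b -> b^-1 ^+ 2 <= 2 * b^-1 - 2 * (b + 1)^-1.
Proof.
move=> b1; rewrite -subr_ge0.
have -> : 2 * b^-1 - 2 * (b + 1)^-1 - b^-1 ^+ 2 = (b - 1) / (b ^+ 2 * (b + 1)).
  by field; apply/andP; split; rewrite gt_eqF //; lra.
rewrite divr_ge0 //; first by lra.
by rewrite mulr_ge0 ?exprn_ge0 //; lra.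
Qed.

Lemma latN_summable : summable_weight (fun p => (latN p)^-1 ^+ 3).
Proof.
split=> [p|]; first by rewrite exprn_ge0 // latNV_ge0.
(* The inner sum is at most 4 (1 + |m|)^-2 (2 for the signs, 2 from [cube_tele]); the outer sum
   brings 2 for the signs and 2 from [square_tele]. *)
exists (2 * (4 * (2 * 1^-1))) => A.
have [K hK] : exists K : nat, forall p, p \in A -> p.1 \in int_box K /\ p.2 \in int_box K.
  exists (\sum_(p <- A) (`|p.1| + `|p.2|).+1)%N => p pA.
  have hle : (`|p.1| + `|p.2| < \sum_(q <- A) (`|q.1| + `|q.2|).+1)%N.
    by rewrite (big_fsetD1 p) //= leq_addr.
  have box (m : int) K : (`|m| < K)%N -> m \in int_box K.
    case: m => k hk; rewrite /int_box mem_cat; apply/orP; [left|right].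
      by rewrite mem_map ?mem_iota // => x y [].
    by rewrite mem_map ?mem_iota //= ?(ltnW hk) // => x y [].
  by split; apply: box; apply: leq_ltn_trans hle; [exact: leq_addr|exact: leq_addl].
apply: (@le_trans _ _ (\sum_(p <- [seq (m, n) | m <- int_box K, n <- int_box K]) (latN p)^-1 ^+ 3)).
  apply: sum_subset_le (fset_uniq A) _ => [p|[m n] /hK[mB nB]].
    by rewrite exprn_ge0 // latNV_ge0.
  by apply/allpairsP; exists (m, n).
rewrite big_allpairs.
apply: (@le_trans _ _ (\sum_(m <- int_box K) 4 * (1 + `|m%:~R|)^-1 ^+ 2)).
  apply: ler_sum => m _; set a : R := 1 + `|m%:~R|.
  have a1 : 1 <= a by rewrite lerDl.
  have -> : 4 * a^-1 ^+ 2 = 2 * (2 * (a + 0%:R)^-1 ^+ 2) by rewrite addr0; ring.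
  apply: (@sum_int_box K (fun x => (a + x)^-1 ^+ 3) (fun k => 2 * (a + k%:R)^-1 ^+ 2)).
  - move=> x y /andP[x0 xy]; apply: invX_dec; lra.
  - move=> k; have := ler0n R k => k0; apply: le_trans (cube_tele _) _; first by lra.
    by rewrite -[k.+1%:R]natr1 [a + (_ + 1)]addrA.
  - by move=> k; rewrite mulr_ge0 // sqr_ge0.
rewrite -mulr_sumr.
rewrite [leRHS](_ : _ = 4 * (2 * (2 * (1 + 0%:R)^-1))); last by rewrite addr0; ring.
rewrite ler_pM2l //.
apply: (@sum_int_box K (fun x => (1 + x)^-1 ^+ 2) (fun k => 2 * (1 + k%:R)^-1)).
- move=> x y /andP[x0 xy]; apply: invX_dec; lra.
- move=> k; have := ler0n R k => k0; apply: le_trans (square_tele _) _; first by lra.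
  by rewrite -[k.+1%:R]natr1 [1 + (_ + 1)]addrA.
- by move=> k; rewrite mulr_ge0 // invr_ge0 addr_ge0.
Qed.

Definition lcoord (s t : R) tau : C := 4 * s%:C%C + 4 * t%:C%C * tau.

Lemma lcoord_int tau (p : int * int) : lcoord p.1%:~R p.2%:~R tau = lat tau p.
Proof. by rewrite /lcoord /lat !rmorph_int. Qed.

Lemma lcoordB s t s' t' tau : lcoord s t tau - lcoord s' t' tau = lcoord (s - s') (t - t') tau.
Proof. by rewrite /lcoord !rmorphB; ring. Qed.

Lemma lcoordE s t x y :
  lcoord s t (x +i* y)%C = ((4 * s + 4 * t * x) +i* (4 * t * y))%C.
Proof.
have e4 : (4 : C) = (4%:R : R)%:C%C by rewrite rmorph_nat.
by rewrite /lcoord e4; simpc => /=; congr (_ +i* _)%C; ring.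
Qed.

Lemma lcoord_ex tau z : complex.Im tau != 0 -> exists s t, z = lcoord s t tau.
Proof.
case: tau z => [x y] [a b] /= y0.
exists ((a - b / y * x) / 4), (b / (4 * y)).
by rewrite lcoordE; congr (_ +i* _)%C; field; rewrite y0.
Qed.

Lemma lcoord_lower tau : complex.Im tau != 0 ->
  exists2 c : R, 0 < c & forall s t, c * (`|s| + `|t|) <= cmod (lcoord s t tau).
Proof.
case: tau => [x y] /= y0; have yp : 0 < `|y| by rewrite normr_gt0.
have xp := normr_ge0 x.
(* The imaginary part bounds 4 |t| |y| and the real part bounds 4 |s| - 4 |t| |x|; adding |y| times
   the second to 1 + |x| times the first gives this constant. *)
exists (4 * `|y| / (1 + `|x| + `|y|)); first by rewrite divr_gt0 ?mulr_gt0 //; lra.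
move=> s t; have hL := lcoordE s t x y; set L := cmod (lcoord s t (x +i* y)%C).
rewrite [leLHS]mulrAC ler_pdivrMr; last by lra.
have h1 : `|4 * s + 4 * t * x| <= L by apply: (le_trans _ (cmod_Re _)); rewrite hL.
have h2 : 4 * `|t| * `|y| <= L.
  by apply: (le_trans _ (cmod_Im _)); rewrite hL /= !normrM normr_nat.
have h3 : 4 * `|s| <= L + 4 * `|t| * `|x|.
  have := ler_normB (4 * s + 4 * t * x) (4 * t * x); rewrite addrK !normrM normr_nat; lra.
have : 4 * `|s| * `|y| <= (L + 4 * `|t| * `|x|) * `|y| by rewrite ler_wpM2r.
have : 4 * `|t| * `|y| * `|x| <= L * `|x| by rewrite ler_wpM2r.
lra.
Qed.

Lemma int_gap (s : R) : (forall m : int, s != m%:~R) ->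
  exists2 d : R, 0 < d & forall m : int, d <= `|s - m%:~R|.
Proof.
move=> hs; pose f := Num.floor s.
have f1 : f%:~R <= s by exact: floor_le.
have f2 : s < (f + 1)%:~R by exact: floorD1_gt.
exists (Num.min (s - f%:~R) ((f + 1)%:~R - s)).
  by rewrite lt_min !subr_gt0 f2 lt_def hs f1.
move=> m; rewrite ge_min; case: (lerP m f) => mf; apply/orP; [left|right].
  have : m%:~R <= f%:~R :> R by rewrite ler_int.
  have := ler_norm (s - m%:~R); lra.
have : (f + 1)%:~R <= m%:~R :> R by rewrite ler_int lezD1.
have := ler_norm (m%:~R - s); rewrite distrC; lra.
Qed.

(** The distance to a lattice point is bounded below near z by discreteness and far away by linear
    growth. The predicate P allows z to be a lattice point, as for z = 0 with the index (0, 0) left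
    out. *)
Lemma lat_separated tau z (P : pred (int * int)) : complex.Im tau != 0 ->
  (forall p, P p -> z != lat tau p) ->
  exists2 k : R, 0 < k & forall p, P p -> k * latN p <= cmod (z - lat tau p).
Proof.
move=> ht hP; have [c c0 hc] := lcoord_lower ht.
have [s [t zE]] := lcoord_ex z ht.
have [d d0 hd] : exists2 d : R, 0 < d &
    forall p, P p -> d <= `|s - p.1%:~R| + `|t - p.2%:~R|.
  have [[m hm]|hs] := pselect (exists m : int, s = m%:~R); last first.
    have [|d d0 hd] := @int_gap s; first by move=> m; apply/eqP => sm; apply: hs; exists m.
    by exists d => // p _; apply: le_trans (hd p.1) _; rewrite lerDl.
  have [[n hn]|hs] := pselect (exists n : int, t = n%:~R); last first.
    have [|d d0 hd] := @int_gap t; first by move=> n; apply/eqP => sn; apply: hs; exists n.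
    by exists d => // p _; apply: le_trans (hd p.2) _; rewrite lerDr.
  exists 1 => // p /hP; rewrite zE hm hn.
  have -> : lcoord m%:~R n%:~R tau = lat tau (m, n) by rewrite -lcoord_int.
  move=> hne; rewrite -!intrB -!intr_norm -intrD -(mulr1z 1) ler_int.
  have : (m, n) != p by apply: contraNneq hne => <-.
  by case: (p) => m' n' /=; rewrite xpair_eqE /=; lia.
pose D := 1 + `|s| + `|t|.
have D0 : 0 < D by rewrite /D; have := normr_ge0 s; have := normr_ge0 t; lra.
have dD : 0 < d + D by lra.
(* With x the sum of the coordinate distances, d <= x and latN p <= x + D give d latN p <= (d + D)
   x. *)
exists (c * (d / (d + D))); first by rewrite mulr_gt0 // divr_gt0.
move=> p Pp; rewrite zE -lcoord_int lcoordB; apply: (le_trans _ (hc _ _)).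
rewrite -mulrA ler_pM2l // mulrAC ler_pdivrMr //.
have := hd p Pp; set x := _ + _ => dx.
have Nx : latN p <= x + D.
  have := ler_normB s (s - p.1%:~R); have := ler_normB t (t - p.2%:~R).
  rewrite !subKr /latN /x /D; lra.
nra.
Qed.

Lemma lat0 tau : lat tau (0, 0) = 0.
Proof. by rewrite /lat /= !mulr0 mul0r addr0. Qed.

Lemma lat_neq0 tau p : complex.Im tau != 0 -> p != (0, 0) -> lat tau p != 0.
Proof.
move=> ht hp; have [c c0 hc] := lcoord_lower ht.
rewrite -cmod_gt0 -lcoord_int; apply: (lt_le_trans _ (hc _ _)); rewrite mulr_gt0 //.
case: p hp => m n; rewrite xpair_eqE negb_and /= => /orP[m0|n0].
  by rewrite ltr_wpDr // normr_gt0 intr_eq0.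
by rewrite ltr_wpDl // normr_gt0 intr_eq0.
Qed.

Lemma inL0 tau : inL tau 0.
Proof. by exists (0, 0); rewrite lat0. Qed.

Lemma latD tau p q : lat tau (p + q) = lat tau p + lat tau q.
Proof. by rewrite /lat /= !intrD; ring. Qed.

Lemma latNe tau p : lat tau (- p) = - lat tau p.
Proof. by rewrite /lat /= !mulrNz; ring. Qed.

Lemma inLD tau z w : inL tau z -> inL tau w -> inL tau (z + w).
Proof. by move=> [p ->] [q ->]; exists (p + q); rewrite latD. Qed.

Lemma inLN tau z : inL tau z -> inL tau (- z).
Proof. by move=> [p ->]; exists (- p); rewrite latNe. Qed.

Lemma inL_lcoord tau s t : complex.Im tau != 0 -> inL tau (lcoord s t tau) ->
  exists m n : int, s = m%:~R /\ t = n%:~R.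
Proof.
move=> ht [[m n] /eqP]; rewrite -lcoord_int -subr_eq0 lcoordB /= => /eqP h0.
have [c c0 hc] := lcoord_lower ht; exists m, n.
have := hc (s - m%:~R) (t - n%:~R); rewrite h0 cmod0 pmulr_rle0 // => h.
have h1 : `|s - m%:~R| <= 0 by have := normr_ge0 (t - n%:~R); lra.
have h2 : `|t - n%:~R| <= 0 by have := normr_ge0 (s - m%:~R); lra.
by move: h1 h2; rewrite !normr_le0 !subr_eq0 => /eqP -> /eqP ->.
Qed.

End Lattice.

(** * Lattice series for the regular part of zeta, and their derivatives *)

Section EisensteinSeries.
Variable R : realType.
Local Notation C := R[i].
Implicit Types (z tau : C) (p : int * int).

Lemma jet_has_sum (I : choiceType) (W : I -> R) g a b c : summable_weight W ->
  jet W g a b c -> has_sum a (csum a).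
Proof.
by move=> sW [M [d [_ _ h]]]; apply: (has_csum sW (K := M)) => i; have [] := h i.
Qed.

(* The value 0 at p = (0, 0) removes the origin from all the lattice sums; the
   factor 1/l is written [- latU 0 tau p]. *)
Definition latU z tau p : C := if p != (0, 0) then (z - lat tau p)^-1 else 0.
Definition offL z tau := forall p, p != (0, 0) -> z != lat tau p.

Let NV p : R := (latN R p)^-1.
Let NV0 p : 0 <= NV p := latNV_ge0 R p.
Let N0 p : 0 <= (latN R p : R) := ltW (latN_gt0 R p).
Let W3 p : R := NV p ^+ 3.

(** Moving (z, tau) in the direction (c, d) changes z - lat tau p by (c - 4 p.2 d) h. This
    coefficient grows like [latN p], the growth that [jet_inv] allows. *)
Lemma jet_latU z tau c d : complex.Im tau != 0 -> offL z tau ->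
  jet NV (fun p h => latU (z + c * h) (tau + d * h) p) (latU z tau)
    (fun p => - (c - 4 * p.2%:~R * d) * latU z tau p ^+ 2)
    (fun p => (c - 4 * p.2%:~R * d) ^+ 2 * latU z tau p ^+ 3).
Proof.
move=> ht hz; have [k k0 hk] := lat_separated ht hz.
have := @jet_inv R _ (@latN R) (fun p => z - lat tau p) (fun p => c - 4 * p.2%:~R * d)
  (fun p => p != (0, 0)) k (cmod c + 4 * cmod d) k0.
move=> /(_ _ (@latN_gt0 R) hk) h.
apply: (jet_eq (h _ _)) => [|p|p x|//|p|p].
- by rewrite addr_ge0 ?mulr_ge0 ?cmod_ge0.
- apply: le_trans (cmodB _ _) _; rewrite !cmodM cmod_nat.
  have -> : cmod (p.2%:~R : C) = `|p.2%:~R|.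
    by rewrite -(rmorph_int (real_complex R)) cmod_real.
  have := cmod_ge0 c; have := cmod_ge0 d; set x := cmod c; set y := cmod d.
  move=> y0 x0.
  have h1 : x * 1 <= x * latN R p by rewrite ler_wpM2l // latN_ge1.
  have : `|p.2%:~R : R| * y <= latN R p * y.
    by rewrite ler_wpM2r // /latN lerDr addr_ge0.
  lra.
- rewrite /latU; case: ifP => // _; congr (_^-1).
  by rewrite /lat; ring.
- by rewrite /latU; case: ifP => // _; rewrite expr0n mulr0.
- by rewrite /latU; case: ifP => // _; rewrite expr0n mulr0.
Qed.

Lemma jet_latV tau d : complex.Im tau != 0 ->
  jet NV (fun p h => latU 0 (tau + d * h) p) (latU 0 tau)
    (fun p => 4 * p.2%:~R * d * latU 0 tau p ^+ 2)
    (fun p => (4 * p.2%:~R * d) ^+ 2 * latU 0 tau p ^+ 3).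
Proof.
move=> ht; have /(jet_latU 0 d ht) : offL 0 tau.
  by move=> p hp; rewrite eq_sym lat_neq0.
by move=> /jet_eq; apply => [p h|//|p|p]; rewrite ?mul0r ?addr0 //; ring.
Qed.

(** The unbounded factor p.2 that differentiation in tau produces; its weight is absorbed by one of
    the inverse factors next to it. *)
Lemma jet_latn : jet (@latN R) (fun p _ => p.2%:~R : C) (fun p => p.2%:~R) (fun=> 0) (fun=> 0).
Proof.
have := @jet_affine R (int * int) (@latN R) (fun p => p.2%:~R) (fun=> 0) 1 ler01 N0.
move=> h; apply: (jet_eq (h _ _)) => // [p|p|p x].
- rewrite mul1r -(rmorph_int (real_complex R)) cmod_real /latN.
  by rewrite lerDr addr_ge0.
- by rewrite cmod0 mul1r.
- by rewrite mul0r addr0.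
Qed.

Definition term (j k : nat) z tau p : C := latU 0 tau p ^+ j * latU z tau p ^+ k.

(* [z ^+ 2 * eB0 z tau] is the regular part of zeta at 0, because
   1/(z - l) + 1/l + z/l^2 = z^2 / (l^2 (z - l)).  [eB1], [eB2], [eB3] are the
   z-derivatives of [eB0], while [eBt] and [eB1t] are the tau-derivatives of
   [eB0] and [eB1]. *)
Definition eB0 z tau := csum (term 2 1 z tau).
Definition eB1 z tau := csum (fun p => - term 2 2 z tau p).
Definition eB2 z tau := csum (fun p => 2 * term 2 3 z tau p).
Definition eB3 z tau := csum (fun p => - 6 * term 2 4 z tau p).
Definition eBt z tau :=
  csum (fun p => p.2%:~R * (8 * term 3 1 z tau p + 4 * term 2 2 z tau p)).
Definition eB1t z tau :=
  csum (fun p => p.2%:~R * (- 8 * (term 3 2 z tau p + term 2 3 z tau p))).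

Let WS : summable_weight W3 := latN_summable R.

(** Products of at least three inverse factors are dominated by the summable weight [W3], since
    surplus factors are at most 1 and a factor [latN] cancels one of them. *)
Let W3_1 p : NV p * (NV p * NV p) <= 1 * W3 p.
Proof. by rewrite mul1r /W3 !exprS expr0 mulr1. Qed.

Let NV1 p : NV p <= 1.
Proof. by rewrite invf_le1 ?latN_gt0 ?latN_ge1. Qed.

Let NNV p : latN R p * NV p = 1.
Proof. by rewrite divff // gt_eqF // latN_gt0. Qed.

Let NV20 p : 0 <= NV p * NV p. Proof. by rewrite mulr_ge0. Qed.
Let NV30 p : 0 <= NV p * (NV p * NV p). Proof. by rewrite mulr_ge0. Qed.
Let NV40 p : 0 <= NV p * (NV p * (NV p * NV p)). Proof. by rewrite mulr_ge0. Qed.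
Let NV50 p : 0 <= NV p * (NV p * (NV p * (NV p * NV p))). Proof. by rewrite mulr_ge0. Qed.

Let W3_2 p : NV p * (NV p * (NV p * NV p)) <= 1 * W3 p.
Proof. by apply: (le_trans _ (W3_1 p)); rewrite ler_piMl. Qed.

Let W3_3 p : NV p * (NV p * (NV p * (NV p * NV p))) <= 1 * W3 p.
Proof. by apply: (le_trans _ (W3_2 p)); rewrite ler_piMl. Qed.

Let W3_4 p : NV p * (NV p * (NV p * (NV p * (NV p * NV p)))) <= 1 * W3 p.
Proof. by apply: (le_trans _ (W3_3 p)); rewrite ler_piMl. Qed.

Let W3_n p : latN R p * (NV p * (NV p * (NV p * NV p))) <= 1 * W3 p.
Proof. by rewrite mulrA NNV [leLHS]mul1r; exact: W3_1. Qed.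

Let W3_n2 p : latN R p * (NV p * (NV p * (NV p * (NV p * NV p)))) <= 1 * W3 p.
Proof. by rewrite mulrA NNV [leLHS]mul1r; exact: W3_2. Qed.

Section AtPoint.
Variables (z tau : C) (ht : complex.Im tau != 0) (hz : offL z tau).

Let jU c d := jet_latU c d ht hz.
Let jV d := jet_latV d ht.

(** With V for [latU 0 tau] and U for [latU z tau], the names spell the monomials in V and U; a
    prefix n marks the factor p.2. *)
Let jV2U c d := jetM NV0 NV20 (jV d) (jetM NV0 NV0 (jV d) (jU c d)).
Let jV2U2 c d := jetM NV0 NV30 (jU c d) (jV2U c d).
Let jV2U3 c d := jetM NV0 NV40 (jU c d) (jV2U2 c d).
Let jV2U4 c d := jetM NV0 NV50 (jU c d) (jV2U3 c d).
Let jV3U c d := jetM NV0 NV30 (jV d) (jV2U c d).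
Let jV3U2 c d := jetM NV0 NV40 (jU c d) (jV3U c d).
Let jnV3U c d := jetM N0 NV40 jet_latn (jV3U c d).
Let jnV2U2 c d := jetM N0 NV40 jet_latn (jV2U2 c d).
Let jnV3U2 c d := jetM N0 NV50 jet_latn (jV3U2 c d).
Let jnV2U3 c d := jetM N0 NV50 jet_latn (jV2U3 c d).

Let W30 p : 0 <= W3 p. Proof. by rewrite exprn_ge0. Qed.

Let wk W g a b c (hW : forall p, W p <= 1 * W3 p) (h : jet W g a b c) :
  jet W3 g a b c := jet_weaken ler01 hW h.

Let jcst (k : C) : jet (fun=> 1) (fun (p : int * int) (h : C) => k) (fun=> k) (fun=> 0) (fun=> 0).
Proof.
have := @jet_affine R (int * int) (fun=> 1) (fun=> k) (fun=> 0) (cmod k) (cmod_ge0 k).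
move=> h; apply: (jet_eq (h _ _ _)) => // [p|p|p x].
- by rewrite mulr1.
- by rewrite cmod0 mulr1 cmod_ge0.
- by rewrite mul0r addr0.
Qed.

Let jZ W g a b c (k : C) : (forall p, 0 <= W p) -> jet W g a b c ->
  jet W (fun p h => k * g p h) (fun p => k * a p) (fun p => k * b p) (fun p => k * c p).
Proof.
move=> W0 /(jetM (fun=> ler01) W0 (jcst k)) h.
have hw p : 1 * W p <= 1 * W p by [].
by apply: (jet_eq (jet_weaken (W' := W) ler01 hw h)) => // p; ring.
Qed.

Let jet_t21 c d : exists g, jet W3 (fun p h => term 2 1 (z + c * h) (tau + d * h) p)
  (term 2 1 z tau)
  (fun p => c * - term 2 2 z tau p +
            d * (p.2%:~R * (8 * term 3 1 z tau p + 4 * term 2 2 z tau p))) g.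
Proof.
eexists; apply: (jet_eq (wk W3_1 (jV2U c d))) => [p h|p|p|//]; rewrite /term; ring.
Qed.

Let jet_t21z : jet W3 (fun p h => term 2 1 (z + 1 * h) (tau + 0 * h) p)
  (term 2 1 z tau) (fun p => - term 2 2 z tau p) (fun p => term 2 3 z tau p).
Proof.
apply: (jet_eq (wk W3_1 (jV2U 1 0))) => [p h|p|p|p]; rewrite /term; ring.
Qed.

Let jet_t22 c d : exists g, jet W3 (fun p h => - term 2 2 (z + c * h) (tau + d * h) p)
  (fun p => - term 2 2 z tau p)
  (fun p => c * (2 * term 2 3 z tau p) +
            d * (p.2%:~R * (- 8 * (term 3 2 z tau p + term 2 3 z tau p)))) g.
Proof.
eexists; apply: (jet_eq (jZ (-1) W30 (wk W3_2 (jV2U2 c d)))) => [p h|p|p|//]; rewrite /term; ring.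
Qed.

Let jet_t22z : jet W3 (fun p h => - term 2 2 (z + 1 * h) (tau + 0 * h) p)
  (fun p => - term 2 2 z tau p) (fun p => 2 * term 2 3 z tau p)
  (fun p => - 3 * term 2 4 z tau p).
Proof.
apply: (jet_eq (jZ (-1) W30 (wk W3_2 (jV2U2 1 0)))) => [p h|p|p|p]; rewrite /term; ring.
Qed.

Let jet_t23 : exists g, jet W3 (fun p h => 2 * term 2 3 (z + 1 * h) (tau + 0 * h) p)
  (fun p => 2 * term 2 3 z tau p) (fun p => - 6 * term 2 4 z tau p) g.
Proof.
eexists; apply: (jet_eq (jZ 2 W30 (wk W3_3 (jV2U3 1 0)))) => [p h|p|p|//]; rewrite /term; ring.
Qed.

Let jet_t24 : exists b g, jet W3 (fun p h => - 6 * term 2 4 (z + 1 * h) (tau + 0 * h) p)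
  (fun p => - 6 * term 2 4 z tau p) b g.
Proof.
do 2 eexists; apply: (jet_eq (jZ (- 6) W30 (wk W3_4 (jV2U4 1 0)))) => [p h|p|//|//]; rewrite /term; ring.
Qed.

Let jet_tt : exists g, jet W3
  (fun p h => p.2%:~R * (8 * term 3 1 (z + 1 * h) (tau + 0 * h) p + 4 * term 2 2 (z + 1 * h) (tau + 0 * h) p))
  (fun p => p.2%:~R * (8 * term 3 1 z tau p + 4 * term 2 2 z tau p))
  (fun p => p.2%:~R * (- 8 * (term 3 2 z tau p + term 2 3 z tau p))) g.
Proof.
eexists; apply: (jet_eq (jetD W30 (jZ 8 W30 (wk W3_n (jnV3U 1 0)))
   (jZ 4 W30 (wk W3_n (jnV2U2 1 0))))) => [p h|p|p|//]; rewrite /term; ring.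
Qed.

Let jet_t1t : exists b g, jet W3
  (fun p h => p.2%:~R * (- 8 * (term 3 2 (z + 1 * h) (tau + 0 * h) p + term 2 3 (z + 1 * h) (tau + 0 * h) p)))
  (fun p => p.2%:~R * (- 8 * (term 3 2 z tau p + term 2 3 z tau p))) b g.
Proof.
do 2 eexists; apply: (jet_eq (jetD W30 (jZ (- 8) W30 (wk W3_n2 (jnV3U2 1 0)))
   (jZ (- 8) W30 (wk W3_n2 (jnV2U3 1 0))))) => [p h|p|//|//]; rewrite /term; ring.
Qed.

Let hs22 : has_sum (fun p => - term 2 2 z tau p) (eB1 z tau).
Proof. exact: jet_has_sum WS jet_t22z. Qed.
Let hs23 : has_sum (fun p => 2 * term 2 3 z tau p) (eB2 z tau).
Proof. by have [g /(jet_has_sum WS)] := jet_t23. Qed.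
Let hs24 : has_sum (fun p => - 6 * term 2 4 z tau p) (eB3 z tau).
Proof. by have [b [g /(jet_has_sum WS)]] := jet_t24. Qed.
Let hst : has_sum (fun p => p.2%:~R * (8 * term 3 1 z tau p + 4 * term 2 2 z tau p)) (eBt z tau).
Proof. by have [g /(jet_has_sum WS)] := jet_tt. Qed.
Let hs1t : has_sum (fun p => p.2%:~R * (- 8 * (term 3 2 z tau p + term 2 3 z tau p))) (eB1t z tau).
Proof. by have [b [g /(jet_has_sum WS)]] := jet_t1t. Qed.

Lemma eB0_has_sum : has_sum (term 2 1 z tau) (eB0 z tau).
Proof. exact: jet_has_sum WS jet_t21z. Qed.

Lemma eB1_has_sum : has_sum (fun p => - term 2 2 z tau p) (eB1 z tau).
Proof. exact: hs22. Qed.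

Lemma eB2_has_sum : has_sum (fun p => 2 * term 2 3 z tau p) (eB2 z tau).
Proof. exact: hs23. Qed.

Lemma eB0_jet c d : exists g, sjet (fun h => eB0 (z + c * h) (tau + d * h)) (eB0 z tau)
  (c * eB1 z tau + d * eBt z tau) g.
Proof.
have [g /(csum_jet WS) h] := jet_t21 c d; eexists; apply: (sjet_eq h) => //.
by apply: csumE; apply: has_sumD; apply: has_sumZ.
Qed.

Lemma eB1_jet c d : exists g, sjet (fun h => eB1 (z + c * h) (tau + d * h)) (eB1 z tau)
  (c * eB2 z tau + d * eB1t z tau) g.
Proof.
have [g /(csum_jet WS) h] := jet_t22 c d; eexists; apply: (sjet_eq h) => //.
by apply: csumE; apply: has_sumD; apply: has_sumZ.
Qed.

Let zE f a b c : sjet (fun h : C => f (z + 1 * h) (tau + 0 * h)) a b c ->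
  sjet (fun h : C => f (z + h) tau) a b c.
Proof. by apply: sjet_near ltr01 _ => h _; rewrite mul1r mul0r addr0. Qed.

Lemma eB0_jetz : sjet (fun h => eB0 (z + h) tau) (eB0 z tau) (eB1 z tau) (eB2 z tau / 2).
Proof.
have /(csum_jet WS) h := jet_t21z; apply: zE; apply: (sjet_eq h) => //.
apply: csumE; rewrite mulrC; have := has_sumZ 2^-1 hs23.
by apply: has_sum_ext => p; rewrite mulKf.
Qed.

Lemma eB1_jetz : sjet (fun h => eB1 (z + h) tau) (eB1 z tau) (eB2 z tau) (eB3 z tau / 2).
Proof.
have /(csum_jet WS) h := jet_t22z; apply: zE; apply: (sjet_eq h) => //.
apply: csumE; rewrite mulrC; have := has_sumZ 2^-1 hs24.
by apply: has_sum_ext => p; field.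
Qed.

Lemma eB2_jetz : exists g, sjet (fun h => eB2 (z + h) tau) (eB2 z tau) (eB3 z tau) g.
Proof.
by have [g /(csum_jet WS) h] := jet_t23; eexists; apply: zE; exact: h.
Qed.

Lemma eB3_jetz : exists b g, sjet (fun h => eB3 (z + h) tau) (eB3 z tau) b g.
Proof.
by have [b [g /(csum_jet WS) h]] := jet_t24; do 2 eexists; apply: zE; exact: h.
Qed.

Lemma eBt_jetz : exists g, sjet (fun h => eBt (z + h) tau) (eBt z tau) (eB1t z tau) g.
Proof.
by have [g /(csum_jet WS) h] := jet_tt; eexists; apply: zE; exact: h.
Qed.

Lemma eB1t_jetz : exists b g, sjet (fun h => eB1t (z + h) tau) (eB1t z tau) b g.
Proof.
by have [b [g /(csum_jet WS) h]] := jet_t1t; do 2 eexists; apply: zE; exact: h.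
Qed.

End AtPoint.

End EisensteinSeries.

(** * Zeta and wp: expansions, parity, periods *)

Section Weierstrass.
Variable R : realType.
Local Notation C := R[i].
Implicit Types (z tau w : C) (p : int * int).

(* [wpe1], [wpe2] are the z-derivatives of [wpe]; [wzetat] and [wpet] are the
   tau-derivatives of [wzeta] and [wpe] at fixed z. *)
Definition wzeta z tau : C := z^-1 + z ^+ 2 * eB0 z tau.
Definition wpe z tau : C := z^-1 ^+ 2 - 2 * z * eB0 z tau - z ^+ 2 * eB1 z tau.
Definition wpe1 z tau : C :=
  - 2 * z^-1 ^+ 3 - 2 * eB0 z tau - 4 * z * eB1 z tau - z ^+ 2 * eB2 z tau.
Definition wpe2 z tau : C :=
  6 * z^-1 ^+ 4 - 6 * eB1 z tau - 6 * z * eB2 z tau - z ^+ 2 * eB3 z tau.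
Definition wzetat z tau : C := z ^+ 2 * eBt z tau.
Definition wpet z tau : C := - 2 * z * eBt z tau - z ^+ 2 * eB1t z tau.

Lemma notinL_neq0 tau z : ~ inL tau z -> z != 0.
Proof. by move=> hz; apply: contra_not_neq hz => ->; exact: inL0. Qed.

Lemma notinL_offL tau z : ~ inL tau z -> offL z tau.
Proof. by move=> hz p _; apply: contra_not_neq hz => ->; exists p. Qed.

Lemma notinL_ltr tau z w : inL tau w -> ~ inL tau z -> ~ inL tau (z + w).
Proof. by move=> hw hz /inLD/(_ (inLN hw)); rewrite addrK. Qed.

Lemma inL_period1 tau : inL tau 4.
Proof. by exists (1, 0); rewrite /lat /= mulr1 mulr0 mul0r addr0. Qed.

Lemma inL_period2 tau : inL tau (4 * tau).
Proof. by exists (0, 1); rewrite /lat /= mulr1 mulr0 add0r. Qed.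

Lemma frac_not_int (x : R) (m : int) : 0 < x < 1 -> x = m%:~R -> False.
Proof.
move=> /andP[x0 x1] xm; move: x0 x1; rewrite xm ltr0z ltrz1; lia.
Qed.

Lemma lcoord_notinL tau s t : complex.Im tau != 0 ->
  (forall m : int, s <> m%:~R) \/ (forall m : int, t <> m%:~R) -> ~ inL tau (lcoord s t tau).
Proof. by move=> ht h /(inL_lcoord ht)[m [n [sm tn]]]; case: h => /(_ _) h; [exact: (h m)|exact: (h n)]. Qed.

Lemma half_notinL tau s t : complex.Im tau != 0 -> 0 < s < 1 \/ 0 < t < 1 ->
  ~ inL tau (lcoord s t tau).
Proof.
move=> ht st; apply: lcoord_notinL => //.
by case: st => h; [left|right] => m; exact: frac_not_int.
Qed.

(** Being off the lattice is an open condition in z and tau together: the displacement of z - lat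
    tau p is at most (|c| + 4 |d|) latN p |h|, below the separation k latN p for small h. *)
Lemma notinL_near tau z (c d : C) : complex.Im tau != 0 -> ~ inL tau z ->
  exists2 e : R, 0 < e & forall h, cmod h <= e ->
    complex.Im (tau + d * h) != 0 /\ ~ inL (tau + d * h) (z + c * h).
Proof.
move=> ht hz; have [|k k0 hk] := @lat_separated R tau z xpredT ht.
  by move=> p _; apply: contra_not_neq hz => ->; exists p.
have c0 := cmod_ge0 c; have d0 := cmod_ge0 d.
have K0 : 0 < cmod c + 4 * cmod d + 1 by lra.
have D0 : 0 < cmod d + 1 by lra.
have I0 : 0 < `|complex.Im tau| by rewrite normr_gt0.
exists (Num.min (k / 2 / (cmod c + 4 * cmod d + 1)) (`|complex.Im tau| / 2 / (cmod d + 1))).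
  by rewrite lt_min !divr_gt0.
move=> h; rewrite le_min !ler_pdivlMr // => /andP[h1 h2]; have h0 := cmod_ge0 h.
split.
  rewrite raddfD /= -normr_gt0.
  have := ler_normB (complex.Im tau + complex.Im (d * h)) (complex.Im (d * h)).
  rewrite addrK; have := cmod_Im (d * h); rewrite cmodM; lra.
move=> [p zE]; have := hk p isT.
have -> : z - lat tau p = (4 * p.2%:~R * d - c) * h.
  by rewrite -[z](addrK (c * h)) zE /lat; ring.
apply/negP; rewrite -ltNge cmodM.
have N1 := latN_ge1 R p.
have hN : cmod (4 * p.2%:~R * d - c) <= (cmod c + 4 * cmod d) * latN R p.
  apply: le_trans (cmodB _ _) _; rewrite !cmodM cmod_nat.
  have -> : cmod (p.2%:~R : C) = `|p.2%:~R|.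
    by rewrite -(rmorph_int (real_complex R)) cmod_real.
  have : cmod c * 1 <= cmod c * latN R p by rewrite ler_wpM2l.
  have : `|p.2%:~R : R| * cmod d <= latN R p * cmod d.
    by rewrite ler_wpM2r // /latN lerDr addr_ge0.
  lra.
apply: (@le_lt_trans _ _ ((cmod c + 4 * cmod d) * latN R p * cmod h)).
  by rewrite ler_wpM2r.
have : (cmod c + 4 * cmod d) * cmod h < k by lra.
have N0 : 0 < latN R p by lra.
by rewrite mulrAC ltr_pM2r.
Qed.

Section OffLattice.
Variables (z tau : C) (ht : complex.Im tau != 0) (hz : ~ inL tau z).

Let z0 : z != 0 := notinL_neq0 hz.
Let hoff : offL z tau := notinL_offL hz.

Lemma wzeta_jet (c d : C) : exists g, sjet (fun h => wzeta (z + c * h) (tau + d * h))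
  (wzeta z tau) (c * (- wpe z tau) + d * wzetat z tau) g.
Proof.
have [g hB] := eB0_jet ht hoff c d.
have := sjetD (sjet_inv_shift c z0) (sjetM (sjetX (sjet_affine z c)) hB).
move=> h; eexists; apply: (sjet_eq h) => //.
by rewrite /wpe /wzetat; ring.
Qed.

Lemma wpe_jet (c d : C) : exists g, sjet (fun h => wpe (z + c * h) (tau + d * h))
  (wpe z tau) (c * wpe1 z tau + d * wpet z tau) g.
Proof.
have [g hB] := eB0_jet ht hoff c d; have [g' hB1] := eB1_jet ht hoff c d.
have := sjetB (sjetB (sjetX (sjet_inv_shift c z0))
  (sjetM (sjetZ 2 (sjet_affine z c)) hB)) (sjetM (sjetX (sjet_affine z c)) hB1).
move=> h; eexists; apply: (sjet_eq h) => //.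
by rewrite /wpe1 /wpet; ring.
Qed.

Lemma wpe_jetz : sjet (fun h => wpe (z + h) tau) (wpe z tau) (wpe1 z tau) (wpe2 z tau / 2).
Proof.
have hB := eB0_jetz ht hoff; have hB1 := eB1_jetz ht hoff.
have := sjetB (sjetB (sjetX (sjet_invl z0))
  (sjetM (sjetZ 2 (sjet_shift z)) hB)) (sjetM (sjetX (sjet_shift z)) hB1).
move=> h; apply: (sjet_eq h) => //; first by rewrite /wpe1; ring.
by rewrite /wpe2; field.
Qed.

Lemma wzeta_jetz : exists g, sjet (fun h => wzeta (z + h) tau) (wzeta z tau) (- wpe z tau) g.
Proof.
have [g h] := wzeta_jet 1 0; exists g.
have := sjet_eq h erefl _ erefl; rewrite mul1r mul0r addr0 => /(_ _ erefl).
by apply: sjet_near ltr01 _ => w _; rewrite mul1r mul0r addr0.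
Qed.

Lemma wpe1_jetz : exists g, sjet (fun h => wpe1 (z + h) tau) (wpe1 z tau) (wpe2 z tau) g.
Proof.
have hB := eB0_jetz ht hoff; have hB1 := eB1_jetz ht hoff.
have [g hB2] := eB2_jetz ht hoff.
have hz3 := sjetM (sjet_invl z0) (sjetX (sjet_invl z0)).
have h := sjetB (sjetB (sjetB (sjetZ (- 2) hz3) (sjetZ 2 hB))
  (sjetM (sjetZ 4 (sjet_shift z)) hB1)) (sjetM (sjetX (sjet_shift z)) hB2).
eexists; apply: (sjet_near ltr01 _ (sjet_eq h _ _ erefl)) => [w _||].
- by rewrite /wpe1 [X in - 2 * X]exprS.
- by rewrite /wpe1 [X in - 2 * X]exprS.
- by rewrite /wpe2; ring.
Qed.

Lemma wpe2_jetz : exists b g, sjet (fun h => wpe2 (z + h) tau) (wpe2 z tau) b g.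
Proof.
have hB1 := eB1_jetz ht hoff; have [g hB2] := eB2_jetz ht hoff.
have [b [g' hB3]] := eB3_jetz ht hoff.
have hz4 := sjetX (sjetX (sjet_invl z0)).
have h := sjetB (sjetB (sjetB (sjetZ 6 hz4) (sjetZ 6 hB1))
  (sjetM (sjetZ 6 (sjet_shift z)) hB2)) (sjetM (sjetX (sjet_shift z)) hB3).
do 2 eexists; apply: (sjet_near ltr01 _ (sjet_eq h _ erefl erefl)) => [w _|].
- by rewrite /wpe2 -exprM.
- by rewrite /wpe2 -exprM.
Qed.

Lemma wzetat_jetz : exists g, sjet (fun h => wzetat (z + h) tau) (wzetat z tau) (- wpet z tau) g.
Proof.
have [g hBt] := eBt_jetz ht hoff; have h := sjetM (sjetX (sjet_shift z)) hBt.
by eexists; apply: (sjet_eq h) => //; rewrite /wpet; ring.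
Qed.

Lemma wpet_jetz : exists b g, sjet (fun h => wpet (z + h) tau) (wpet z tau) b g.
Proof.
have [g hBt] := eBt_jetz ht hoff; have [b [g' hB1t]] := eB1t_jetz ht hoff.
have h := sjetB (sjetM (sjetZ (- 2) (sjet_shift z)) hBt) (sjetM (sjetX (sjet_shift z)) hB1t).
by do 2 eexists; apply: (sjet_eq h).
Qed.

(** The series of wp' runs over the whole lattice without correction terms, so its periodicity is a
    reindexing; the periods of wp and zeta are then deduced from it. *)
Lemma wpe1_has_sum :
  has_sum (fun p => (z - lat tau p)^-1 ^+ 3) (- wpe1 z tau / 2).
Proof.
have h0 := eB0_has_sum ht hoff; have h1 := eB1_has_sum ht hoff.
have h2 := eB2_has_sum ht hoff.
have := has_sumD (has_sum_pt (0, 0) (z^-1 ^+ 3))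
  (has_sumD h0 (has_sumD (has_sumZ (2 * z) h1) (has_sumZ (z ^+ 2 / 2) h2))).
have -> : z^-1 ^+ 3 + (eB0 z tau + (2 * z * eB1 z tau + z ^+ 2 / 2 * eB2 z tau)) =
   - wpe1 z tau / 2 by rewrite /wpe1; field.
apply: has_sum_ext => p; rewrite /term /latU.
case: (eqVneq p (0, 0)) => [->|p0] /=.
  by rewrite lat0 subr0 !expr0n /= !(mul0r, mulr0, oppr0, addr0).
have l0 := lat_neq0 ht p0.
have zl0 : z - lat tau p != 0 by rewrite subr_eq0 hoff.
by rewrite sub0r; field; rewrite ?zl0 ?l0 ?oppr_eq0 ?l0.
Qed.

End OffLattice.

Lemma latU_opp z tau p : latU (- z) tau (- p) = - latU z tau p.
Proof.
rewrite /latU; have -> : (- p == (0, 0)) = (p == (0, 0)).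
  by rewrite -(inj_eq oppr_inj) opprK.
case: ifP => _; last by rewrite oppr0.
by rewrite latNe opprK -invrN opprB addrC.
Qed.

Lemma term_opp j k z tau p : term j k (- z) tau (- p) = (-1) ^+ (j + k) * term j k z tau p.
Proof.
rewrite /term latU_opp; have := latU_opp 0 tau p; rewrite oppr0 => ->.
set a := latU 0 _ _; set b := latU z _ _.
by rewrite (exprNn a) (exprNn b) exprD; ring.
Qed.

Lemma eB0_odd z tau : complex.Im tau != 0 -> offL z tau -> eB0 (- z) tau = - eB0 z tau.
Proof.
move=> ht hz; apply: csumE.
have /has_sumN/(has_sum_reindex opprK opprK) := eB0_has_sum ht hz.
apply: has_sum_ext => p /=; have := term_opp 2 1 z tau (- p); rewrite opprK => ->.
by rewrite /=; ring.
Qed.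

Lemma eB1_even z tau : complex.Im tau != 0 -> offL z tau -> eB1 (- z) tau = eB1 z tau.
Proof.
move=> ht hz; apply: csumE.
have /(has_sum_reindex opprK opprK) := eB1_has_sum ht hz.
apply: has_sum_ext => p /=; have := term_opp 2 2 z tau (- p); rewrite opprK => ->.
by rewrite /=; ring.
Qed.

Lemma eB2_odd z tau : complex.Im tau != 0 -> offL z tau -> eB2 (- z) tau = - eB2 z tau.
Proof.
move=> ht hz; apply: csumE.
have /has_sumN/(has_sum_reindex opprK opprK) := eB2_has_sum ht hz.
apply: has_sum_ext => p /=; have := term_opp 2 3 z tau (- p); rewrite opprK => ->.
by rewrite /=; ring.
Qed.

Lemma wzeta_odd z tau : complex.Im tau != 0 -> offL z tau -> wzeta (- z) tau = - wzeta z tau.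
Proof. by move=> ht hz; rewrite /wzeta eB0_odd // invrN; ring. Qed.

Lemma wpe_even z tau : complex.Im tau != 0 -> offL z tau -> wpe (- z) tau = wpe z tau.
Proof. by move=> ht hz; rewrite /wpe eB0_odd // eB1_even // invrN; ring. Qed.

Lemma wpe1_odd z tau : complex.Im tau != 0 -> offL z tau -> wpe1 (- z) tau = - wpe1 z tau.
Proof. by move=> ht hz; rewrite /wpe1 eB0_odd // eB1_even // eB2_odd // invrN; ring. Qed.

(* Any two points off the lattice are joined by segments parallel to the periods
   and avoiding the lattice, through a point with half-integer coordinates. *)
Lemma constant_offL tau (F : C -> C) : complex.Im tau != 0 ->
  (forall z, ~ inL tau z -> exists a c, sjet (fun w => F (z + w)) a 0 c) ->
  forall z w, ~ inL tau z -> ~ inL tau w -> F z = F w.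
Proof.
move=> ht hF.
have hor s s' t : (forall m : int, t <> m%:~R) -> F (lcoord s t tau) = F (lcoord s' t tau).
  move=> htt; have := @constant_on_line R F (lcoord 0 t tau) 4 _ s s'.
  have E (x : R) : lcoord 0 t tau + x%:C%C * 4 = lcoord x t tau by rewrite /lcoord; ring.
  rewrite !E; apply => x; apply: hF; rewrite E; apply: lcoord_notinL => //; by right.
have ver s t t' : (forall m : int, s <> m%:~R) -> F (lcoord s t tau) = F (lcoord s t' tau).
  move=> hs; have := @constant_on_line R F (lcoord s 0 tau) (4 * tau) _ t t'.
  have E (x : R) : lcoord s 0 tau + x%:C%C * (4 * tau) = lcoord s x tau by rewrite /lcoord; ring.
  rewrite !E; apply => x; apply: hF; rewrite E; apply: lcoord_notinL => //; by left.
have hh (m : int) : (1 / 2 : R) <> m%:~R by apply: frac_not_int; apply/andP; split; lra.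
suff base z : ~ inL tau z -> F z = F (lcoord (1 / 2) (1 / 2) tau).
  by move=> z w /base -> /base ->.
have [s [t ->]] := lcoord_ex z ht => hst.
have [[m hm]|nt] := pselect (exists m : int, t = m%:~R); last first.
  rewrite (hor s (1 / 2)) ?(ver (1 / 2) t (1 / 2)) // => m tm; apply: nt; by exists m.
have ns (n : int) : s <> n%:~R.
  by move=> sn; apply: hst; exists (n, m); rewrite -lcoord_int sn hm.
by rewrite (ver s t (1 / 2)) // (hor s (1 / 2)).
Qed.

Section Periodicity.
Variables (tau : C) (ht : complex.Im tau != 0).
Variables (hp : C) (hphp : ~ inL tau hp) (hpL : inL tau (hp + hp)).

Lemma wpe1_period z : ~ inL tau z -> wpe1 (z + (hp + hp)) tau = wpe1 z tau.
Proof.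
case: hpL => q hq hz; have hz' := notinL_ltr hpL hz.
have h1 := wpe1_has_sum ht hz; have h2 := wpe1_has_sum ht hz'.
have hc1 : cancel (fun p => p + q) (fun p => p - q) by exact: addrK.
have hc2 : cancel (fun p => p - q) (fun p => p + q) by exact: subrK.
have h3 := has_sum_reindex hc1 hc2 h2.
have : - wpe1 (z + (hp + hp)) tau / 2 = - wpe1 z tau / 2.
  apply: has_sum_unique h3 _; apply: has_sum_ext h1 => p /=.
  by rewrite hq latD; congr (_^-1 ^+ _); ring.
by move=> /(divIf (y := 2)) h; apply: oppr_inj; apply: h; rewrite pnatr_eq0.
Qed.

Let nhp : ~ inL tau (- hp).
Proof. by move=> /inLN; rewrite opprK. Qed.

(** The difference has derivative 0, hence is constant off the lattice; at - hp it is wp(hp) - wp(-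
    hp) = 0. The quasi-period of zeta is found in the same way, with oddness instead. *)
Lemma wpe_period z : ~ inL tau z -> wpe (z + (hp + hp)) tau = wpe z tau.
Proof.
move=> hz; apply/eqP; rewrite -subr_eq0; apply/eqP.
have := @constant_offL tau (fun z => wpe (z + (hp + hp)) tau - wpe z tau) ht.
move=> /(_ _ z (- hp) hz nhp) ->.
  by rewrite addKr wpe_even ?subrr //; exact: notinL_offL.
move=> u hu; have hu' := notinL_ltr hpL hu.
have := sjetB (wpe_jetz ht hu') (wpe_jetz ht hu).
rewrite wpe1_period // subrr => h; do 2 eexists.
by apply: (sjet_near ltr01 _ h) => w _ /=; rewrite (addrAC u).
Qed.

Lemma wzeta_period z : ~ inL tau z ->
  wzeta (z + (hp + hp)) tau = wzeta z tau + 2 * wzeta hp tau.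
Proof.
move=> hz; apply/eqP; rewrite [_ + 2 * _]addrC -subr_eq; apply/eqP.
have := @constant_offL tau (fun z => wzeta (z + (hp + hp)) tau - wzeta z tau) ht.
move=> /(_ _ z (- hp) hz nhp) ->.
  rewrite addKr wzeta_odd; first by ring. by []. exact: notinL_offL.
move=> u hu; have hu' := notinL_ltr hpL hu.
have [g1 h1] := wzeta_jetz ht hu'; have [g2 h2] := wzeta_jetz ht hu.
have := sjetB h1 h2.
rewrite wpe_period // subrr => h; do 2 eexists.
by apply: (sjet_near ltr01 _ h) => w _ /=; rewrite (addrAC u).
Qed.

Lemma wpe2_period z : ~ inL tau z -> wpe2 (z + (hp + hp)) tau = wpe2 z tau.
Proof.
move=> hz; have hz' := notinL_ltr hpL hz.
have [g1 h1] := wpe1_jetz ht hz'; have [g2 h2] := wpe1_jetz ht hz.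
have [e e0 he] := notinL_near 1 0 ht hz.
have h3 : sjet (fun h => wpe1 (z + h) tau) (wpe1 (z + (hp + hp)) tau)
    (wpe2 (z + (hp + hp)) tau) g1.
  apply: sjet_near e0 _ h1 => h /he[_]; rewrite mul1r mul0r addr0 => hn.
  by rewrite addrAC wpe1_period.
by have [] := sjet_unique h3 h2.
Qed.

Lemma wpe1_half : wpe1 hp tau = 0.
Proof.
have h := wpe1_period nhp; rewrite addKr wpe1_odd // in h; last exact: notinL_offL.
have : 2 * wpe1 hp tau = 0 by rewrite mulrDl mul1r {1}h addNr.
by move/eqP; rewrite mulf_eq0 pnatr_eq0 => /eqP.
Qed.

End Periodicity.

End Weierstrass.

(** * Elliptic functions without poles; wp at the half-periods *)

Section EllipticFunctions.
Variable R : realType.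
Local Notation C := R[i].
Implicit Types (z tau w : C) (F : C -> C) (p : int * int).

Lemma int_period F (u : C) : (forall z, F (z + u) = F z) ->
  forall (m : int) z, F (z + m%:~R * u) = F z.
Proof.
move=> hF; have hn (n : nat) z : F (z + n%:R * u) = F z.
  elim: n z => [|n IHn] z; first by rewrite mul0r addr0.
  by rewrite -natr1 mulrDl mul1r addrA hF IHn.
case=> n z; first by rewrite -pmulrn hn.
by rewrite NegzE mulrNz -pmulrn mulNr -(hn n.+1 (z - _)) subrK.
Qed.

Lemma lat_period F tau : (forall z, F (z + 4) = F z) -> (forall z, F (z + 4 * tau) = F z) ->
  forall p z, F (z + lat tau p) = F z.
Proof.
move=> h1 h2 p z.
have -> : z + lat tau p = z + p.1%:~R * 4 + p.2%:~R * (4 * tau) by rewrite /lat; ring.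
by rewrite !int_period.
Qed.

(* The second alternative deals with the translates of a removable singularity
   at 0, where only continuity is known. *)
Lemma elliptic_const F tau : complex.Im tau != 0 ->
  (forall z, F (z + 4) = F z) -> (forall z, F (z + 4 * tau) = F z) ->
  (forall z, has_jet F z \/ forall w, F (z + w) = F w) -> ccont F 0 ->
  forall z, F z = F 0.
Proof.
move=> ht h1 h2 hj hc0.
have hc z : ccont F z.
  have [/has_jet_ccont//|hz] := hj z.
  by move=> e /hc0[d d0 hd]; exists d => // w /hd; rewrite add0r hz -(addr0 z) hz.
(* The disc of radius r contains the period parallelogram, so the maximum of |F| on it bounds F
   everywhere. *)
pose r : R := 4 + 4 * cmod tau.
have r0 : 0 <= r by rewrite /r; have := cmod_ge0 tau; lra.
have [|z0 _ hmax] := @disc_max _ F 0 r 0 r0; first by move=> z _; exact: hc.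
pose B := cmod (F z0).
have hB z : cmod (F z) <= B.
  have [s [t ->]] := lcoord_ex z ht.
  pose s' := s - (Num.floor s)%:~R; pose t' := t - (Num.floor t)%:~R.
  have -> : lcoord s t tau = lcoord s' t' tau + lat tau (Num.floor s, Num.floor t).
    by rewrite -lcoord_int -lcoordB subrK.
  rewrite lat_period // -(ler_pXn2r (n := 2)) ?nnegrE ?cmod_ge0 //.
  have := hmax (lcoord s' t' tau); rewrite !mul0r !addr0; apply.
  have fr (x : R) : 0 <= x - (Num.floor x)%:~R <= 1.
    have := floor_le x; have := floorD1_gt x; rewrite intrD; lra.
  have /andP[s0 s1] := fr s; have /andP[t0 t1] := fr t.
  rewrite subr0; apply: le_trans (cmodD _ _) _.
  rewrite !cmodM !cmod_real cmod_nat !ger0_norm // /r.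
  have : t' * cmod tau <= 1 * cmod tau by rewrite ler_wpM2r ?cmod_ge0.
  rewrite -/s' -/t' in s0 s1 t0 t1 *; lra.
move=> z; apply/eqP; rewrite -subr_eq0; apply/eqP.
apply: (@liouville _ (fun z => F z - F 0) (2 * B) 0) => [u|u|u|]; last by rewrite subrr.
- exact: ccont_addr.
- by have := cmodB (F u) (F 0); have := hB u; have := hB 0; lra.
- have [hu|hu] := hj u; last by left; have := hu 0; rewrite addr0 => ->; rewrite subrr.
  by right; apply: has_jetD => //; exact: has_jet_cst.
Qed.

Section FixedLattice.
Variables (tau : C) (ht : complex.Im tau != 0).

Lemma notinL_2 : ~ inL tau 2.
Proof.
have := @half_notinL R tau (1 / 2) 0 ht; have -> : lcoord (1 / 2) 0 tau = 2.
  by rewrite /lcoord fmorph_div rmorph1 rmorph_nat rmorph0; field.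
by apply; left; lra.
Qed.

Lemma notinL_2tau : ~ inL tau (2 * tau).
Proof.
have := @half_notinL R tau 0 (1 / 2) ht; have -> : lcoord 0 (1 / 2) tau = 2 * tau.
  by rewrite /lcoord fmorph_div rmorph1 rmorph_nat rmorph0; field.
by apply; right; lra.
Qed.

Lemma notinL_2D2tau : ~ inL tau (2 + 2 * tau).
Proof.
have := @half_notinL R tau (1 / 2) (1 / 2) ht; have -> : lcoord (1 / 2) (1 / 2) tau = 2 + 2 * tau.
  by rewrite /lcoord fmorph_div rmorph1 rmorph_nat; field.
by apply; right; lra.
Qed.

Lemma notinL_1 : ~ inL tau 1.
Proof.
have := @half_notinL R tau (1 / 4) 0 ht; have -> : lcoord (1 / 4) 0 tau = 1.
  by rewrite /lcoord fmorph_div rmorph1 rmorph_nat rmorph0; field.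
by apply; left; lra.
Qed.

Lemma notinL_tau : ~ inL tau tau.
Proof.
have := @half_notinL R tau 0 (1 / 4) ht; have -> : lcoord 0 (1 / 4) tau = tau.
  by rewrite /lcoord fmorph_div rmorph1 rmorph_nat rmorph0; field.
by apply; right; lra.
Qed.

Lemma period1E : 2 + 2 = 4 :> C. Proof. by ring. Qed.
Lemma period2E : 2 * tau + 2 * tau = 4 * tau. Proof. by ring. Qed.

Lemma inL_22 : inL tau (2 + 2). Proof. by rewrite period1E; exact: (@inL_period1 R tau). Qed.
Lemma inL_22tau : inL tau (2 * tau + 2 * tau).
Proof. by rewrite period2E; exact: (@inL_period2 R tau). Qed.

Lemma inL_addr z w : inL tau w -> inL tau (z + w) <-> inL tau z.
Proof.
by move=> hw; split=> [h|h]; [have := inLD h (inLN hw); rewrite addrK|exact: inLD].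
Qed.

(** Prescribing a value on the lattice makes periodicity an identity for all z, as [elliptic_const]
    asks. *)
Definition fill (c : C) F z : C := if `[< inL tau z >] then c else F z.

Lemma fill_in c F z : inL tau z -> fill c F z = c.
Proof. by rewrite /fill => /asboolT ->. Qed.

Lemma fill_out c F z : ~ inL tau z -> fill c F z = F z.
Proof. by rewrite /fill => /asboolF ->. Qed.

Lemma fill_period c F u : inL tau u -> (forall z, ~ inL tau z -> F (z + u) = F z) ->
  forall z, fill c F (z + u) = fill c F z.
Proof.
move=> hu hF z; have [hz|hz] := pselect (inL tau z).
  by rewrite !fill_in //; apply/inL_addr.
by rewrite !fill_out ?hF //; apply: notinL_ltr.
Qed.

Lemma fill_jet c F z : ~ inL tau z -> has_jet F z -> has_jet (fill c F) z.
Proof.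
move=> hz; have [e e0 he] := notinL_near 1 0 ht hz.
apply: has_jet_near e0 _ => w /he[_]; rewrite mul1r mul0r addr0 => hw.
by rewrite fill_out.
Qed.

Lemma wpe_lat p z : ~ inL tau z -> wpe (z + lat tau p) tau = wpe z tau.
Proof.
move=> hz; have := @lat_period (fill 0 (fun u => wpe u tau)) tau _ _ p z.
rewrite !fill_out //; last by apply: notinL_ltr => //; exists p.
apply; [move=> u|move=> u].
- apply: fill_period u; first exact: (@inL_period1 R tau).
  by move=> u hu; rewrite -period1E wpe_period //; [exact: notinL_2|exact: inL_22].
- apply: fill_period u; first exact: (@inL_period2 R tau).
  by move=> u hu; rewrite -period2E wpe_period //; [exact: notinL_2tau|exact: inL_22tau].
Qed.

Lemma notinL_near0 : exists2 e : R, 0 < e & forall w, cmod w <= e -> w != 0 -> ~ inL tau w.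
Proof.
have [|k k0 hk] := @lat_separated R tau 0 (fun p => p != (0, 0)) ht.
  by move=> p hp; rewrite eq_sym lat_neq0.
exists (k / 2) => [|w wk w0 [p wp]]; first by lra.
have p0 : p != (0, 0) by apply: contraNneq w0 => p0; rewrite wp p0 lat0.
have := hk p p0; rewrite sub0r cmodN -wp.
have := latN_ge1 R p => N1; have : k * 1 <= k * latN R p by rewrite ler_pM2l.
lra.
Qed.

Lemma offL0 : offL 0 tau.
Proof. by move=> p hp; rewrite eq_sym lat_neq0. Qed.

(** A is w^2 (wp(w) - e), written so that it is smooth at 0. *)
Lemma wpe_pole (e : C) : exists A : C -> C, [/\ A 0 = 1, has_jet A 0 &
  forall w, w != 0 -> wpe w tau - e = A w * w^-1 ^+ 2].
Proof.
exists (fun w => 1 - 2 * w ^+ 3 * eB0 w tau - w ^+ 4 * eB1 w tau - e * w ^+ 2); split.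
- by rewrite !expr0n /=; ring.
- have jB0 : has_jet (fun u => eB0 u tau) 0 by do 3 eexists; exact: (eB0_jetz ht offL0).
  have jB1 : has_jet (fun u => eB1 u tau) 0 by do 3 eexists; exact: (eB1_jetz ht offL0).
  have jw n : has_jet (fun w : C => w ^+ n) 0 by apply: has_jetX; exact: has_jet_id.
  have jc a : has_jet (fun=> a : C) 0 by exact: has_jet_cst.
  apply: has_jetD; last by apply: has_jetN; exact: has_jetM.
  apply: has_jetD; last by apply: has_jetN; exact: has_jetM.
  apply: has_jetD => //; apply: has_jetN; apply: has_jetM => //; exact: has_jetM.
- by move=> w w0; rewrite /wpe; field.
Qed.

Section HalfPeriod.
Variables (hp : C) (hphp : ~ inL tau hp) (hpL : inL tau (hp + hp)).

Let e := wpe hp tau.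
Let S z := inL tau z \/ inL tau (z + hp).
(** The value on S is the limit at 0, where the first factor behaves like w^-2 and the second like
    w^2 wp''(hp)/2. *)
Let Q z := if `[< S z >] then wpe2 hp tau / 2 else (wpe z tau - e) * (wpe (z + hp) tau - e).

Let Q_out z : ~ S z -> Q z = (wpe z tau - e) * (wpe (z + hp) tau - e).
Proof. by rewrite /Q => /asboolF ->. Qed.

Let Q_in z : S z -> Q z = wpe2 hp tau / 2.
Proof. by rewrite /Q => /asboolT ->. Qed.

Let Q_lat p z : Q (z + lat tau p) = Q z.
Proof.
have hl : inL tau (lat tau p) by exists p.
have hS : S (z + lat tau p) <-> S z.
  rewrite /S addrAC; have := inL_addr z hl; have := inL_addr (z + hp) hl; tauto.
have [hz|hz] := pselect (S z); first by rewrite !Q_in //; apply/hS.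
have [z1 z2] := (iffLR (not_orP _ _) hz).
rewrite !Q_out; [|by []|by move/hS].
by rewrite wpe_lat // (addrAC z) wpe_lat.
Qed.

(** Translation by hp swaps the two factors, which carries the singular points congruent to - hp to
    the lattice. *)
Let Q_half z : Q (z + hp) = Q z.
Proof.
have hS : S (z + hp) <-> S z.
  rewrite /S -addrA; have := inL_addr z hpL; tauto.
have [hz|hz] := pselect (S z); first by rewrite !Q_in //; apply/hS.
have [z1 z2] := (iffLR (not_orP _ _) hz).
rewrite !Q_out; [|by []|by move/hS].
by rewrite -[z + hp + hp]addrA wpe_period // mulrC.
Qed.

Let Q0 : Q 0 = wpe2 hp tau / 2.
Proof. by apply: Q_in; left; exact: inL0. Qed.

(** As wp'(hp) = 0, the difference has a double zero at w = 0, and A is the continuous quotient. *)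
Let wpe_half_jet : exists A : C -> C, [/\ ccont A 0, A 0 = wpe2 hp tau / 2 &
  forall w, w != 0 -> wpe (w + hp) tau - e = A w * w ^+ 2].
Proof.
pose A w := if w == 0 then wpe2 hp tau / 2 else (wpe (w + hp) tau - e) * w^-1 ^+ 2.
exists A; split; last 1 first.
- by move=> w w0; rewrite /A (negbTE w0) -mulrA -exprMn mulVf // expr1n mulr1.
- have := wpe_jetz ht hphp; rewrite wpe1_half //; move=> [M [d [M0 d0 hd]]].
  move=> ep ep0; exists (Num.min d (ep / 2 / (M + 1))).
    by rewrite lt_min d0 !divr_gt0 //; lra.
  move=> w; rewrite le_min ler_pdivlMr; last by lra.
  move=> /andP[/hd wd we]; rewrite add0r /A eqxx.
  have [_|w0] := eqVneq w 0; first by rewrite subrr cmod0.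
  have wc : 0 < cmod w by rewrite cmod_gt0.
  apply: (@le_lt_trans _ _ (M * cmod w)); last by lra.
  have -> : (wpe (w + hp) tau - e) * w^-1 ^+ 2 - wpe2 hp tau / 2 =
     (wpe (hp + w) tau - (wpe hp tau + 0 * w + wpe2 hp tau / 2 * w ^+ 2)) * w^-1 ^+ 2.
    by rewrite (addrC w) /e; field.
  have := cmodM_le wd (cmodX_le 2 (lexx (cmod w^-1))).
  move/le_trans; apply; rewrite cmodV le_eqVlt; apply/orP; left; apply/eqP; field.
  by rewrite gt_eqF.
- by rewrite /A eqxx.
Qed.

(* The double poles of one factor are compensated by the double zeros of the
   other, so the product is elliptic without poles. *)
Lemma half_period_product z : ~ inL tau z -> ~ inL tau (z + hp) ->
  (wpe z tau - wpe hp tau) * (wpe (z + hp) tau - wpe hp tau) = wpe2 hp tau / 2.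
Proof.
move=> z1 z2; rewrite -Q0 -[LHS]Q_out; last by case.
apply: (elliptic_const ht).
- by move=> u; rewrite -(Q_lat (1, 0) u) /lat /= mulr1 mulr0 mul0r addr0.
- by move=> u; rewrite -(Q_lat (0, 1) u) /lat /= mulr1 mulr0 add0r.
- move=> u; have [hu|hu] := pselect (S u); [right=> w|left].
    case: hu => [[p ->]|[p hup]]; first by rewrite addrC Q_lat.
    by rewrite -Q_half addrAC hup addrC Q_lat.
  have [u1 u2] := (iffLR (not_orP _ _) hu).
  have [e1 e10 he1] := notinL_near 1 0 ht u1; have [e2 e20 he2] := notinL_near 1 0 ht u2.
  have jc : has_jet (fun=> - e) u by exact: has_jet_cst.
  have j1 : has_jet (fun z => wpe z tau - e) u.
    by apply: has_jetD => //; do 3 eexists; exact: (wpe_jetz ht u1).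
  have j2 : has_jet (fun z => wpe (z + hp) tau - e) u.
    apply: has_jetD => //; apply: (@has_jet_shift _ (fun u => wpe u tau)).
    by do 3 eexists; exact: (wpe_jetz ht u2).
  apply: (has_jet_near (d := Num.min e1 e2) _ _ (has_jetM j1 j2)).
    by rewrite lt_min e10.
  move=> w; rewrite le_min => /andP[/he1[_ w1] /he2[_ w2]].
  rewrite Q_out // => -[]; first by move: w1; rewrite mul1r mul0r addr0.
  by move: w2; rewrite mul1r mul0r addr0 addrAC.
- have [A [A0 jA hA]] := wpe_pole e; have [D [cD D0 hD]] := wpe_half_jet.
  have cAD : ccont (fun w => A w * D w) 0 by apply: ccontM => //; exact: has_jet_ccont.
  move=> ep /cAD[d d0 hd]; have [e1 e10 he1] := notinL_near0.
  have [e2 e20 he2] := notinL_near 1 0 ht hphp.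
  exists (Num.min d (Num.min e1 e2)); first by rewrite !lt_min d0 e10.
  move=> w; rewrite !le_min => /and3P[/hd wd w1 /he2[_ w2]].
  have AD0 : A 0 * D 0 = Q 0 by rewrite A0 D0 mul1r Q0.
  rewrite -AD0; have [->|w0] := eqVneq w 0.
    by rewrite addr0 AD0 subrr cmod0 //; apply: le_lt_trans wd; exact: cmod_ge0.
  move: wd; rewrite !add0r Q_out; last first.
    case; first exact: he1.
    by move: w2; rewrite mul1r mul0r addr0 addrC.
  rewrite hA // hD // mulrACA -exprMn mulVf // expr1n mulr1 //.
Qed.

(* If wp'' vanished at the half-period hp, then wp(u + hp) would be constant near
   u = 0, hence on the largest disc around 0 that contains no pole; but a pole
   lies on the boundary of this disc. *)
Lemma wpe2_half_neq0 : wpe2 hp tau != 0.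
Proof.
apply/negP => /eqP c0.
pose v u := wpe (u + hp) tau - e.
have [A [A0 jA hA]] := wpe_pole e.
have [d1 d10 hd1] := has_jet_ccont jA (ltr01 : 0 < 1 :> R).
have [e1 e10 he1] := notinL_near0; have [e2 e20 he2] := notinL_near 1 0 ht hphp.
pose d2 := Num.min d1 (Num.min e1 e2).
have d20 : 0 < d2 by rewrite !lt_min d10 e10.
have pne w : cmod w <= d2 -> w != 0 -> wpe w tau - e != 0.
  rewrite !le_min => /and3P[/hd1 w1 _ _] w0; rewrite hA // mulf_neq0 ?expf_neq0 ?invr_eq0 //.
  by apply/eqP => Aw; move: w1; rewrite add0r Aw A0 sub0r cmodN cmod1 ltxx.
have v0 w : cmod w <= d2 -> v w = 0.
  have [->|w0] := eqVneq w 0; first by rewrite /v add0r subrr.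
  move=> wd; have := pne w wd w0; move: wd.
  rewrite !le_min => /and3P[_ w1 /he2[_]]; rewrite mul1r mul0r addr0 addrC => w2.
  move=> pw; have := half_period_product (he1 w w1 w0) w2.
  by rewrite c0 mul0r => /eqP; rewrite mulf_eq0 (negbTE pw) => /eqP.
pose E : set R := ((fun p => cmod (lat tau p - hp)) @` setT)%classic.
have [k k0 hk] : exists2 k : R, 0 < k & forall p, k <= cmod (lat tau p - hp).
  have [|k k0 hk] := @lat_separated R tau hp xpredT ht.
    by move=> p _; apply: contra_not_neq hphp => ->; exists p.
  exists k => // p; rewrite cmodBC; apply: le_trans (hk p isT).
  by rewrite ler_pMr // latN_ge1.
have infE : has_inf E.
  by split; [exists (cmod (lat tau (0, 0) - hp)); exists (0, 0)|exists k => _ [p _ <-]].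
pose r := inf E.
have r0 : 0 < r by apply: lt_le_trans k0 _; apply: lb_le_inf => [|_ [p _ <-]//]; case: infE.
have rE p : r <= cmod (lat tau p - hp) by apply: ge_inf; [case: infE|exists p].
pose d := Num.min d2 (r / 2).
have d0 : 0 < d by rewrite lt_min d20 divr_gt0.
have hd2 : d <= d2 by rewrite ge_min lexx.
have hdr : d <= r / 2 by rewrite ge_min lexx orbT.
(* A pole P0 of v with |P0| < r + d/2 is enough. Moving from it towards 0 by d gives a point inside
   the disc of radius r - d/4, where v = 0, yet so close to the pole that v is nonzero. *)
have [_ [p _ <-]] := inf_adherent (divr_gt0 d0 (ltr0Sn R 1)) infE.
rewrite -/r; set P0 := lat tau p - hp => hP0; have rP0 := rE p; rewrite -/P0 in rP0.
have P00 : 0 < cmod P0 by apply: lt_le_trans rP0.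
have Pn0 : P0 != 0 by rewrite -cmod_gt0.
pose s := d / cmod P0.
have s0 : 0 < s by rewrite divr_gt0.
have sP : s * cmod P0 = d by rewrite /s divfK // gt_eqF.
pose w := - (s%:C%C * P0).
have wd : cmod w = d by rewrite cmodN cmodM cmod_real gtr0_norm.
have w0 : w != 0 by rewrite -cmod_gt0 wd.
have vw : v (P0 + w) = wpe w tau - e.
  have -> : v (P0 + w) = wpe (w + lat tau p) tau - e.
    by rewrite /v /P0; congr (wpe _ _ - _); ring.
  rewrite wpe_lat //; apply: he1 => //; rewrite wd.
  by apply: le_trans hd2 _; rewrite !ge_min lexx !orbT.
have uP : cmod (P0 + w) = cmod P0 - d.
  have -> : P0 + w = (1 - s)%:C%C * P0 by rewrite /w rmorphB rmorph1; ring.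
  rewrite cmodM cmod_real ger0_norm; first by rewrite mulrBl mul1r sP.
  rewrite subr_ge0 /s ler_pdivrMr // mul1r; lra.
have : v (P0 + w) = 0.
  apply: (@zero_on_disc _ v (r - d / 4) d2) => //; last by rewrite uP; lra.
  - by lra.
  - move=> z zr; have zL : ~ inL tau (z + hp).
      by move=> [q hq]; have := rE q; rewrite -hq addrK; lra.
    apply: has_jetD; last exact: has_jet_cst.
    apply: (@has_jet_shift _ (fun u => wpe u tau)).
    by do 3 eexists; exact: (wpe_jetz ht zL).
rewrite vw; apply/eqP; apply: pne => //; by rewrite wd.
Qed.

End HalfPeriod.

End FixedLattice.

End EllipticFunctions.

(** * Dependence on tau: constancy of kappa and the Darboux-Halphen system *)

Section PeriodVariation.
Variable R : realType.
Local Notation C := R[i].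
Implicit Types (z tau w hp : C).

(* [4 * weta] is the quasi-period of zeta along 4 and [wkappa] is the Legendre
   expression (classically [+- i pi / 2], a value that is not needed); [wetat]
   and [wkappat] are their tau-derivatives. *)
Definition weta tau : C := wzeta 2 tau / 2.
Definition wkappa tau : C := tau * weta tau - wzeta (2 * tau) tau / 2.
Definition wetat tau : C := wzetat 2 tau / 2.
Definition wkappat tau : C :=
  weta tau + tau * wetat tau + wpe (2 * tau) tau - wzetat (2 * tau) tau / 2.

Section FixedTau.
Variables (tau : C) (ht : complex.Im tau != 0).

Let n2 := notinL_2 ht.
Let n2t := notinL_2tau ht.
Let p4 := inL_22 tau.
Let p4t := inL_22tau tau.

Lemma wpet_period1 z : ~ inL tau z -> wpet (z + 4) tau = wpet z tau.
Proof.
move=> hz; have hz' : ~ inL tau (z + 4) by apply: notinL_ltr; first exact: inL_period1.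
have [g1 h1] := wpe_jet ht hz' 0 1; have [g2 h2] := wpe_jet ht hz 0 1.
have [e e0 he] := notinL_near 0 1 ht hz.
have h3 : sjet (fun h => wpe (z + 0 * h) (tau + 1 * h)) (wpe (z + 4) tau)
    (0 * wpe1 (z + 4) tau + 1 * wpet (z + 4) tau) g1.
  apply: sjet_near e0 _ h1 => h /he[hI hL].
  rewrite addrAC -period1E wpe_period //; [exact: notinL_2|exact: inL_22].
have [_ + _] := sjet_unique h3 h2.
by rewrite !mul0r !mul1r !add0r.
Qed.

(** Differentiate wp(z + 4 t, t) = wp(z, t) in t: the first argument moves with speed 4, which adds
    the multiple of wp'. *)
Lemma wpet_period2 z : ~ inL tau z -> wpet (z + 4 * tau) tau = wpet z tau - 4 * wpe1 z tau.
Proof.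
move=> hz; have hz' : ~ inL tau (z + 4 * tau) by apply: notinL_ltr; first exact: inL_period2.
have [g1 h1] := wpe_jet ht hz' 4 1; have [g2 h2] := wpe_jet ht hz 0 1.
have [e e0 he] := notinL_near 0 1 ht hz.
have h3 : sjet (fun h => wpe (z + 0 * h) (tau + 1 * h)) (wpe (z + 4 * tau) tau)
    (4 * wpe1 (z + 4 * tau) tau + 1 * wpet (z + 4 * tau) tau) g1.
  apply: sjet_near e0 _ h1 => h /he[hI hL].
  have -> : z + 4 * tau + 4 * h = z + 0 * h + (2 * (tau + 1 * h) + 2 * (tau + 1 * h)) by ring.
  rewrite wpe_period //; [exact: notinL_2tau|exact: inL_22tau].
have [_ + _] := sjet_unique h3 h2.
rewrite -(period2E tau) wpe1_period // mul0r !mul1r add0r => <-; ring.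
Qed.

Lemma wzetat_period1 z : ~ inL tau z -> wzetat (z + 4) tau = wzetat z tau + 2 * wzetat 2 tau.
Proof.
move=> hz; have hz' : ~ inL tau (z + 4) by apply: notinL_ltr; first exact: inL_period1.
have [g1 h1] := wzeta_jet ht hz' 0 1; have [g2 h2] := wzeta_jet ht hz 0 1.
have [g3 h3] := wzeta_jet ht n2 0 1.
have [e e0 he] := notinL_near 0 1 ht hz.
have h4 : sjet (fun h => wzeta (z + 0 * h) (tau + 1 * h) + 2 * wzeta (2 + 0 * h) (tau + 1 * h))
    (wzeta (z + 4) tau) (0 * - wpe (z + 4) tau + 1 * wzetat (z + 4) tau) g1.
  apply: sjet_near e0 _ h1 => h /he[hI hL].
  rewrite addrAC -period1E wzeta_period //; [|exact: notinL_2|exact: inL_22].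
  by rewrite mul0r !addr0.
have [_ + _] := sjet_unique h4 (sjetD h2 (sjetZ 2 h3)).
by rewrite !mul0r !mul1r !add0r.
Qed.

(** The quasi-period relation is differentiated in t; the half-period 2 t inside it moves too, with
    speed 2. *)
Lemma wzetat_period2 z : ~ inL tau z -> wzetat (z + 4 * tau) tau =
  wzetat z tau + 4 * wpe z tau - 4 * wpe (2 * tau) tau + 2 * wzetat (2 * tau) tau.
Proof.
move=> hz; have hz' : ~ inL tau (z + 4 * tau) by apply: notinL_ltr; first exact: inL_period2.
have [g1 h1] := wzeta_jet ht hz' 4 1; have [g2 h2] := wzeta_jet ht hz 0 1.
have [g3 h3] := wzeta_jet ht n2t 2 1.
have [e e0 he] := notinL_near 0 1 ht hz.
have h4 : sjet (fun h => wzeta (z + 0 * h) (tau + 1 * h) + 2 * wzeta (2 * tau + 2 * h) (tau + 1 * h))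
    (wzeta (z + 4 * tau) tau) (4 * - wpe (z + 4 * tau) tau + 1 * wzetat (z + 4 * tau) tau) g1.
  apply: sjet_near e0 _ h1 => h /he[hI hL].
  have -> : z + 4 * tau + 4 * h = z + 0 * h + (2 * (tau + 1 * h) + 2 * (tau + 1 * h)) by ring.
  rewrite wzeta_period //.
  - by have -> : 2 * tau + 2 * h = 2 * (tau + 1 * h) by ring.
  - exact: notinL_2tau.
  - exact: inL_22tau.
have [_ + _] := sjet_unique h4 (sjetD h2 (sjetZ 2 h3)).
rewrite -(period2E tau) wpe_period // => h.
have -> : wzetat (z + (2 * tau + 2 * tau)) tau =
  (4 * - wpe z tau + 1 * wzetat (z + (2 * tau + 2 * tau)) tau) + 4 * wpe z tau by ring.
by rewrite h; ring.
Qed.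

Let eta := weta tau.
Let kappa := wkappa tau.
Let f z := wzeta z tau - eta * z.

Let f_period1 z : ~ inL tau z -> f (z + 4) = f z.
Proof. by move=> hz; rewrite /f -period1E wzeta_period // /eta /weta; field. Qed.

Let f_period2 z : ~ inL tau z -> f (z + 4 * tau) = f z - 4 * kappa.
Proof. by move=> hz; rewrite /f -(period2E tau) wzeta_period // /kappa /wkappa -/eta; field. Qed.

Let K z := kappa * wpet z tau + (wpe z tau + eta) ^+ 2 - f z * wpe1 z tau - wpe2 z tau / 2.

(* [K] with its poles at 0 cancelled, hence smooth at 0. *)
Let Kreg z := kappa * wpet z tau +
  (- 2 * z * eB0 z tau - z ^+ 2 * eB1 z tau + eta) ^+ 2 +
  (z ^+ 2 * eB0 z tau - eta * z) * (2 * eB0 z tau + 4 * z * eB1 z tau + z ^+ 2 * eB2 z tau)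
  + 5 * eB1 z tau + 4 * z * eB2 z tau + z ^+ 2 * eB3 z tau / 2.

Let K_reg z : z != 0 -> K z = Kreg z.
Proof.
by move=> z0; rewrite /K /Kreg /f /wzeta /wpe /wpe1 /wpe2; field.
Qed.

Let Kreg_jet0 : has_jet Kreg 0.
Proof.
have o0 := offL0 ht.
have j0 : has_jet (fun z => eB0 z tau) 0 by do 3 eexists; exact: (eB0_jetz ht o0).
have j1 : has_jet (fun z => eB1 z tau) 0 by do 3 eexists; exact: (eB1_jetz ht o0).
have j2 : has_jet (fun z => eB2 z tau) 0.
  by have [g h] := eB2_jetz ht o0; do 3 eexists; exact: h.
have j3 : has_jet (fun z => eB3 z tau) 0.
  by have [b [g h]] := eB3_jetz ht o0; do 3 eexists; exact: h.
have jt : has_jet (fun z => eBt z tau) 0.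
  by have [g h] := eBt_jetz ht o0; do 3 eexists; exact: h.
have j1t : has_jet (fun z => eB1t z tau) 0.
  by have [b [g h]] := eB1t_jetz ht o0; do 3 eexists; exact: h.
have jw : has_jet (fun z : C => z) 0 by exact: has_jet_id.
have jc a : has_jet (fun=> a : C) 0 by exact: has_jet_cst.
have jz2 := has_jetX 2 jw.
have jwt := has_jetD (has_jetM (has_jetM (jc (- 2)) jw) jt) (has_jetN (has_jetM jz2 j1t)).
have jP := has_jetD (has_jetD (has_jetM (has_jetM (jc (- 2)) jw) j0)
  (has_jetN (has_jetM jz2 j1))) (jc eta).
have jA := has_jetD (has_jetM jz2 j0) (has_jetN (has_jetM (jc eta) jw)).
have jD := has_jetD (has_jetD (has_jetM (jc 2) j0) (has_jetM (has_jetM (jc 4) jw) j1))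
  (has_jetM jz2 j2).
exact: (has_jetD (has_jetD (has_jetD (has_jetD (has_jetD (has_jetM (jc kappa) jwt)
  (has_jetX 2 jP)) (has_jetM jA jD)) (has_jetM (jc 5) j1))
  (has_jetM (has_jetM (jc 4) jw) j2)) (has_jetM (has_jetM jz2 j3) (jc 2^-1))).
Qed.

Let K_jet z : ~ inL tau z -> has_jet K z.
Proof.
move=> hz.
have jz : has_jet (fun z => wzeta z tau) z.
  by have [g h] := wzeta_jetz ht hz; do 3 eexists; exact: h.
have jp : has_jet (fun z => wpe z tau) z by do 3 eexists; exact: (wpe_jetz ht hz).
have jp1 : has_jet (fun z => wpe1 z tau) z.
  by have [g h] := wpe1_jetz ht hz; do 3 eexists; exact: h.
have jp2 : has_jet (fun z => wpe2 z tau) z.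
  by have [b [g h]] := wpe2_jetz ht hz; do 3 eexists; exact: h.
have jpt : has_jet (fun z => wpet z tau) z.
  by have [b [g h]] := wpet_jetz ht hz; do 3 eexists; exact: h.
have jw : has_jet (fun z : C => z) z by exact: has_jet_id.
have jc a : has_jet (fun=> a : C) z by exact: has_jet_cst.
exact: (has_jetD (has_jetD (has_jetD (has_jetM (jc kappa) jpt)
  (has_jetX 2 (has_jetD jp (jc eta)))) (has_jetN (has_jetM (has_jetD jz
  (has_jetN (has_jetM (jc eta) jw))) jp1))) (has_jetN (has_jetM jp2 (jc 2^-1)))).
Qed.

Let K_const z : ~ inL tau z -> K z = Kreg 0.
Proof.
move=> hz; pose F := fill tau (Kreg 0) K.
have F1 u : F (u + 4) = F u.
  apply: fill_period; first exact: inL_period1.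
  move=> v hv; rewrite /K f_period1 // wpet_period1 //.
  by rewrite -period1E wpe_period // wpe1_period // wpe2_period.
have F2 u : F (u + 4 * tau) = F u.
  apply: fill_period; first exact: inL_period2.
  move=> v hv; rewrite /K f_period2 // wpet_period2 //.
  by rewrite -(period2E tau) wpe_period // wpe1_period // wpe2_period //; ring.
have F0 : F 0 = Kreg 0 by rewrite /F fill_in //; exact: inL0.
rewrite -F0 -(@elliptic_const _ F tau ht F1 F2 _ _ z); first by rewrite /F fill_out.
- move=> u; have [[p ->]|hu] := pselect (inL tau u).
    by right=> w; rewrite addrC lat_period.
  by left; apply: fill_jet => //; exact: K_jet.
- have [e e0 he] := notinL_near0 ht.
  apply: has_jet_ccont; apply: has_jet_near e0 _ Kreg_jet0 => w we.
  rewrite add0r; have [->|w0] := eqVneq w 0; first by rewrite F0.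
  by rewrite /F fill_out ?K_reg //; exact: he.
Qed.

Lemma half_period_values hp : ~ inL tau hp -> inL tau (hp + hp) ->
  kappa * wpet hp tau + (wpe hp tau + eta) ^+ 2 - wpe2 hp tau / 2 = Kreg 0.
Proof.
by move=> h1 h2; rewrite -(K_const h1) /K wpe1_half // mulr0 subr0.
Qed.

Let e1 := wpe 2 tau.
Let e2 := wpe (2 + 2 * tau) tau.
Let e3 := wpe (2 * tau) tau.

Let n22 := notinL_2D2tau ht.

Lemma inL_double3 : inL tau (2 + 2 * tau + (2 + 2 * tau)).
Proof.
by rewrite addrACA period1E period2E; apply: inLD; [exact: inL_period1|exact: inL_period2].
Qed.

(** The product formula evaluated at a second half-period, which translation by the first carries to
    the third. *)
Lemma wpe2_half1 : (e1 - e2) * (e1 - e3) = wpe2 2 tau / 2.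
Proof.
rewrite -(@half_period_product _ _ ht 2 n2 p4 (2 * tau)) //; last by rewrite addrC.
by rewrite (addrC (2 * tau)) -/e1 -/e2 -/e3; ring.
Qed.

Lemma wpe2_half3 : (e3 - e1) * (e3 - e2) = wpe2 (2 * tau) tau / 2.
Proof.
rewrite -(@half_period_product _ _ ht (2 * tau) n2t p4t 2) //.
by rewrite -/e1 -/e2 -/e3; ring.
Qed.

Lemma wpe2_half2 : (e2 - e1) * (e2 - e3) = wpe2 (2 + 2 * tau) tau / 2.
Proof.
have hE : 2 + (2 + 2 * tau) = 2 * tau + (2 + 2) by ring.
rewrite -(@half_period_product _ _ ht (2 + 2 * tau) n22 inL_double3 2) //; last first.
  by rewrite hE; apply: notinL_ltr.
by rewrite hE wpe_period // -/e1 -/e2 -/e3; ring.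
Qed.

Lemma wpe_half12_neq : e1 - e2 != 0.
Proof.
have := wpe2_half_neq0 ht n2 p4; apply: contra_neq => h.
by move: wpe2_half1; rewrite h mul0r => /esym/eqP; rewrite mulf_eq0 invr_eq0 pnatr_eq0 orbF => /eqP.
Qed.

Lemma wpe_half13_neq : e1 - e3 != 0.
Proof.
have := wpe2_half_neq0 ht n2 p4; apply: contra_neq => h.
by move: wpe2_half1; rewrite h mulr0 => /esym/eqP; rewrite mulf_eq0 invr_eq0 pnatr_eq0 orbF => /eqP.
Qed.

Lemma wpe_half23_neq : e2 - e3 != 0.
Proof.
have := wpe2_half_neq0 ht n22 inL_double3; apply: contra_neq => h.
by move: wpe2_half2; rewrite h mulr0 => /esym/eqP; rewrite mulf_eq0 invr_eq0 pnatr_eq0 orbF => /eqP.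
Qed.

(** If kappa were 0, K would give E_i E_j + E_i E_k - E_j E_k the same value at the three
    half-periods. Differences yield 2 (e1 - e2) E3 = 0 and 2 (e1 - e3) E2 = 0, hence E2 = E3, which
    is excluded. *)
Lemma wkappa_neq0 : kappa != 0.
Proof.
apply/negP => /eqP k0.
have h1 := half_period_values n2 p4; have h2 := half_period_values n22 inL_double3.
have h3 := half_period_values n2t p4t.
move: h1 h2 h3; rewrite k0 -wpe2_half1 -wpe2_half2 -wpe2_half3 -/e1 -/e2 -/e3 => h1 h2 h3.
have d12 : (e1 - e2) * (e3 + eta) = 0.
  have : 2 * ((e1 - e2) * (e3 + eta)) = 0.
    rewrite -(subrr (Kreg 0)) -{1}h1 -h2; ring.
  by move/eqP; rewrite mulf_eq0 pnatr_eq0 => /eqP.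
have d13 : (e1 - e3) * (e2 + eta) = 0.
  have : 2 * ((e1 - e3) * (e2 + eta)) = 0.
    rewrite -(subrr (Kreg 0)) -{1}h1 -h3; ring.
  by move/eqP; rewrite mulf_eq0 pnatr_eq0 => /eqP.
have := wpe_half23_neq; move/eqP; apply.
move/eqP: d12; rewrite mulf_eq0 (negbTE wpe_half12_neq) => /eqP E3.
move/eqP: d13; rewrite mulf_eq0 (negbTE wpe_half13_neq) => /eqP E2.
by rewrite -(subrr (0 : C)) -{1}E2 -E3; ring.
Qed.

Let H z := kappa * (wzetat z tau - wetat tau * z) + f z * (wpe z tau + eta) + wpe1 z tau / 2.

Let H_jet z : ~ inL tau z ->
  exists c, sjet (fun w => H (z + w)) (H z) (- (Kreg 0 + kappa * wetat tau)) c.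
Proof.
move=> hz.
have [gz hzj] := wzeta_jetz ht hz; have hp := wpe_jetz ht hz.
have [g1 hp1] := wpe1_jetz ht hz; have [gt hzt] := wzetat_jetz ht hz.
have hs := sjet_shift z.
have hf := sjetB hzj (sjetZ eta hs).
have hpe := sjetD hp (sjet_const eta).
have h := sjetD (sjetD (sjetZ kappa (sjetB hzt (sjetZ (wetat tau) hs))) (sjetM hf hpe))
  (sjetZ 2^-1 hp1).
eexists; apply: (sjet_near ltr01 _ (sjet_eq h _ _ erefl)) => [w _||].
- by rewrite /H /f [_ / 2]mulrC.
- by rewrite /H /f [_ / 2]mulrC.
- by rewrite -(K_const hz) /K /f; field.
Qed.

Let H_period1 z : ~ inL tau z -> H (z + 4) = H z.
Proof.
move=> hz; rewrite /H f_period1 // wzetat_period1 // -period1E wpe_period // wpe1_period //.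
by rewrite /wetat; field.
Qed.

Let H_period2 z : ~ inL tau z -> H (z + 4 * tau) = H z - 4 * kappa * wkappat tau.
Proof.
move=> hz; rewrite /H f_period2 // wzetat_period2 // -(period2E tau) wpe_period // wpe1_period //.
by rewrite /wkappat -/eta; field.
Qed.

Let Kreg_eta : Kreg 0 = - (kappa * wetat tau).
Proof.
pose al := - (Kreg 0 + kappa * wetat tau).
have hc := @constant_offL _ tau (fun z => H z - al * z) ht.
have n6 : ~ inL tau (2 + 4) by apply: notinL_ltr => //; exact: inL_period1.
have := hc _ (2 + 4) 2 n6 n2; rewrite H_period1 // => h.
have : 4 * al = 0.
  have {}h := h _.
  have -> : 4 * al = (H 2 - al * 2) - (H 2 - al * (2 + 4)) by ring.
  rewrite h ?subrr //.
  move=> z hz; have [c hj] := H_jet hz.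
  have := sjetB hj (sjetZ al (sjet_shift z)); rewrite mulr1 subrr => hj2.
  by do 2 eexists; exact: hj2.
move/eqP; rewrite mulf_eq0 pnatr_eq0 /= /al oppr_eq0 addr_eq0 => /eqP //.
Qed.

Lemma wkappat0 : wkappat tau = 0.
Proof.
have n6 : ~ inL tau (2 + 4 * tau) by apply: notinL_ltr => //; exact: inL_period2.
have := @constant_offL _ tau H ht _ (2 + 4 * tau) 2 n6 n2; rewrite H_period2 // => h.
have : 4 * kappa * wkappat tau = 0.
  have -> : 4 * kappa * wkappat tau = H 2 - (H 2 - 4 * kappa * wkappat tau) by ring.
  rewrite h ?subrr // => z hz; have [c hj] := H_jet hz.
  by move: hj; rewrite Kreg_eta addNr oppr0 => hj; do 2 eexists; exact: hj.
by move/eqP; rewrite !mulf_eq0 pnatr_eq0 (negbTE wkappa_neq0) => /eqP.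
Qed.

Lemma half_period_derive hp : ~ inL tau hp -> inL tau (hp + hp) ->
  wpet hp tau + wetat tau = - ((wpe hp tau + eta) ^+ 2 - wpe2 hp tau / 2) / kappa.
Proof.
move=> h1 h2; have := half_period_values h1 h2; rewrite Kreg_eta => h.
apply: (mulIf wkappa_neq0); rewrite divfK ?wkappa_neq0 //.
have -> : (wpet hp tau + wetat tau) * kappa =
  (kappa * wpet hp tau + (wpe hp tau + eta) ^+ 2 - wpe2 hp tau / 2) + kappa * wetat tau
  - ((wpe hp tau + eta) ^+ 2 - wpe2 hp tau / 2) by ring.
by rewrite h addNr add0r.
Qed.

End FixedTau.

End PeriodVariation.

(** * From expansions to complex derivatives *)

Section JetDerivative.
Variable R : realType.
Local Notation C := R[i].
Implicit Types (f g : C -> C) (t a b : C).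

(** The polynomial q inverts the Taylor polynomial of f up to order 3, and 1/f - q = - (f q - 1) /
    f. *)
Lemma sjetV f a b c : a != 0 -> sjet f a b c ->
  sjet (fun h => (f h)^-1) a^-1 (- b * a^-1 ^+ 2) (b ^+ 2 * a^-1 ^+ 3 - c * a^-1 ^+ 2).
Proof.
move=> a0 hf; set q1 := - b * _; set q2 := _ - _.
have a0' : 0 < cmod a by rewrite cmod_gt0.
have hq : sjet (fun h => a^-1 + q1 * h + q2 * h ^+ 2) a^-1 q1 q2.
  by exists 0, 1; split=> // h _; rewrite subrr cmod0 mul0r.
have [M [d [M0 d0 hfq]]] := sjetM hf hq.
have c1 : a * a^-1 = 1 by rewrite divff.
have c2 : a * q1 + b * a^-1 = 0 by rewrite /q1; field.
have c3 : a * q2 + b * q1 + c * a^-1 = 0 by rewrite /q1 /q2; field.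
have [d' d'0 hd'] := sjet_continuous hf (divr_gt0 a0' (ltr0Sn R 1)).
exists (M * (2 * (cmod a)^-1)), (Num.min d d'); split=> [||h].
- by rewrite mulr_ge0 // mulr_ge0 // invr_ge0 ltW.
- by rewrite lt_min d0.
rewrite le_min => /andP[/hfq k1 /hd' k2].
rewrite (sjet_at0 hf) in k2; rewrite c1 c2 c3 !mul0r !addr0 in k1.
have fh : cmod a / 2 <= cmod (f h).
  by have := cmodB (f h) (f h - a); rewrite subKr; lra.
have fh0 : 0 < cmod (f h) by apply: lt_le_trans fh; rewrite divr_gt0.
have fn0 : f h != 0 by rewrite -cmod_gt0.
have fV : cmod (f h)^-1 <= 2 * (cmod a)^-1.
  rewrite cmodV -[leRHS]invrK lef_pV2 ?posrE ?invr_gt0 ?mulr_gt0 ?invr_gt0 //.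
  by rewrite invfM invrK mulrC.
have -> : (f h)^-1 - (a^-1 + q1 * h + q2 * h ^+ 2) =
  - ((f h * (a^-1 + q1 * h + q2 * h ^+ 2) - 1) * (f h)^-1).
  set q := a^-1 + _ + _; by field.
rewrite cmodN [leRHS]mulrAC; exact: cmodM_le.
Qed.

Definition has_der f t b := exists c, sjet (fun h => f (t + h)) (f t) b c.

Lemma sjet_has_der f t a b c : sjet (fun h => f (t + h)) a b c -> has_der f t b.
Proof.
move=> h; have e := sjet_at0 h; rewrite addr0 in e.
by exists c; apply: (sjet_eq h).
Qed.

Lemma has_der_cst a t : has_der (fun=> a) t 0.
Proof. by exists 0; exact: sjet_const. Qed.

Lemma has_der_id t : has_der (fun t => t) t 1.
Proof. by exists 0; exact: sjet_shift. Qed.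

Lemma has_derD f g t a b : has_der f t a -> has_der g t b ->
  has_der (fun t => f t + g t) t (a + b).
Proof. by move=> [? h1] [? h2]; eexists; exact: (sjetD h1 h2). Qed.

Lemma has_derN f t a : has_der f t a -> has_der (fun t => - f t) t (- a).
Proof. by move=> [? h1]; eexists; exact: (sjetN h1). Qed.

Lemma has_derM f g t a b : has_der f t a -> has_der g t b ->
  has_der (fun t => f t * g t) t (f t * b + a * g t).
Proof. by move=> [? h1] [? h2]; eexists; exact: (sjetM h1 h2). Qed.

Lemma has_derX f t a : has_der f t a -> has_der (fun t => f t ^+ 2) t (2 * f t * a).
Proof. by move=> [? h1]; eexists; exact: (sjetX h1). Qed.

Lemma has_derV f t a : f t != 0 -> has_der f t a ->
  has_der (fun t => (f t)^-1) t (- a * (f t)^-1 ^+ 2).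
Proof. by move=> f0 [? h1]; eexists; exact: (sjetV f0 h1). Qed.

Lemma has_der_eq f t a b : has_der f t a -> a = b -> has_der f t b.
Proof. by move=> h <-. Qed.

Lemma has_der_unique f t a b : has_der f t a -> has_der f t b -> a = b.
Proof. by move=> [c h1] [c' h2]; have [] := sjet_unique h1 h2. Qed.

Lemma near_upper t : complex.Im t != 0 ->
  exists2 e : R, 0 < e & forall h, cmod h <= e -> complex.Im (t + h) != 0.
Proof.
move=> ht; have [e e0 he] := notinL_near 0 1 ht (notinL_2 ht).
by exists e => // h /he; rewrite mul1r => -[].
Qed.

Lemma has_der_near f g t a : complex.Im t != 0 ->
  (forall u, complex.Im u != 0 -> f u = g u) -> has_der f t a -> has_der g t a.
Proof.
move=> ht fg [c h]; have [e e0 he] := near_upper ht.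
exists c; rewrite -fg //; apply: sjet_near e0 _ h => w /he hw.
exact: fg.
Qed.

Lemma has_der_is_derive f t b :
  has_der f t b -> is_derive (t : R[i]^o) 1 (f : R[i]^o -> R[i]^o) b.
Proof.
move=> [c [M [d [M0 d0 hd]]]].
have hcv : ((fun h : R[i]^o => h^-1 *:
    (((f : R[i]^o -> R[i]^o) \o shift (t : R[i]^o)) (h *: (1 : R[i]^o)) - f t))
    @ 0^' --> (b : R[i]^o))%classic.
  apply/cvgrPdist_lt => /= e e0.
  have [a ae] : exists a : R, e = a%:C%C by apply/complex_realP; rewrite gtr0_real.
  rewrite {}ae ltcR in e0 * => {e}.
  have K0 : 0 < M + cmod c + 1 by have := cmod_ge0 c; lra.
  pose ep := Num.min 1 (Num.min d (a / (M + cmod c + 1))).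
  have ep0 : 0 < ep by rewrite !lt_min ltr01 d0 divr_gt0.
  exists ep%:C%C => /=; first by rewrite ltcR.
  move=> h; rewrite /ball_ /= sub0r normrN normr_cmod ltcR => hep hn0.
  rewrite normr_cmod ltcR /shift /= [h *: 1]mulr1 (addrC h).
  move: hep; rewrite !lt_min ltr_pdivlMr // => /and3P[h1 h2 h3].
  have hc : 0 < cmod h by rewrite cmod_gt0.
  have hdh := hd h (ltW h2).
  have -> : b - h^-1 * (f (t + h) - f t) =
    - (h^-1 * (f (t + h) - (f t + b * h + c * h ^+ 2))) - c * h by field.
  have := cmodB (- (h^-1 * (f (t + h) - (f t + b * h + c * h ^+ 2)))) (c * h).
  rewrite cmodN !cmodM cmodV.
  have : (cmod h)^-1 * cmod (f (t + h) - (f t + b * h + c * h ^+ 2)) <= M * cmod h.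
    rewrite mulrC ler_pdivrMr //; apply: le_trans hdh _.
    rewrite -mulrA ler_wpM2l // exprS ler_wpM2l ?cmod_ge0 // expr2.
    by rewrite ler_piMl ?cmod_ge0 // ltW.
  lra.
apply: DeriveDef; first by apply/cvg_ex; exists b.
exact: (@cvg_lim R[i]^o (@norm_hausdorff _ _) _ _ _ _ _ hcv).
Qed.

End JetDerivative.

(** * Algebraic relations and derivatives of p, r and the E_i *)

Section BurnsideDerivatives.
Variable R : realType.
Local Notation C := R[i].
Implicit Types (z tau : C).

(** For l nonzero, (z - l)^-2 - l^-2 = - 2 z / (l^2 (z - l)) + z^2 / (l^2 (z - l)^2), which splits
    the series of wp into two absolutely convergent ones. *)
Lemma wp_wpe z tau : complex.Im tau != 0 -> ~ inL tau z -> wp z 2 (2 * tau) = wpe z tau.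
Proof.
move=> ht hz; have z0 := notinL_neq0 hz; have hoff := notinL_offL hz.
have h0 := eB0_has_sum ht hoff; have h1 := eB1_has_sum ht hoff.
have := has_sumD (has_sumZ (- (2 * z)) h0) (has_sumZ (- z ^+ 2) h1).
rewrite /wp /wpe => h.
rewrite [X in _ + X](_ : _ = - (2 * z) * eB0 z tau + - z ^+ 2 * eB1 z tau).
  by rewrite exprVn; ring.
apply: csumE; apply: has_sum_ext h => p.
rewrite /term /latU; case: (eqVneq p (0, 0)) => [//|p0] /=.
  by rewrite !expr0n /= !(mul0r, mulr0, oppr0, addr0).
have -> : 2 * 2 *~ p.1 + 2 * (2 * tau) *~ p.2 = lat tau p.
  by rewrite /lat -(mulrzr (2 * 2)) -(mulrzr (2 * (2 * tau))); ring.
have l0 := lat_neq0 ht p0; have zl0 : z - lat tau p != 0 by rewrite subr_eq0 hoff.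
by rewrite sub0r; field; rewrite ?zl0 ?l0 ?oppr_eq0 ?l0.
Qed.

(* The half-periods 2, 2 + 2 tau, 2 tau carry the indices 1, 2, 3. *)
Definition hE1 tau : C := wpe 2 tau + weta tau.
Definition hE2 tau : C := wpe (2 + 2 * tau) tau + weta tau.
Definition hE3 tau : C := wpe (2 * tau) tau + weta tau.
Definition bP tau : C := wpe 1 tau - wpe 2 tau.
Definition bR tau : C := wpe tau tau - wpe 2 tau.

Section Derivatives.
Variables (tau : C) (ht : complex.Im tau != 0).

Let k0 : wkappa tau != 0 := wkappa_neq0 ht.

Lemma weta_der : has_der (@weta R) tau (wetat tau).
Proof.
have [g h] := wzeta_jet ht (notinL_2 ht) 0 1.
have /sjet_near/(_ _ (sjetZ 2^-1 h)) : (0 : R) < 1 by [].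
move=> h'; apply: (@sjet_has_der _ _ _ _ _ (2^-1 * g)).
apply: (sjet_eq (h' _ _)) => // [w _|].
  by rewrite /weta mul0r addr0 mul1r mulrC.
by rewrite /wetat mul0r mul1r add0r mulrC.
Qed.

Lemma wkappa_der : has_der (@wkappa R) tau 0.
Proof.
have [g h] := wzeta_jet ht (notinL_2tau ht) 2 1.
have hz : has_der (fun tau => wzeta (2 * tau) tau) tau (2 * - wpe (2 * tau) tau + 1 * wzetat (2 * tau) tau).
  apply: (@sjet_has_der _ _ _ _ _ g); apply: sjet_near ltr01 _ h => w _.
  by rewrite mul1r mulrDr.
apply: has_der_eq (has_derD (has_derM (has_der_id tau) weta_der)
  (has_derN (has_derM hz (has_der_cst 2^-1 tau)))) _.
by rewrite -[RHS](wkappat0 ht) /wkappat; field.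
Qed.

Lemma wpe_line_der (a c : C) : ~ inL tau (a + c * tau) ->
  has_der (fun tau => wpe (a + c * tau) tau) tau
    (c * wpe1 (a + c * tau) tau + wpet (a + c * tau) tau).
Proof.
move=> hz; have [g h] := wpe_jet ht hz c 1.
apply: (@sjet_has_der _ _ _ (wpe (a + c * tau) tau) _ g).
apply: (sjet_near ltr01 _ (sjet_eq h erefl _ erefl)) => [w _|].
  by rewrite mul1r mulrDr addrA.
by rewrite mul1r.
Qed.

(** The half-period moves with tau, but wp' vanishes there, so only the partial derivative in tau
    contributes. *)
Let half_der (a c : C) : ~ inL tau (a + c * tau) -> inL tau (a + c * tau + (a + c * tau)) ->
  has_der (fun tau => wpe (a + c * tau) tau + weta tau) tau
   (- ((wpe (a + c * tau) tau + weta tau) ^+ 2 - wpe2 (a + c * tau) tau / 2) / wkappa tau).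
Proof.
move=> h1 h2; apply: has_der_eq (has_derD (wpe_line_der h1) weta_der) _.
by rewrite wpe1_half // mulr0 add0r half_period_derive.
Qed.

Lemma hE1_der : has_der hE1 tau
  (- (hE1 tau * hE2 tau + hE1 tau * hE3 tau - hE2 tau * hE3 tau) / wkappa tau).
Proof.
have := @half_der 2 0; rewrite mul0r addr0 => /(_ (notinL_2 ht) (inL_22 tau)).
rewrite -wpe2_half1 // => h; apply: has_der_near ht _ (has_der_eq h _) => [u _|].
  by rewrite mul0r addr0.
by rewrite /hE1 /hE2 /hE3; congr (- _ / _); ring.
Qed.

Lemma hE2_der : has_der hE2 tau
  (- (hE1 tau * hE2 tau + hE2 tau * hE3 tau - hE1 tau * hE3 tau) / wkappa tau).
Proof.
have := @half_der 2 2; move=> /(_ (notinL_2D2tau ht) (inL_double3 tau)).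
rewrite -wpe2_half2 // => h; apply: has_der_eq h _.
by rewrite /hE1 /hE2 /hE3; congr (- _ / _); ring.
Qed.

Lemma hE3_der : has_der hE3 tau
  (- (hE1 tau * hE3 tau + hE2 tau * hE3 tau - hE1 tau * hE2 tau) / wkappa tau).
Proof.
have := @half_der 0 2; rewrite add0r => /(_ (notinL_2tau ht) (inL_22tau tau)).
rewrite -wpe2_half3 // => h; apply: has_der_near ht _ (has_der_eq h _) => [u _|].
  by rewrite add0r.
by rewrite /hE1 /hE2 /hE3; congr (- _ / _); ring.
Qed.

Let sub_addr (a b e : C) : a + e - (b + e) = a - b.
Proof. by ring. Qed.

Lemma hE12_neq : hE1 tau - hE2 tau != 0.
Proof. by rewrite /hE1 /hE2 sub_addr wpe_half12_neq. Qed.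

Lemma hE13_neq : hE1 tau - hE3 tau != 0.
Proof. by rewrite /hE1 /hE3 sub_addr wpe_half13_neq. Qed.

Lemma hE23_neq : hE2 tau - hE3 tau != 0.
Proof. by rewrite /hE2 /hE3 sub_addr wpe_half23_neq. Qed.

(** At the quarter-period 1 one has 1 + 2 = -1 modulo the period 4, so by evenness the two factors
    of the product formula coincide. [bR_sqr] is the same at tau. *)
Lemma bP_sqr : bP tau ^+ 2 = (hE1 tau - hE2 tau) * (hE1 tau - hE3 tau).
Proof.
have -> : (hE1 tau - hE2 tau) * (hE1 tau - hE3 tau) = wpe2 2 tau / 2.
  by rewrite -wpe2_half1 // /hE1 /hE2 /hE3; ring.
have n1 := notinL_1 ht; have nm1 : ~ inL tau (-1) by move=> /inLN; rewrite opprK.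
have e3 : 1 + 2 = - 1 + (2 + 2) :> C by ring.
have n3 : ~ inL tau (1 + 2) by rewrite e3; apply: notinL_ltr => //; exact: inL_22.
rewrite -(half_period_product ht (notinL_2 ht) (inL_22 tau) n1 n3) e3.
rewrite wpe_period ?(notinL_2 ht) //; [|exact: notinL_2|exact: inL_22].
by rewrite wpe_even // ?expr2 //; exact: notinL_offL.
Qed.

Lemma bR_sqr : (bR tau + (hE1 tau - hE3 tau)) ^+ 2 = (hE3 tau - hE1 tau) * (hE3 tau - hE2 tau).
Proof.
have -> : (hE3 tau - hE1 tau) * (hE3 tau - hE2 tau) = wpe2 (2 * tau) tau / 2.
  by rewrite -wpe2_half3 // /hE1 /hE2 /hE3; ring.
have -> : bR tau + (hE1 tau - hE3 tau) = wpe tau tau - wpe (2 * tau) tau.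
  by rewrite /bR /hE1 /hE3; ring.
have n1 := notinL_tau ht; have nm1 : ~ inL tau (- tau) by move=> /inLN; rewrite opprK.
have e3 : tau + 2 * tau = - tau + (2 * tau + 2 * tau) by ring.
have n3 : ~ inL tau (tau + 2 * tau) by rewrite e3; apply: notinL_ltr => //; exact: inL_22tau.
rewrite -(half_period_product ht (notinL_2tau ht) (inL_22tau tau) n1 n3) e3.
rewrite wpe_period //; [|exact: notinL_2tau|exact: inL_22tau].
by rewrite wpe_even // ?expr2 //; exact: notinL_offL.
Qed.

Lemma bP_neq0 : bP tau != 0.
Proof.
have : bP tau ^+ 2 != 0 by rewrite bP_sqr mulf_neq0 ?hE12_neq ?hE13_neq.
by rewrite expf_eq0.
Qed.

Let X := bP tau / bR tau.
Let al := hE1 tau - hE2 tau.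
Let be := hE1 tau - hE3 tau.

(** From (r + be)^2 = be (be - al) and p^2 = al be: the combination eliminates al, and with p = X r
    it becomes linear in be. *)
Lemma bR_quadratic : bR tau ^+ 2 + 2 * be * bR tau = - bP tau ^+ 2.
Proof.
have : (bR tau + be) ^+ 2 = be * (be - al) by rewrite bR_sqr /be /al; ring.
rewrite bP_sqr -/al -/be => h.
have -> : bR tau ^+ 2 + 2 * be * bR tau = (bR tau + be) ^+ 2 - be ^+ 2 by ring.
by rewrite h; ring.
Qed.

Lemma bR_neq0 : bR tau != 0.
Proof.
apply: contraNneq bP_neq0 => r0; have := bR_quadratic.
by rewrite r0 expr0n mulr0 add0r => /eqP; rewrite eq_sym oppr_eq0 expf_eq0.
Qed.

Lemma bP_X : bP tau = X * bR tau.
Proof. by rewrite /X divfK // bR_neq0. Qed.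

Lemma be_X : be = - bR tau * (1 + X ^+ 2) / 2.
Proof.
have := bR_quadratic; rewrite bP_X => h; have r0 := bR_neq0.
apply: (mulIf r0); have -> : be * bR tau = (bR tau ^+ 2 + 2 * be * bR tau - bR tau ^+ 2) / 2 by field.
by rewrite h; field.
Qed.

(** 1 + X^2 = 0 would force e1 = e3; [X_neq0] and [X2_neq0] exclude the other branch points, again
    because the e_i are distinct. *)
Lemma X1_neq0 : 1 + X ^+ 2 != 0.
Proof.
by apply: contra_neq hE13_neq => h; rewrite -/be be_X h mulr0 mul0r.
Qed.

Lemma X_neq0 : X != 0.
Proof. by rewrite mulf_neq0 ?bP_neq0 // invr_eq0 bR_neq0. Qed.

Lemma al_X : al = - 2 * X ^+ 2 * bR tau / (1 + X ^+ 2).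
Proof.
have x1 := X1_neq0; have b0 := hE13_neq; apply: (mulIf b0); rewrite -bP_sqr bP_X -/be be_X.
by field; rewrite x1.
Qed.

Lemma hE23_X : hE2 tau - hE3 tau = - bR tau * (1 - X ^+ 2) ^+ 2 / (2 * (1 + X ^+ 2)).
Proof.
have -> : hE2 tau - hE3 tau = be - al by rewrite /be /al; ring.
by rewrite be_X al_X; field; rewrite X1_neq0.
Qed.

Lemma X2_neq0 : 1 - X ^+ 2 != 0.
Proof.
by apply: contra_neq hE23_neq => h; rewrite hE23_X h expr0n mulr0 mul0r.
Qed.

(** Existence alone; the value is then read off from the differentiated quadratic relation. *)
Lemma bP_der0 : exists b, has_der bP tau b.
Proof.
have n1 : ~ inL tau (1 + 0 * tau) by rewrite mul0r addr0; exact: notinL_1.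
have n2 : ~ inL tau (2 + 0 * tau) by rewrite mul0r addr0; exact: notinL_2.
eexists; apply: has_der_near ht _ (has_derD (wpe_line_der n1) (has_derN (wpe_line_der n2))).
by move=> u _; rewrite !mul0r !addr0.
Qed.

Lemma bR_der0 : exists b, has_der bR tau b.
Proof.
have n1 : ~ inL tau (0 + 1 * tau) by rewrite mul1r add0r; exact: notinL_tau.
have n2 : ~ inL tau (2 + 0 * tau) by rewrite mul0r addr0; exact: notinL_2.
eexists; apply: has_der_near ht _ (has_derD (wpe_line_der n1) (has_derN (wpe_line_der n2))).
by move=> u _; rewrite mul0r mul1r add0r addr0.
Qed.

End Derivatives.

Definition bS tau : C := hE2 tau + hE3 tau.
Definition bX tau : C := bP tau / bR tau.

(** The Halphen system gives (E1 - E2)' = - 2 (E1 - E2) E3 / kappa and (E1 - E3)' = - 2 (E1 - E3) E2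
    / kappa, so differentiating [bP_sqr] yields 2 p p'. *)
Lemma bP_der tau : complex.Im tau != 0 ->
  has_der bP tau (- bP tau * bS tau / wkappa tau).
Proof.
move=> ht; have [b hb] := bP_der0 ht; have k0 := wkappa_neq0 ht.
have h1 := hE1_der ht; have h2 := hE2_der ht; have h3 := hE3_der ht.
have hr := has_derM (has_derD h1 (has_derN h2)) (has_derD h1 (has_derN h3)).
have := has_der_unique (has_derX hb) (has_der_near ht (fun u hu => esym (bP_sqr hu)) hr).
move=> hE; apply: (has_der_eq hb); have p0 := bP_neq0 ht.
have p20 : 2 * bP tau != 0 by rewrite mulf_neq0 // pnatr_eq0.
apply: (mulfI p20); rewrite hE.
have -> : 2 * bP tau * (- bP tau * bS tau / wkappa tau) = - 2 * bP tau ^+ 2 * bS tau / wkappa tau.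
  by ring.
by rewrite bP_sqr // /bS; field.
Qed.

End BurnsideDerivatives.

(** * The flow of x and the Schwarzian identity *)

Section SchwarzEquation.
Variable R : realType.
Local Notation C := R[i].
Implicit Types (tau : C).

(** The derivative of r comes from [bR_quadratic], where its coefficient 2 (r + be) = r (1 - x^2) is
    nonzero. In the quotient rule E2 and E3 survive only through E2 - E3, a multiple of r. *)
Lemma bX_der tau : complex.Im tau != 0 ->
  has_der (@bX R) tau (- bP tau * (1 - bX tau ^+ 2) / (2 * wkappa tau)).
Proof.
move=> ht; have [b hb] := bR_der0 ht; have k0 := wkappa_neq0 ht.
have r0 := bR_neq0 ht; have hp := bP_der ht.
have h1 := hE1_der ht; have h3 := hE3_der ht; have hbe := has_derD h1 (has_derN h3).
have hl := has_derD (has_derX hb) (has_derM (has_derM (has_der_cst 2 tau) hbe) hb).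
have hE := has_der_unique (has_der_near ht (fun u hu => bR_quadratic hu) hl) (has_derN (has_derX hp)).
have x1 := X1_neq0 ht; have x2 := X2_neq0 ht.
have beX := be_X ht; have dX := hE23_X ht; have pX := bP_X ht.
rewrite -/(bX tau) in x1 x2 beX dX pX.
have E1E : hE1 tau = hE3 tau - bR tau * (1 + bX tau ^+ 2) / 2.
  by rewrite -[LHS](subrK (hE3 tau)) beX; ring.
have E2E : hE2 tau = hE3 tau - bR tau * (1 - bX tau ^+ 2) ^+ 2 / (2 * (1 + bX tau ^+ 2)).
  by rewrite -[LHS](subrK (hE3 tau)) dX; ring.
have bE : b = 2 * bR tau * (bX tau ^+ 2 * bS tau - (1 + bX tau ^+ 2) * hE2 tau) /
   (wkappa tau * (1 - bX tau ^+ 2)).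
  have nz : bR tau * (1 - bX tau ^+ 2) != 0 by rewrite mulf_neq0.
  apply: (mulfI nz); apply/eqP; rewrite -subr_eq0; apply/eqP.
  move/eqP: hE; rewrite -subr_eq0 => /eqP <-.
  rewrite /bS E1E E2E pX.
  move: (hE3 tau) (bR tau) (bX tau) (wkappa tau) k0 r0 x1 x2 => e r x k k0 r0 x1 x2.
  by field; rewrite ?k0 ?x1 ?x2 ?r0.
apply: (has_der_eq (has_derM hp (has_derV r0 hb))).
rewrite bE /bS E2E pX.
move: (hE3 tau) (bR tau) (bX tau) (wkappa tau) k0 r0 x1 x2 => e r x k k0 r0 x1 x2.
by field; rewrite ?k0 ?x1 ?x2 ?r0.
Qed.

Lemma bS_der tau : complex.Im tau != 0 ->
  has_der (@bS R) tau (- 2 * hE2 tau * hE3 tau / wkappa tau).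
Proof.
move=> ht; apply: has_der_eq (has_derD (hE2_der ht) (hE3_der ht)) _.
by have k0 := wkappa_neq0 ht; field.
Qed.

(* Along the flow x' = bX1, x''/x' = bY and bY' = bY1, so that the Schwarzian of
   x is bY1 - bY^2 / 2. *)
Definition bX1 tau : C := - bP tau * (1 - bX tau ^+ 2) / (2 * wkappa tau).
Definition bY tau : C := (bX tau * bP tau - bS tau) / wkappa tau.
Definition bX2 tau : C := bX1 tau * bY tau.
Definition bY1 tau : C :=
  (- bP tau ^+ 2 * (1 - bX tau ^+ 2) / 2 - bX tau * bP tau * bS tau
   + 2 * hE2 tau * hE3 tau) / wkappa tau ^+ 2.

Lemma bX1_der tau : complex.Im tau != 0 -> has_der bX1 tau (bX2 tau).
Proof.
move=> ht; have k0 := wkappa_neq0 ht; have hx := bX_der ht; have hp := bP_der ht.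
have hk := wkappa_der ht.
have k20 : 2 * wkappa tau != 0 by rewrite mulf_neq0 // pnatr_eq0.
have hq := has_derD (has_der_cst 1 tau) (has_derN (has_derX hx)).
have hv := @has_derV _ (fun t => 2 * wkappa t) tau _ k20 (has_derM (has_der_cst 2 tau) hk).
have h := has_derM (has_derM (has_derN hp) hq) hv.
apply: (has_der_eq h); rewrite /bX2 /bX1 /bY.
move: (bP tau) (bX tau) (bS tau) (wkappa tau) k0 => p x s k k0; by field.
Qed.

Lemma bY_der tau : complex.Im tau != 0 -> has_der bY tau (bY1 tau).
Proof.
move=> ht; have k0 := wkappa_neq0 ht; have hx := bX_der ht; have hp := bP_der ht.
have hk := wkappa_der ht; have hs := bS_der ht.
have h := has_derM (has_derD (has_derM hx hp) (has_derN hs)) (has_derV k0 hk).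
apply: (has_der_eq h); rewrite /bY1.
move: (bP tau) (bX tau) (bS tau) (hE2 tau) (hE3 tau) (wkappa tau) k0 => p x s e2 e3 k k0.
by field.
Qed.

Lemma bX2_der tau : complex.Im tau != 0 ->
  has_der bX2 tau (bX1 tau * bY1 tau + bX2 tau * bY tau).
Proof. by move=> ht; apply: has_derM; [exact: bX1_der|exact: bY_der]. Qed.

Lemma bX1_neq0 tau : complex.Im tau != 0 -> bX1 tau != 0.
Proof.
move=> ht; rewrite /bX1 mulf_neq0 ?mulf_neq0 ?oppr_eq0 ?bP_neq0 ?X2_neq0 //.
by rewrite invr_eq0 mulf_neq0 ?wkappa_neq0 // pnatr_eq0.
Qed.

(** Eliminates i before [field] is called, by treating x - i and x + i as independent with product 1
    + x^2. *)
Lemma sum_inv_sqr_i (x : C) : 1 + x ^+ 2 != 0 ->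
  1 / (x - 'i%C) ^+ 2 + 1 / (x + 'i%C) ^+ 2 = (2 * x ^+ 2 - 2) / (1 + x ^+ 2) ^+ 2.
Proof.
move=> x1; have ii := sqr_i R.
have hm : (x - 'i%C) * (x + 'i%C) = 1 + x ^+ 2.
  have -> : (x - 'i%C) * (x + 'i%C) = x ^+ 2 - 'i%C ^+ 2 by ring.
  by rewrite ii opprK addrC.
have : (x - 'i%C) * (x + 'i%C) != 0 by rewrite hm.
rewrite mulf_eq0 negb_or => /andP[a0 b0].
rewrite -hm.
have -> : 2 * x ^+ 2 - 2 = (x - 'i%C) ^+ 2 + (x + 'i%C) ^+ 2.
  have -> : (x - 'i%C) ^+ 2 + (x + 'i%C) ^+ 2 = 2 * x ^+ 2 + 2 * 'i%C ^+ 2 by ring.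
  by rewrite ii; ring.
move: (x - 'i%C) (x + 'i%C) a0 b0 => a b a0 b0.
by field; rewrite ?a0 ?b0.
Qed.

(** The numerator collapses to - (p^2 + (E2 - E3)^2) / (2 kappa^2). With p and E2 - E3 both r times
    a function of x, the quotient depends on x alone. *)
Lemma schwarz_identity tau : complex.Im tau != 0 -> let x := bX tau in
  (bY1 tau - bY tau ^+ 2 / 2) / bX1 tau ^+ 2 =
  - (1 / 2) * (1 / x ^+ 2 + 1 / (x - 1) ^+ 2 + 1 / (x + 1) ^+ 2
               + 1 / (x - 'i%C) ^+ 2 + 1 / (x + 'i%C) ^+ 2
               - 4 * x ^+ 3 / (x ^+ 5 - x)).
Proof.
move=> ht x; have x1 := X1_neq0 ht; have x2 := X2_neq0 ht; have x0 := X_neq0 ht.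
have dX := hE23_X ht; have pX := bP_X ht; have r0 := bR_neq0 ht.
have k0 := wkappa_neq0 ht.
rewrite -/(bX tau) -/x in x1 x2 x0 dX pX.
rewrite -!addrA (addrA (1 / (x - 'i%C) ^+ 2)) sum_inv_sqr_i //.
have E2E : hE2 tau = hE3 tau - bR tau * (1 - x ^+ 2) ^+ 2 / (2 * (1 + x ^+ 2)).
  by rewrite -[LHS](subrK (hE3 tau)) dX; ring.
have xm : x - 1 != 0 by apply: contraNneq x2 => /eqP; rewrite subr_eq0 => /eqP ->; rewrite expr1n subrr.
have xp : x + 1 != 0.
  by apply: contraNneq x2 => /eqP; rewrite addr_eq0 => /eqP ->; rewrite sqrrN expr1n subrr.
have x5 : x ^+ 5 - x = x * (x - 1) * (x + 1) * (1 + x ^+ 2) by ring.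
have x12 : 1 - x ^+ 2 = - (x - 1) * (x + 1) by ring.
rewrite x5 /bY1 /bX1 /bY /bS -/x E2E pX x12.
move: (hE3 tau) (bR tau) (wkappa tau) k0 r0 => e r k k0 r0.
by field; rewrite ?k0 ?x1 ?x0 ?r0 ?xm ?xp.
Qed.

End SchwarzEquation.

(** * Derivatives of Burnside's function and the final equation *)

Section Burnside.
Variable R : realType.

Lemma burnside_bX (tau : R[i]^o) : complex.Im tau != 0 -> burnside tau = bX tau.
Proof.
move=> ht; have h1 := notinL_1 ht; have h2 := notinL_2 ht; have h3 := notinL_tau ht.
by rewrite /burnside /bX /bP /bR !wp_wpe.
Qed.

(** The derivative of order n has to be identified on the whole open set Im u <> 0, since the next
    one depends on its neighbouring values. *)
Lemma has_der_derive1n (tau : R[i]^o) (n : nat) (F G : R[i] -> R[i]) :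
  complex.Im tau != 0 ->
  (forall u, complex.Im u != 0 -> has_der F u (G u)) ->
  (forall u : R[i]^o, complex.Im u != 0 -> derive1n n (@burnside R) u = F u) ->
  derivable (derive1n n (@burnside R) : R[i]^o -> R[i]^o) tau 1 /\
  derive1n n.+1 (@burnside R) tau = G tau.
Proof.
move=> ht hFG hF.
have hd : has_der (derive1n n (@burnside R) : R[i] -> R[i]) tau (G tau).
  apply: has_der_near ht _ (hFG _ ht) => u hu; exact/esym/hF.
have hi := has_der_is_derive hd; split; first exact: ex_derive.
by rewrite derive1nS derive1E; exact: derive_val.
Qed.

End Burnside.

Theorem proposition1 (R : realType) (tau : R[i]^o)
    (htau : complex.Im tau != 0) :
  let x := burnside tau in
  let dx := derive1 (@burnside R) tau in
  [/\ (forall k : nat, (k < 3)%N ->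
         derivable (derive1n k (@burnside R) : R[i]^o -> R[i]^o) tau 1),
      dx != 0,
      x ^+ 5 - x != 0
    & schwarzian (@burnside R) tau / dx ^+ 2 =
      - (1 / 2) * (1 / x ^+ 2 + 1 / (x - 1) ^+ 2 + 1 / (x + 1) ^+ 2
                   + 1 / (x - 'i%C) ^+ 2 + 1 / (x + 'i%C) ^+ 2
                   - 4 * x ^+ 3 / (x ^+ 5 - x))].
Proof.
move=> x dx.
have D0 (u : R[i]^o) : complex.Im u != 0 -> derive1n 0 (@burnside R) u = bX u.
  exact: burnside_bX.
have D1 (u : R[i]^o) (hu : complex.Im u != 0) := has_der_derive1n hu (@bX_der R) D0.
have D2 (u : R[i]^o) (hu : complex.Im u != 0) :=
  has_der_derive1n hu (@bX1_der R) (fun v hv => (D1 v hv).2).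
have D3 (u : R[i]^o) (hu : complex.Im u != 0) :=
  has_der_derive1n hu (@bX2_der R) (fun v hv => (D2 v hv).2).
have xE : x = bX tau := burnside_bX htau.
have dxE : dx = bX1 tau := (D1 tau htau).2.
have dx0 : dx != 0 by rewrite dxE bX1_neq0.
split=> //.
- move=> [|[|[|//]]] _; [exact: (D1 tau htau).1|exact: (D2 tau htau).1|exact: (D3 tau htau).1].
- have x1 := X1_neq0 htau; have x2 := X2_neq0 htau; have x0 := X_neq0 htau.
  rewrite -/(bX tau) -xE in x1 x2 x0.
  have -> : x ^+ 5 - x = - x * (1 - x ^+ 2) * (1 + x ^+ 2) by ring.
  by rewrite !mulf_neq0 ?oppr_eq0.
- rewrite xE -schwarz_identity // -dxE /schwarzian -/dx (D2 tau htau).2 (D3 tau htau).2.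
  congr (_ / _); rewrite /bX2 -dxE; move: (bY1 tau) (bY tau) dx0 => a b.
  by move: (dx) => d d0; field.
Qed.
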